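(* Write $\Delta^h=\frac{\partial^2}{\partial u^2}-\frac{\partial^2}{\partial v^2}$ and consider, for functions $K(u,v)$, $\varkappa(u,v)$, the system $$(K^2+\varkappa^2)^{\frac14}\,\Delta^h\ln (K^2+\varkappa^2)^{\frac18}=K,\qquad (K^2+\varkappa^2)^{\frac14}\,\Delta^h\arctan\frac{\varkappa}{K}=2\varkappa. \qquad ( * )$$ (i) Let $M^2$ be a timelike surface in $\mathbb{R}^4_1$ with zero mean curvature, free of flat points. If $M^2$ is parametrized by canonical parameters $(u,v)$, then its Gauss curvature $K$ and its normal curvature $\varkappa$ satisfy $( * )$. (ii) Conversely, let $K(u,v)\neq 0$ and $\varkappa(u,v)\neq 0$ be two smooth functions defined in a domain $\mathcal{D}\subset\mathbb{R}^2$ and satisfying $( * )$. Then, locally (that is, on some subdomain $\mathcal{D}_0\subset\mathcal{D}$ around any given point of $\mathcal{D}$), there exists a unique (up to a motion in $\mathbb{R}^4_1$) timelike surface $M^2: z=z(u,v)$, $(u,v)\in\mathcal D_0$, in $\mathbb{R}^4_1$ with zero mean curvature, free of flat points, such that $K(u,v)$ and $\varkappa(u,v)$ are its Gauss curvature and the curvature of its normal connection, respectively, and $(u,v)$ are canonical parameters of $M^2$.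
   Context: $\mathbb{R}^4_1$ is Minkowski 4-space, i.e. $\mathbb{R}^4$ with the flat metric $\langle\,,\rangle = dx_1^2+dx_2^2+dx_3^2-dx_4^2$. A surface $M^2\subset\mathbb{R}^4_1$ is timelike if the induced metric has signature $(1,1)$; the normal planes are then positive definite. $\sigma$ denotes the second fundamental tensor (the normal component of the flat connection: $\nabla'_XY=\nabla_XY+\sigma(X,Y)$) and $D$ the normal connection. The mean curvature vector is $H=\frac12(-\sigma(x,x)+\sigma(y,y))$ for an orthonormal tangent frame with $\langle x,x\rangle=-1$, $\langle y,y\rangle=1$; ''zero mean curvature'' means $H=0$ at every point. Flat points: for a local parametrization $z(u,v)$ and an orthonormal normal frame $\{e_1,e_2\}$ put $c_{11}^k=\langle z_{uu},e_k\rangle$, $c_{12}^k=\langle z_{uv},e_k\rangle$, $c_{22}^k=\langle z_{vv},e_k\rangle$ and $\Delta_1=c_{11}^1c_{12}^2-c_{12}^1c_{11}^2$, $\Delta_2=c_{11}^1c_{22}^2-c_{22}^1c_{11}^2$, $\Delta_3=c_{12}^1c_{22}^2-c_{22}^1c_{12}^2$. The surface is free of flat points if $(\Delta_1,\Delta_2,\Delta_3)\neq(0,0,0)$ at each point. Geometric frame: on a timelike surface with $H=0$ free of flat points there is locally an orthonormal frame field $\{x,y,n_1,n_2\}$ ($x,y$ tangent, $\langle x,x\rangle=-1$, $\langle y,y\rangle=1$; $n_1,n_2$ normal) such that $$\sigma(x,x)=\nu\,n_1,\qquad \sigma(x,y)=\mu\,n_2,\qquad \sigma(y,y)=\nu\,n_1,$$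 with $\nu\mu\neq0$; the directions of $x$ and $y$ (the canonical directions) are uniquely determined. This is the geometric frame field, and $\nu,\mu$ are the geometric functions. Parameters $(u,v)$ are semi-canonical if the parametric lines are integral lines of the canonical directions; semi-canonical parameters are canonical if $$E=\langle z_u,z_u\rangle=-\frac{1}{\sqrt{\mu^2+\nu^2}},\qquad F=\langle z_u,z_v\rangle=0,\qquad G=\langle z_v,z_v\rangle=\frac{1}{\sqrt{\mu^2+\nu^2}}.$$ One takes $x=z_u/\sqrt{-E}$, $y=z_v/\sqrt{G}$. Curvature conventions: the Gauss curvature is $K=\langle\sigma(x,x),\sigma(y,y)\rangle-\langle\sigma(x,y),\sigma(x,y)\rangle=\nu^2-\mu^2$ (note the sign convention: there is no division by $\langle x,x\rangle\langle y,y\rangle=-1$). The normal curvature (curvature of the normal connection) is $\varkappa=\langle R^\bot(x,y)n_2,n_1\rangle=-2\nu\mu$, where $R^\bot(x,y)=D_xD_y-D_yD_x-D_{[x,y]}$, computed in a geometric frame field; the choice of signs of $n_1,n_2$ may change the sign of $\varkappa$, and a statement that a given function is the normal curvature means that it is so for a suitable choice of geometric frame field. *)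

(* Defs.v *)
From Stdlib Require Import Reals.
From Coquelicot Require Import Coquelicot.
Open Scope R_scope.

(** * Minkowski 4-space *)

Definition R4 : Type := (R * R * R * R)%type.

Definition mink (p q : R4) : R :=
  let '(p1, p2, p3, p4) := p in
  let '(q1, q2, q3, q4) := q in
  p1 * q1 + p2 * q2 + p3 * q3 - p4 * q4.

(* All isometries are allowed, not only the proper or orthochronous ones. *)
Definition motion (M : R4 -> R4) : Prop :=
  exists (L : R4 -> R4) (b : R4),
    (forall p q, L (plus p q) = plus (L p) (L q)) /\
    (forall (k : R) p, L (scal k p) = scal k (L p)) /\
    (forall p q, mink (L p) (L q) = mink p q) /\
    (forall p, M p = plus (L p) b).

(** * Plane domains, smooth functions and partial derivatives *)

Definition connected (D : R * R -> Prop) : Prop :=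
  forall U V : R * R -> Prop, open U -> open V ->
    (forall p, D p -> U p \/ V p) ->
    (exists p, D p /\ U p) -> (exists p, D p /\ V p) ->
    exists p, D p /\ U p /\ V p.

Definition plane_domain (D : R * R -> Prop) : Prop := open D /\ connected D.

Definition smooth (D : R * R -> Prop) (f : R -> R -> R) : Prop :=
  forall (n : nat) (u v : R), D (u, v) -> ex_diff_n f n u v.

Definition coord1 (p : R4) : R := fst (fst (fst p)).
Definition coord2 (p : R4) : R := snd (fst (fst p)).
Definition coord3 (p : R4) : R := snd (fst p).
Definition coord4 (p : R4) : R := snd p.

Definition smooth4 (D : R * R -> Prop) (w : R -> R -> R4) : Prop :=
  smooth D (fun u v => coord1 (w u v)) /\
  smooth D (fun u v => coord2 (w u v)) /\
  smooth D (fun u v => coord3 (w u v)) /\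
  smooth D (fun u v => coord4 (w u v)).

(* [m] derivatives in [u] and [k] derivatives in [v]. *)
Definition partial4 (m k : nat) (w : R -> R -> R4) (u v : R) : R4 :=
  (partial_derive m k (fun s t => coord1 (w s t)) u v,
   partial_derive m k (fun s t => coord2 (w s t)) u v,
   partial_derive m k (fun s t => coord3 (w s t)) u v,
   partial_derive m k (fun s t => coord4 (w s t)) u v).

(** * Tangent fields, second fundamental tensor, normal connection *)

Definition fE (z : R -> R -> R4) (u v : R) : R :=
  mink (partial4 1 0 z u v) (partial4 1 0 z u v).
Definition fF (z : R -> R -> R4) (u v : R) : R :=
  mink (partial4 1 0 z u v) (partial4 0 1 z u v).
Definition fG (z : R -> R -> R4) (u v : R) : R :=
  mink (partial4 0 1 z u v) (partial4 0 1 z u v).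

(* A tangent vector is given by its components (a, b) with respect to the
   coordinate basis (z_u, z_v), so that a tangent field is a map to [R * R]. *)
Definition tfield : Type := R -> R -> R * R.

Definition smooth_tfield (D : R * R -> Prop) (X : tfield) : Prop :=
  smooth D (fun u v => fst (X u v)) /\ smooth D (fun u v => snd (X u v)).

Definition push (z : R -> R -> R4) (a : R * R) (u v : R) : R4 :=
  plus (scal (fst a) (partial4 1 0 z u v)) (scal (snd a) (partial4 0 1 z u v)).

Definition along (X : tfield) (f : R -> R -> R) (u v : R) : R :=
  fst (X u v) * partial_derive 1 0 f u v + snd (X u v) * partial_derive 0 1 f u v.

Definition bracket (X Y : tfield) : tfield := fun u v =>
  (along X (fun s t => fst (Y s t)) u v - along Y (fun s t => fst (X s t)) u v,
   along X (fun s t => snd (Y s t)) u v - along Y (fun s t => snd (X s t)) u v).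

(* The flat connection of the ambient space, along the surface. *)
Definition flat_conn (X : tfield) (w : R -> R -> R4) (u v : R) : R4 :=
  plus (scal (fst (X u v)) (partial4 1 0 w u v))
       (scal (snd (X u v)) (partial4 0 1 w u v)).

(* Subtract from [w] the vector in span (z_u, z_v) having the same products with
   z_u and z_v; its components are found by inverting the matrix (E F; F G). *)
Definition normal_part (z : R -> R -> R4) (u v : R) (w : R4) : R4 :=
  let zu := partial4 1 0 z u v in
  let zv := partial4 0 1 z u v in
  let E := fE z u v in let F := fF z u v in let G := fG z u v in
  let W := E * G - F ^ 2 in
  minus w
    (plus (scal ((G * mink w zu - F * mink w zv) / W) zu)
          (scal ((E * mink w zv - F * mink w zu) / W) zv)).

Definition second_fund (z : R -> R -> R4) (X Y : tfield) (u v : R) : R4 :=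
  normal_part z u v (flat_conn X (fun s t => push z (Y s t) s t) u v).

Definition normal_conn (z : R -> R -> R4) (X : tfield) (xi : R -> R -> R4)
    (u v : R) : R4 :=
  normal_part z u v (flat_conn X xi u v).

Definition R_perp (z : R -> R -> R4) (X Y : tfield) (xi : R -> R -> R4)
    (u v : R) : R4 :=
  minus (minus (normal_conn z X (normal_conn z Y xi) u v)
               (normal_conn z Y (normal_conn z X xi) u v))
        (normal_conn z (bracket X Y) xi u v).

(** * Timelike surfaces with zero mean curvature, free of flat points *)

Definition orthonormal_tangent (z : R -> R -> R4) (a b : R * R) (u v : R) : Prop :=
  mink (push z a u v) (push z a u v) = -1 /\
  mink (push z b u v) (push z b u v) = 1 /\
  mink (push z a u v) (push z b u v) = 0.

Definition orthonormal_normal (z : R -> R -> R4) (e1 e2 : R4) (u v : R) : Prop :=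
  mink e1 e1 = 1 /\ mink e2 e2 = 1 /\ mink e1 e2 = 0 /\
  mink e1 (partial4 1 0 z u v) = 0 /\ mink e1 (partial4 0 1 z u v) = 0 /\
  mink e2 (partial4 1 0 z u v) = 0 /\ mink e2 (partial4 0 1 z u v) = 0.

(* Such a pair exists exactly when z_u, z_v are linearly independent and the
   induced metric has signature (1,1). *)
Definition timelike (D : R * R -> Prop) (z : R -> R -> R4) : Prop :=
  forall u v, D (u, v) -> exists a b : R * R, orthonormal_tangent z a b u v.

Definition mean_curvature (z : R -> R -> R4) (X Y : tfield) (u v : R) : R4 :=
  scal (1 / 2) (plus (opp (second_fund z X X u v)) (second_fund z Y Y u v)).

(* The fields need only be orthonormal at the point considered, so on a timelike
   surface there are always such fields, e.g. ones with constant components. *)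
Definition zero_mean_curvature (D : R * R -> Prop) (z : R -> R -> R4) : Prop :=
  forall (X Y : tfield) (u v : R),
    smooth_tfield D X -> smooth_tfield D Y -> D (u, v) ->
    orthonormal_tangent z (X u v) (Y u v) u v ->
    mean_curvature z X Y u v = zero.

Definition free_of_flat_points (D : R * R -> Prop) (z : R -> R -> R4) : Prop :=
  forall (u v : R) (e1 e2 : R4),
    D (u, v) -> orthonormal_normal z e1 e2 u v ->
    let c11 e := mink (partial4 2 0 z u v) e in
    let c12 e := mink (partial4 1 1 z u v) e in
    let c22 e := mink (partial4 0 2 z u v) e in
    let Delta1 := c11 e1 * c12 e2 - c12 e1 * c11 e2 in
    let Delta2 := c11 e1 * c22 e2 - c22 e1 * c11 e2 in
    let Delta3 := c12 e1 * c22 e2 - c22 e1 * c12 e2 in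
    (Delta1, Delta2, Delta3) <> (0, 0, 0).

Definition zmc_surface (D : R * R -> Prop) (z : R -> R -> R4) : Prop :=
  smooth4 D z /\ timelike D z /\ zero_mean_curvature D z /\
  free_of_flat_points D z.

(** * Geometric frames, canonical parameters, curvatures *)

Definition geometric_frame (D : R * R -> Prop) (z : R -> R -> R4)
    (X Y : tfield) (n1 n2 : R -> R -> R4) (nu mu : R -> R -> R) : Prop :=
  smooth_tfield D X /\ smooth_tfield D Y /\ smooth4 D n1 /\ smooth4 D n2 /\
  forall u v, D (u, v) ->
    orthonormal_tangent z (X u v) (Y u v) u v /\
    orthonormal_normal z (n1 u v) (n2 u v) u v /\
    second_fund z X X u v = scal (nu u v) (n1 u v) /\
    second_fund z X Y u v = scal (mu u v) (n2 u v) /\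
    second_fund z Y Y u v = scal (nu u v) (n1 u v) /\
    nu u v * mu u v <> 0.

Definition unit_u (z : R -> R -> R4) : tfield :=
  fun u v => (1 / sqrt (- fE z u v), 0).
Definition unit_v (z : R -> R -> R4) : tfield :=
  fun u v => (0, 1 / sqrt (fG z u v)).

(* With x and y given by the parameters, the normals n1 and n2 of a geometric
   frame are determined up to sign, by the second fundamental tensor; hence a
   frame defined on all of the connected set [D] is no restriction. *)
Definition canonical_parameters (D : R * R -> Prop) (z : R -> R -> R4) : Prop :=
  exists (n1 n2 : R -> R -> R4) (nu mu : R -> R -> R),
    geometric_frame D z (unit_u z) (unit_v z) n1 n2 nu mu /\
    forall u v, D (u, v) ->
      fE z u v = - (1 / sqrt (mu u v ^ 2 + nu u v ^ 2)) /\
      fF z u v = 0 /\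
      fG z u v = 1 / sqrt (mu u v ^ 2 + nu u v ^ 2).

(* For surfaces in canonical parameters; no division by <x,x><y,y> = -1. *)
Definition gauss_curvature (D : R * R -> Prop) (z : R -> R -> R4)
    (K : R -> R -> R) : Prop :=
  forall u v, D (u, v) ->
    let x := unit_u z in let y := unit_v z in
    K u v = mink (second_fund z x x u v) (second_fund z y y u v)
            - mink (second_fund z x y u v) (second_fund z x y u v).

(* For surfaces in canonical parameters; [kap] is determined up to sign, by the
   choice of the signs of n1 and n2. *)
Definition normal_curvature (D : R * R -> Prop) (z : R -> R -> R4)
    (kap : R -> R -> R) : Prop :=
  exists (n1 n2 : R -> R -> R4) (nu mu : R -> R -> R),
    geometric_frame D z (unit_u z) (unit_v z) n1 n2 nu mu /\
    forall u v, D (u, v) ->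
      kap u v = mink (R_perp z (unit_u z) (unit_v z) n2 u v) (n1 u v).

(** * The system of partial differential equations *)

Definition box (f : R -> R -> R) (u v : R) : R :=
  partial_derive 2 0 f u v - partial_derive 0 2 f u v.

Definition eq_gauss (K kap : R -> R -> R) (u v : R) : Prop :=
  Rpower (K u v ^ 2 + kap u v ^ 2) (1 / 4)
  * box (fun s t => ln (Rpower (K s t ^ 2 + kap s t ^ 2) (1 / 8))) u v
  = K u v.

(* [theta] stands for arctan (kap / K). *)
Definition eq_normal (K kap theta : R -> R -> R) (u v : R) : Prop :=
  Rpower (K u v ^ 2 + kap u v ^ 2) (1 / 4) * box theta u v = 2 * kap u v.

Definition arctan_quot (K kap : R -> R -> R) (u v : R) : R :=
  atan (kap u v / K u v).

(* The smooth determinations of arctan (kap / K): they also make sense where K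
   vanishes and kap does not, and differ from [arctan_quot] by a locally constant
   function where K does not vanish. *)
Definition arctan_determination (U : R * R -> Prop) (K kap theta : R -> R -> R)
    : Prop :=
  smooth U theta /\
  forall u v, U (u, v) -> K u v * sin (theta u v) = kap u v * cos (theta u v).

(* Main.v *)
Require Import Defs.
From Stdlib Require Import Reals.
From Coquelicot Require Import Coquelicot.
From Stdlib Require Import Lra Lia ClassicalEpsilon FunctionalExtensionality.
Open Scope R_scope.

(* Let d_s = d_u + d_v and d_t = d_u - d_v.  In canonical parameters z satisfies the wave
   equation, so a = d_s z and b = d_t z are null fields with d_t a = d_s b = 0; canonicity
   means |d_s a|^2 = |d_t b|^2 = 4.  With f = <a, b> = -2 / rho, rho^4 = K^2 + kap^2, the
   normal parts P, Q of d_s a, d_t b have product c = f_st - f_s f_t / f = 4 K / rho^2, which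
   is the Gauss equation, and d_t P = -(c/f) a, d_s Q = -(c/f) b; differentiating c twice
   gives the equation for arctan (kap / K).
   All coefficients of the linear system satisfied by (a, b, P, Q) depend on f only, so the
   linear map between two such frames is constant, which gives uniqueness.
   For existence, the system says that psi with psi^2 = (K + i kap) / rho^3 satisfies the
   Liouville equation psi psi_st - psi_s psi_t = -1.  Then psi_ss / psi depends on s only,
   hence psi(s,t) = xi1(s) eta2(t) - xi2(s) eta1(t) by constancy of Wronskians, and the null
   vectors of the spinors xi and eta are the required fields a and b. *)

(** The frame equations form an overdetermined linear system, whose direct integration would call
    for a Frobenius theorem. Null coordinates avoid it: each field that has to be integrated is
    constant along one of the two null directions, so every integration is a primitive of a function
    of one variable.

    The Liouville equation comes from a logarithm. Up to a constant, log psi = -1/2 ln rho + (i/2)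
    theta with theta an argument of K + i kap, so the two real equations together say d_s d_t log
    psi = -conj(K + i kap) / rho. Multiplication by psi^2 = (K + i kap) / rho^3 gives -(K^2 + kap^2)
    / rho^4 = -1.

    The spinors xi and eta have Wronskians -1 and 1, which yields |d_s a|^2 = |d_t b|^2 = 4, and
    |psi|^2 = 1 / rho yields f = -2 |psi|^2 = -2 / rho.

    The condition nu mu <> 0 enters through 16 - c^2 = 64 (nu mu)^2 / rho^4: it makes a, b, P, Q a
    basis, and it allows the division by 16 - c^2 in the second-order equation for c. *)

Definition du (f : R -> R -> R) (u v : R) : R := Derive (fun t => f t v) u.
Definition dv (f : R -> R -> R) (u v : R) : R := Derive (fun t => f u t) v.

(** A derivative along a constant vector: [(1, 1)] and [(1, -1)] give the two null derivatives,
    [(1, 0)] and [(0, 1)] the partial ones, so that one set of rules serves all four. *)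
Definition dir (h : R * R) (f : R -> R -> R) (u v : R) : R :=
  fst h * du f u v + snd h * dv f u v.

(** * Smooth functions of two real variables *)

Definition smooth_n (n : nat) (D : R * R -> Prop) (f : R -> R -> R) : Prop :=
  forall u v, D (u, v) -> ex_diff_n f n u v.

Lemma smooth_smooth_n (D : R * R -> Prop) (f : R -> R -> R) :
  smooth D f <-> forall n, smooth_n n D f.
Proof. unfold smooth, smooth_n; intuition. Qed.

Lemma smooth_n_0 (D : R * R -> Prop) (f : R -> R -> R) :
  smooth_n 0 D f <-> forall u v, D (u, v) -> continuity_2d_pt f u v.
Proof. unfold smooth_n; simpl; split; intros H u v Huv; specialize (H u v Huv); tauto. Qed.

Lemma smooth_n_S (n : nat) (D : R * R -> Prop) (f : R -> R -> R) :
  smooth_n (S n) D f <->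
  (forall u v, D (u, v) -> continuity_2d_pt f u v /\
     ex_derive (fun t => f t v) u /\ ex_derive (fun t => f u t) v) /\
  smooth_n n D (du f) /\ smooth_n n D (dv f).
Proof.
split.
- intros H; split; [ | split ]; intros u v Huv; specialize (H u v Huv); simpl in H; tauto.
- intros (H1 & H2 & H3) u v Huv; simpl.
  specialize (H1 u v Huv); specialize (H2 u v Huv); specialize (H3 u v Huv); tauto.
Qed.

Lemma smooth_n_cont (n : nat) (D : R * R -> Prop) (f : R -> R -> R) (u v : R) :
  smooth_n n D f -> D (u, v) -> continuity_2d_pt f u v.
Proof. intros H Huv; specialize (H u v Huv); destruct n; simpl in H; tauto. Qed.

Lemma smooth_n_le (n m : nat) (D : R * R -> Prop) (f : R -> R -> R) :
  (m <= n)%nat -> smooth_n n D f -> smooth_n m D f.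
Proof. intros Hm H u v Huv; apply ex_diff_n_m with n; auto. Qed.

Lemma smooth_cont (D : R * R -> Prop) (f : R -> R -> R) (u v : R) :
  smooth D f -> D (u, v) -> continuity_2d_pt f u v.
Proof. intros H Huv; exact (proj1 (smooth_n_0 D f) (proj1 (smooth_smooth_n D f) H 0%nat) u v Huv). Qed.

Lemma smooth_ex_du (D : R * R -> Prop) (f : R -> R -> R) (u v : R) :
  smooth D f -> D (u, v) -> ex_derive (fun t => f t v) u.
Proof. intros H Huv; specialize (H 1%nat u v Huv); simpl in H; tauto. Qed.

Lemma smooth_ex_dv (D : R * R -> Prop) (f : R -> R -> R) (u v : R) :
  smooth D f -> D (u, v) -> ex_derive (fun t => f u t) v.
Proof. intros H Huv; specialize (H 1%nat u v Huv); simpl in H; tauto. Qed.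

Lemma smooth_du (D : R * R -> Prop) (f : R -> R -> R) : smooth D f -> smooth D (du f).
Proof. intros H n u v Huv; specialize (H (S n) u v Huv); simpl in H; tauto. Qed.

Lemma smooth_dv (D : R * R -> Prop) (f : R -> R -> R) : smooth D f -> smooth D (dv f).
Proof. intros H n u v Huv; specialize (H (S n) u v Huv); simpl in H; tauto. Qed.

Lemma open_locally_2d (D : R * R -> Prop) (u v : R) :
  open D -> D (u, v) -> locally_2d (fun x y => D (x, y)) u v.
Proof.
intros HD Huv; apply locally_2d_locally.
apply (filter_imp D); [ intros [x y] | apply HD ]; auto.
Qed.

Lemma eq_on_locally_2d (D : R * R -> Prop) (f g : R -> R -> R) (u v : R) :
  open D -> (forall x y, D (x, y) -> f x y = g x y) -> D (u, v) ->
  locally_2d (fun x y => f x y = g x y) u v.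
Proof.
intros HD H Huv; apply locally_2d_impl with (2 := open_locally_2d D u v HD Huv).
apply locally_2d_forall; auto.
Qed.

Lemma smooth_n_ext (n : nat) (D : R * R -> Prop) (f g : R -> R -> R) :
  open D -> (forall x y, D (x, y) -> f x y = g x y) -> smooth_n n D f -> smooth_n n D g.
Proof.
intros HD H Hf u v Huv; apply ex_diff_n_ext_loc with f; auto.
now apply eq_on_locally_2d with D.
Qed.

Lemma smooth_ext (D : R * R -> Prop) (f g : R -> R -> R) :
  open D -> (forall x y, D (x, y) -> f x y = g x y) -> smooth D f -> smooth D g.
Proof.
intros HD H Hf; apply smooth_smooth_n; intros n; apply smooth_n_ext with f; auto.
now apply smooth_smooth_n.
Qed.

Lemma dir_ext (D : R * R -> Prop) (h : R * R) (f g : R -> R -> R) (u v : R) :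
  open D -> (forall x y, D (x, y) -> f x y = g x y) -> D (u, v) -> dir h f u v = dir h g u v.
Proof.
intros HD H Huv.
assert (L := eq_on_locally_2d D f g u v HD H Huv).
unfold dir, du, dv; f_equal; f_equal; apply Derive_ext_loc.
- exact (locally_2d_1d_const_y _ _ _ L).
- exact (locally_2d_1d_const_x _ _ _ L).
Qed.

Lemma smooth_subset (D D' : R * R -> Prop) (f : R -> R -> R) :
  (forall p, D' p -> D p) -> smooth D f -> smooth D' f.
Proof. intros H Hf n u v Huv; apply Hf; auto. Qed.

Lemma smooth_n_const (n : nat) (D : R * R -> Prop) (c : R) : smooth_n n D (fun _ _ => c).
Proof.
revert c; induction n; intros c.
- apply smooth_n_0; intros; apply continuity_2d_pt_const.
- assert (Eu : du (fun _ _ => c) = fun _ _ => 0).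
  { do 2 (apply functional_extensionality; intro); unfold du, dv; apply Derive_const. }
  assert (Ev : dv (fun _ _ => c) = fun _ _ => 0).
  { do 2 (apply functional_extensionality; intro); unfold du, dv; apply Derive_const. }
  apply smooth_n_S; rewrite Eu, Ev; repeat split; auto.
  + apply continuity_2d_pt_const.
  + apply ex_derive_const.
  + apply ex_derive_const.
Qed.

Lemma smooth_const (D : R * R -> Prop) (c : R) : smooth D (fun _ _ => c).
Proof. apply smooth_smooth_n; intros; apply smooth_n_const. Qed.

(** The partial derivatives may be given by formulas valid on [D] only: openness of [D] turns
    agreement on [D] into local agreement, which [ex_diff_n] respects. All closure proofs by
    induction on the order go through this step. *)
Lemma smooth_n_step (n : nat) (D : R * R -> Prop) (f fu fv : R -> R -> R) :
  open D ->
  (forall u v, D (u, v) -> continuity_2d_pt f u v /\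
     is_derive (fun t => f t v) u (fu u v) /\ is_derive (fun t => f u t) v (fv u v)) ->
  smooth_n n D fu -> smooth_n n D fv -> smooth_n (S n) D f.
Proof.
intros HD H Hu Hv; apply smooth_n_S; split; [ | split ].
- intros u v Huv; destruct (H u v Huv) as (Hc & H1 & H2).
  split; [ exact Hc | split; eexists; eassumption ].
- apply smooth_n_ext with fu; auto; intros u v Huv; destruct (H u v Huv) as (_ & H1 & _).
  symmetry; now apply is_derive_unique.
- apply smooth_n_ext with fv; auto; intros u v Huv; destruct (H u v Huv) as (_ & _ & H2).
  symmetry; now apply is_derive_unique.
Qed.

Lemma smooth_n_derive (n : nat) (D : R * R -> Prop) (f : R -> R -> R) :
  smooth_n (S n) D f ->
  (forall u v, D (u, v) -> is_derive (fun t => f t v) u (du f u v)) /\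
  (forall u v, D (u, v) -> is_derive (fun t => f u t) v (dv f u v)) /\
  smooth_n n D f /\ smooth_n n D (du f) /\ smooth_n n D (dv f).
Proof.
intros H; assert (H' := smooth_n_le (S n) n D f (le_S _ _ (le_n n)) H).
apply smooth_n_S in H; destruct H as (H & Hu & Hv).
split; [ | split; [ | now split ] ]; intros u v Huv; apply Derive_correct; apply (H u v Huv).
Qed.

Lemma smooth_n_proj1 (n : nat) (D : R * R -> Prop) : open D -> smooth_n n D (fun u _ => u).
Proof.
intros HD; destruct n.
- apply smooth_n_0; intros; apply continuity_2d_pt_id1.
- apply smooth_n_step with (fun _ _ => 1) (fun _ _ => 0); auto; try apply smooth_n_const.
  intros u v _; split; [ apply continuity_2d_pt_id1 | split; auto_derive; auto ].
Qed.

Lemma smooth_n_proj2 (n : nat) (D : R * R -> Prop) : open D -> smooth_n n D (fun _ v => v).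
Proof.
intros HD; destruct n.
- apply smooth_n_0; intros; apply continuity_2d_pt_id2.
- apply smooth_n_step with (fun _ _ => 0) (fun _ _ => 1); auto; try apply smooth_n_const.
  intros u v _; split; [ apply continuity_2d_pt_id2 | split; auto_derive; auto ].
Qed.

Lemma smooth_n_plus (n : nat) (D : R * R -> Prop) (f g : R -> R -> R) :
  open D -> smooth_n n D f -> smooth_n n D g -> smooth_n n D (fun u v => f u v + g u v).
Proof.
intros HD; revert f g; induction n; intros f g Hf Hg.
- rewrite smooth_n_0 in Hf, Hg |- *; intros; apply continuity_2d_pt_plus; auto.
- destruct (smooth_n_derive n D f Hf) as (fu & fv & f0 & f1 & f2).
  destruct (smooth_n_derive n D g Hg) as (gu & gv & g0 & g1 & g2).
  apply smooth_n_step with (fun u v => du f u v + du g u v) (fun u v => dv f u v + dv g u v); auto.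
  intros u v Huv; split; [ | split ].
  + apply continuity_2d_pt_plus; eapply smooth_n_cont; eauto.
  + apply (is_derive_plus (fun t => f t v) (fun t => g t v)); auto.
  + apply (is_derive_plus (fun t => f u t) (fun t => g u t)); auto.
Qed.

Lemma smooth_n_mult (n : nat) (D : R * R -> Prop) (f g : R -> R -> R) :
  open D -> smooth_n n D f -> smooth_n n D g -> smooth_n n D (fun u v => f u v * g u v).
Proof.
intros HD; revert f g; induction n; intros f g Hf Hg.
- rewrite smooth_n_0 in Hf, Hg |- *; intros; apply continuity_2d_pt_mult; auto.
- destruct (smooth_n_derive n D f Hf) as (fu & fv & f0 & f1 & f2).
  destruct (smooth_n_derive n D g Hg) as (gu & gv & g0 & g1 & g2).
  apply smooth_n_step with (fun u v => du f u v * g u v + f u v * du g u v)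
    (fun u v => dv f u v * g u v + f u v * dv g u v); auto.
  + intros u v Huv; split; [ | split ].
    * apply continuity_2d_pt_mult; eapply smooth_n_cont; eauto.
    * apply (is_derive_mult (fun t => f t v) (fun t => g t v)); auto; intros; apply Rmult_comm.
    * apply (is_derive_mult (fun t => f u t) (fun t => g u t)); auto; intros; apply Rmult_comm.
  + apply smooth_n_plus; auto.
  + apply smooth_n_plus; auto.
Qed.

(* [phi'] is only assumed to be smooth after composition with [f], so that the lemma can be
   used by induction on [n] when [phi'] is a function of [phi]. *)
Lemma smooth_n_comp_S (n : nat) (D : R * R -> Prop) (phi phi' : R -> R) (f : R -> R -> R) :
  open D -> smooth_n (S n) D f ->
  (forall u v, D (u, v) -> is_derive phi (f u v) (phi' (f u v))) ->
  smooth_n n D (fun u v => phi' (f u v)) ->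
  smooth_n (S n) D (fun u v => phi (f u v)).
Proof.
intros HD Hf Hphi Hphi'.
destruct (smooth_n_derive n D f Hf) as (fu & fv & f0 & f1 & f2).
apply smooth_n_step with (fun u v => du f u v * phi' (f u v)) (fun u v => dv f u v * phi' (f u v));
  auto using smooth_n_mult.
intros u v Huv; split; [ | split ].
- apply continuity_1d_2d_pt_comp; [ | now apply (smooth_n_cont (S n) D) ].
  apply continuity_pt_filterlim, (ex_derive_continuous phi); eexists; now apply Hphi.
- apply (is_derive_comp phi (fun t => f t v)); auto.
- apply (is_derive_comp phi (fun t => f u t)); auto.
Qed.

Lemma smooth_plus (D : R * R -> Prop) (f g : R -> R -> R) :
  open D -> smooth D f -> smooth D g -> smooth D (fun u v => f u v + g u v).
Proof. rewrite !smooth_smooth_n; intros; apply smooth_n_plus; auto. Qed.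

Lemma smooth_mult (D : R * R -> Prop) (f g : R -> R -> R) :
  open D -> smooth D f -> smooth D g -> smooth D (fun u v => f u v * g u v).
Proof. rewrite !smooth_smooth_n; intros; apply smooth_n_mult; auto. Qed.

Lemma smooth_opp (D : R * R -> Prop) (f : R -> R -> R) :
  open D -> smooth D f -> smooth D (fun u v => - f u v).
Proof.
intros; apply smooth_ext with (fun u v => (-1) * f u v); auto.
- intros; ring.
- apply smooth_mult; auto; apply smooth_const.
Qed.

Lemma smooth_minus (D : R * R -> Prop) (f g : R -> R -> R) :
  open D -> smooth D f -> smooth D g -> smooth D (fun u v => f u v - g u v).
Proof. intros; apply smooth_plus; auto; now apply smooth_opp. Qed.

Lemma smooth_n_inv (n : nat) (D : R * R -> Prop) (f : R -> R -> R) :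
  open D -> (forall u v, D (u, v) -> f u v <> 0) ->
  smooth_n n D f -> smooth_n n D (fun u v => / f u v).
Proof.
intros HD H0; induction n; intros Hf.
- rewrite smooth_n_0 in Hf |- *; intros; apply continuity_2d_pt_inv; auto.
- assert (Hf0 := smooth_n_le (S n) n D f (le_S _ _ (le_n n)) Hf).
  apply (smooth_n_comp_S n D Rinv (fun x => - (/ x * / x)) f); auto.
  + intros u v Huv; specialize (H0 u v Huv); auto_derive; auto.
    field; auto.
  + apply smooth_n_ext with (fun u v => (-1) * (/ f u v * / f u v)); auto.
    * intros; ring.
    * apply smooth_n_mult; auto; [ apply smooth_n_const | apply smooth_n_mult; auto ].
Qed.

Lemma smooth_inv (D : R * R -> Prop) (f : R -> R -> R) :
  open D -> (forall u v, D (u, v) -> f u v <> 0) -> smooth D f -> smooth D (fun u v => / f u v).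
Proof. rewrite !smooth_smooth_n; intros; apply smooth_n_inv; auto. Qed.

Lemma smooth_div (D : R * R -> Prop) (f g : R -> R -> R) :
  open D -> (forall u v, D (u, v) -> g u v <> 0) ->
  smooth D f -> smooth D g -> smooth D (fun u v => f u v / g u v).
Proof. intros; apply smooth_mult; auto; now apply smooth_inv. Qed.

Lemma smooth_exp (D : R * R -> Prop) (f : R -> R -> R) :
  open D -> smooth D f -> smooth D (fun u v => exp (f u v)).
Proof.
intros HD; rewrite !smooth_smooth_n; intros Hf n; induction n.
- apply smooth_n_0; intros; apply continuity_1d_2d_pt_comp.
  + apply derivable_continuous_pt, derivable_pt_exp.
  + now apply (smooth_n_cont 0 D).
- apply smooth_n_comp_S with exp; auto; intros; apply is_derive_exp.
Qed.

Lemma smooth_comp (D : R * R -> Prop) (phi phi' : R -> R) (f : R -> R -> R) :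
  open D -> smooth D f ->
  (forall u v, D (u, v) -> is_derive phi (f u v) (phi' (f u v))) ->
  smooth D (fun u v => phi' (f u v)) -> smooth D (fun u v => phi (f u v)).
Proof.
intros HD Hf H H'; rewrite smooth_smooth_n in Hf, H' |- *; intros n.
apply smooth_n_le with (S n); [ lia | ].
apply smooth_n_comp_S with phi'; auto.
Qed.

Lemma smooth_ln (D : R * R -> Prop) (f : R -> R -> R) :
  open D -> (forall u v, D (u, v) -> 0 < f u v) -> smooth D f -> smooth D (fun u v => ln (f u v)).
Proof.
intros HD Hp Hf; apply smooth_comp with (fun x => / x); auto.
- intros; apply is_derive_ln; auto.
- apply smooth_inv; auto; intros; specialize (Hp u v H); lra.
Qed.

Lemma smooth_sqrt (D : R * R -> Prop) (f : R -> R -> R) :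
  open D -> (forall u v, D (u, v) -> 0 < f u v) -> smooth D f -> smooth D (fun u v => sqrt (f u v)).
Proof.
intros HD Hp Hf; apply smooth_ext with (fun u v => exp (/ 2 * ln (f u v))); auto.
- intros; rewrite <- Rpower_sqrt; auto.
- apply smooth_exp; auto; apply smooth_mult; auto; [ apply smooth_const | now apply smooth_ln ].
Qed.

Lemma smooth_atan (D : R * R -> Prop) (f : R -> R -> R) :
  open D -> smooth D f -> smooth D (fun u v => atan (f u v)).
Proof.
intros HD Hf; apply smooth_comp with (fun x => / (1 + x * x)); auto.
- intros; replace (f u v * f u v) with (f u v ^ 2) by ring.
  apply is_derive_Reals, derivable_pt_lim_atan.
- apply smooth_inv; auto.
  + intros; nra.
  + apply smooth_plus; auto; [ apply smooth_const | now apply smooth_mult ].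
Qed.

(** Each of the two functions is, up to sign, the derivative of the other, so the induction on the
    order must carry both. *)
Lemma smooth_sin_cos (D : R * R -> Prop) (f : R -> R -> R) :
  open D -> smooth D f -> smooth D (fun u v => sin (f u v)) /\ smooth D (fun u v => cos (f u v)).
Proof.
rewrite !smooth_smooth_n; intros HD Hf.
assert (H : forall n, smooth_n n D (fun u v => sin (f u v)) /\ smooth_n n D (fun u v => cos (f u v))).
{ induction n as [ | n [I1 I2] ].
  - split; apply smooth_n_0; intros u v Huv; apply continuity_1d_2d_pt_comp;
      try (now apply (smooth_n_cont 0 D)); [ apply continuity_sin | apply continuity_cos ].
  - split.
    + apply smooth_n_comp_S with cos; auto; intros; apply is_derive_sin.
    + apply smooth_n_comp_S with (fun x => - sin x); auto.
      * intros; apply is_derive_cos.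
      * apply smooth_n_ext with (fun u v => (-1) * sin (f u v)); auto; [ intros; ring | ].
        apply smooth_n_mult; auto; apply smooth_n_const. }
split; intros n; apply H.
Qed.

(** * Calculus rules for directional derivatives *)

Lemma smooth_dir (D : R * R -> Prop) (h : R * R) (f : R -> R -> R) :
  open D -> smooth D f -> smooth D (dir h f).
Proof.
intros HD Hf; unfold dir; apply smooth_plus; auto; apply smooth_mult; auto;
  try apply smooth_const; [ now apply smooth_du | now apply smooth_dv ].
Qed.

Lemma dir_const (h : R * R) (c u v : R) : dir h (fun _ _ => c) u v = 0.
Proof. unfold dir, du, dv; rewrite !Derive_const; ring. Qed.

Lemma dir_is_derive (h : R * R) (f : R -> R -> R) (u v lu lv : R) :
  is_derive (fun t => f t v) u lu -> is_derive (fun t => f u t) v lv ->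
  dir h f u v = fst h * lu + snd h * lv.
Proof. intros Hu Hv; rewrite <- (is_derive_unique _ _ _ Hu), <- (is_derive_unique _ _ _ Hv); reflexivity. Qed.

Lemma smooth_is_derive (D : R * R -> Prop) (f : R -> R -> R) (u v : R) :
  smooth D f -> D (u, v) -> is_derive (fun t => f t v) u (du f u v) /\ is_derive (fun t => f u t) v (dv f u v).
Proof.
intros Hf Huv; split; apply Derive_correct; [ now apply (smooth_ex_du D) | now apply (smooth_ex_dv D) ].
Qed.

Lemma dir_plus (D : R * R -> Prop) (h : R * R) (f g : R -> R -> R) (u v : R) :
  smooth D f -> smooth D g -> D (u, v) ->
  dir h (fun x y => f x y + g x y) u v = dir h f u v + dir h g u v.
Proof.
intros Hf Hg Huv.
destruct (smooth_is_derive D f u v Hf Huv) as [fu fv], (smooth_is_derive D g u v Hg Huv) as [gu gv].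
rewrite (dir_is_derive h _ u v (du f u v + du g u v) (dv f u v + dv g u v)).
- unfold dir; ring.
- apply (is_derive_plus (fun t => f t v) (fun t => g t v)); auto.
- apply (is_derive_plus (fun t => f u t) (fun t => g u t)); auto.
Qed.

Lemma dir_opp (h : R * R) (f : R -> R -> R) (u v : R) :
  dir h (fun x y => - f x y) u v = - dir h f u v.
Proof.
assert (Hu := Derive_opp (fun t => f t v) u); assert (Hv := Derive_opp (fun t => f u t) v).
change (du (fun x y => - f x y) u v = - du f u v) in Hu.
change (dv (fun x y => - f x y) u v = - dv f u v) in Hv.
unfold dir; rewrite Hu, Hv; ring.
Qed.

Lemma dir_minus (D : R * R -> Prop) (h : R * R) (f g : R -> R -> R) (u v : R) :
  smooth D f -> smooth D g -> D (u, v) ->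
  dir h (fun x y => f x y - g x y) u v = dir h f u v - dir h g u v.
Proof.
intros Hf Hg Huv.
destruct (smooth_is_derive D f u v Hf Huv) as [fu fv], (smooth_is_derive D g u v Hg Huv) as [gu gv].
rewrite (dir_is_derive h _ u v (du f u v - du g u v) (dv f u v - dv g u v)).
- unfold dir; ring.
- apply (is_derive_minus (fun t => f t v) (fun t => g t v)); auto.
- apply (is_derive_minus (fun t => f u t) (fun t => g u t)); auto.
Qed.

Lemma dir_mult (D : R * R -> Prop) (h : R * R) (f g : R -> R -> R) (u v : R) :
  smooth D f -> smooth D g -> D (u, v) ->
  dir h (fun x y => f x y * g x y) u v = dir h f u v * g u v + f u v * dir h g u v.
Proof.
intros Hf Hg Huv.
destruct (smooth_is_derive D f u v Hf Huv) as [fu fv], (smooth_is_derive D g u v Hg Huv) as [gu gv].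
rewrite (dir_is_derive h _ u v (du f u v * g u v + f u v * du g u v) (dv f u v * g u v + f u v * dv g u v)).
- unfold dir; ring.
- apply (is_derive_mult (fun t => f t v) (fun t => g t v)); auto; intros; apply Rmult_comm.
- apply (is_derive_mult (fun t => f u t) (fun t => g u t)); auto; intros; apply Rmult_comm.
Qed.

Lemma dir_comp (D : R * R -> Prop) (h : R * R) (phi : R -> R) (l : R) (f : R -> R -> R) (u v : R) :
  smooth D f -> D (u, v) -> is_derive phi (f u v) l ->
  dir h (fun x y => phi (f x y)) u v = l * dir h f u v.
Proof.
intros Hf Huv Hl; destruct (smooth_is_derive D f u v Hf Huv) as [fu fv].
rewrite (dir_is_derive h _ u v (du f u v * l) (dv f u v * l)).
- unfold dir; ring.
- apply (is_derive_comp phi (fun t => f t v)); auto.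
- apply (is_derive_comp phi (fun t => f u t)); auto.
Qed.

Lemma dir_inv (D : R * R -> Prop) (h : R * R) (f : R -> R -> R) (u v : R) :
  smooth D f -> D (u, v) -> f u v <> 0 ->
  dir h (fun x y => / f x y) u v = - dir h f u v / (f u v) ^ 2.
Proof.
intros Hf Huv H0; rewrite (dir_comp D h Rinv (- / (f u v) ^ 2)); auto.
- field; auto.
- auto_derive; auto; field; auto.
Qed.

Lemma dir_div (D : R * R -> Prop) (h : R * R) (f g : R -> R -> R) (u v : R) :
  open D -> (forall x y, D (x, y) -> g x y <> 0) -> smooth D f -> smooth D g -> D (u, v) ->
  dir h (fun x y => f x y / g x y) u v =
  (dir h f u v * g u v - f u v * dir h g u v) / (g u v) ^ 2.
Proof.
intros HD H0 Hf Hg Huv; unfold Rdiv.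
rewrite (dir_mult D h f (fun x y => / g x y)); auto.
- rewrite (dir_inv D); auto; field; auto.
- now apply smooth_inv.
Qed.

Lemma dir_comm (D : R * R -> Prop) (h k : R * R) (f : R -> R -> R) (u v : R) :
  open D -> smooth D f -> D (u, v) -> dir h (dir k f) u v = dir k (dir h f) u v.
Proof.
intros HD Hf Huv.
assert (Hu := smooth_du D f Hf); assert (Hv := smooth_dv D f Hf).
assert (E : forall l m, dir l (dir m f) u v =
  fst l * (fst m * du (du f) u v + snd m * du (dv f) u v) +
  snd l * (fst m * dv (du f) u v + snd m * dv (dv f) u v)).
{ intros l m; unfold dir at 2.
  rewrite (dir_plus D); auto; try (apply smooth_mult; auto; apply smooth_const).
  rewrite (dir_mult D), (dir_mult D), !dir_const; auto; try apply smooth_const.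
  unfold dir; ring. }
assert (S : du (dv f) u v = dv (du f) u v).
{ apply Schwarz.
  - apply locally_2d_impl with (2 := open_locally_2d D u v HD Huv).
    apply locally_2d_forall; intros x y Hxy.
    repeat split.
    + now apply (smooth_ex_du D).
    + now apply (smooth_ex_dv D).
    + now apply (smooth_ex_du D (dv f)).
    + now apply (smooth_ex_dv D (du f)).
  - exact (smooth_cont D _ u v (smooth_du D _ Hv) Huv).
  - exact (smooth_cont D _ u v (smooth_dv D _ Hu) Huv). }
rewrite !E, S; ring.
Qed.

(** The Taylor remainder of order one is at most M r^2, where r is the distance to the base point in
    the maximum norm; for r < eps / (|M| + 1) this is at most eps r. The added 1 covers M = 0. *)
Lemma smooth_differentiable (D : R * R -> Prop) (f : R -> R -> R) (u v : R) :
  open D -> smooth D f -> D (u, v) -> differentiable_pt_lim f u v (du f u v) (dv f u v).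
Proof.
intros HD Hf Huv.
destruct (Taylor_Lagrange_2d f 1 u v) as [M HM].
{ apply locally_2d_impl with (2 := open_locally_2d D u v HD Huv).
  apply locally_2d_forall; intros x y Hxy; now apply Hf. }
intros eps.
assert (Hd : 0 < eps / (Rabs M + 1)).
{ apply Rdiv_lt_0_compat; [ apply cond_pos | ]; pose proof (Rabs_pos M); lra. }
destruct HM as [d H].
assert (Hm : 0 < Rmin d (eps / (Rabs M + 1))).
{ apply Rmin_glb_lt; auto; apply cond_pos. }
exists (mkposreal _ Hm); simpl; intros x y Hx Hy.
assert (Hx' := Rlt_le_trans _ _ _ Hx (Rmin_l _ _)).
assert (Hx2 := Rlt_le_trans _ _ _ Hx (Rmin_r _ _)).
assert (Hy' := Rlt_le_trans _ _ _ Hy (Rmin_l _ _)).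
assert (Hy2 := Rlt_le_trans _ _ _ Hy (Rmin_r _ _)).
specialize (H x y Hx' Hy').
set (r := Rmax (Rabs (x - u)) (Rabs (y - v))) in *.
assert (Hr : r < eps / (Rabs M + 1)) by (apply Rmax_lub_lt; auto).
assert (Hr0 : 0 <= r) by (apply Rle_trans with (2 := Rmax_l _ _); apply Rabs_pos).
replace (f x y - f u v - (du f u v * (x - u) + dv f u v * (y - v)))
  with (f x y - DL_pol 1 f u v (x - u) (y - v)).
- apply Rle_trans with (1 := H).
  assert (HM := Rle_abs M); assert (HM0 := Rabs_pos M).
  apply Rmult_lt_compat_r with (r := Rabs M + 1) in Hr; [ | lra ].
  replace (eps / (Rabs M + 1) * (Rabs M + 1)) with (pos eps) in Hr by (field; lra).
  nra.
- unfold DL_pol, differential; simpl.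
  unfold Binomial.C, partial_derive, du, dv; simpl.
  field.
Qed.

(** * Chain rule, and functions constant along a direction *)

Lemma is_derive_path (D : R * R -> Prop) (f : R -> R -> R) (x y : R -> R) (r lx ly : R) :
  open D -> smooth D f -> D (x r, y r) -> is_derive x r lx -> is_derive y r ly ->
  is_derive (fun t => f (x t) (y t)) r (dir (lx, ly) f (x r) (y r)).
Proof.
intros HD Hf Hr Hx Hy; apply is_derive_Reals; unfold dir; simpl.
rewrite (Rmult_comm lx), (Rmult_comm ly).
apply derivable_pt_lim_comp_2d; try now apply is_derive_Reals.
now apply (smooth_differentiable D).
Qed.

Lemma du_comp2 (D : R * R -> Prop) (f a b : R -> R -> R) (u v : R) :
  open D -> smooth D f -> D (a u v, b u v) ->
  ex_derive (fun t => a t v) u -> ex_derive (fun t => b t v) u ->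
  is_derive (fun t => f (a t v) (b t v)) u (du a u v * du f (a u v) (b u v) + du b u v * dv f (a u v) (b u v)).
Proof.
intros HD Hf Huv Ha Hb.
apply (is_derive_path D f (fun t => a t v) (fun t => b t v)); auto; now apply Derive_correct.
Qed.

Lemma dv_comp2 (D : R * R -> Prop) (f a b : R -> R -> R) (u v : R) :
  open D -> smooth D f -> D (a u v, b u v) ->
  ex_derive (fun t => a u t) v -> ex_derive (fun t => b u t) v ->
  is_derive (fun t => f (a u t) (b u t)) v (dv a u v * du f (a u v) (b u v) + dv b u v * dv f (a u v) (b u v)).
Proof.
intros HD Hf Huv Ha Hb.
apply (is_derive_path D f (fun t => a u t) (fun t => b u t)); auto; now apply Derive_correct.
Qed.

Lemma continuity_2d_pt_comp2 (f a b : R -> R -> R) (u v : R) :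
  continuity_2d_pt f (a u v) (b u v) -> continuity_2d_pt a u v -> continuity_2d_pt b u v ->
  continuity_2d_pt (fun x y => f (a x y) (b x y)) u v.
Proof.
intros Hf Ha Hb eps.
destruct (Hf eps) as [d Hd].
apply locally_2d_impl with (2 := locally_2d_and _ _ _ _ (Ha d) (Hb d)).
apply locally_2d_forall; intros x y [H1 H2]; auto.
Qed.

Lemma smooth_comp2 (D D' : R * R -> Prop) (f a b : R -> R -> R) :
  open D -> open D' -> smooth D f -> smooth D' a -> smooth D' b ->
  (forall u v, D' (u, v) -> D (a u v, b u v)) -> smooth D' (fun u v => f (a u v) (b u v)).
Proof.
intros HD HD' Hf Ha Hb Hab; rewrite smooth_smooth_n; intros n; revert f Hf.
assert (Hc : forall f, smooth D f -> forall u v, D' (u, v) ->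
  continuity_2d_pt (fun x y => f (a x y) (b x y)) u v).
{ intros f Hf u v Huv; apply continuity_2d_pt_comp2.
  - apply (smooth_cont D); auto.
  - now apply (smooth_cont D').
  - now apply (smooth_cont D'). }
induction n; intros f Hf.
- apply smooth_n_0; auto.
- assert (Hfu := IHn _ (smooth_du D f Hf)); assert (Hfv := IHn _ (smooth_dv D f Hf)).
  apply smooth_n_step with
    (fun u v => du a u v * du f (a u v) (b u v) + du b u v * dv f (a u v) (b u v))
    (fun u v => dv a u v * du f (a u v) (b u v) + dv b u v * dv f (a u v) (b u v)); auto.
  + intros u v Huv; split; [ now apply Hc | split ].
    * apply (du_comp2 D f a b u v); auto; now apply (smooth_ex_du D').
    * apply (dv_comp2 D f a b u v); auto; now apply (smooth_ex_dv D').
  + apply smooth_n_plus; auto; apply smooth_n_mult; auto;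
      apply smooth_smooth_n; now apply smooth_du.
  + apply smooth_n_plus; auto; apply smooth_n_mult; auto;
      apply smooth_smooth_n; now apply smooth_dv.
Qed.

Lemma dir_comp2 (D D' : R * R -> Prop) (h : R * R) (f a b : R -> R -> R) (u v : R) :
  open D -> smooth D f -> smooth D' a -> smooth D' b -> D' (u, v) -> D (a u v, b u v) ->
  dir h (fun x y => f (a x y) (b x y)) u v = dir (dir h a u v, dir h b u v) f (a u v) (b u v).
Proof.
intros HD Hf Ha Hb Huv Hab.
rewrite (dir_is_derive h _ u v _ _
  (du_comp2 D f a b u v HD Hf Hab (smooth_ex_du D' a u v Ha Huv) (smooth_ex_du D' b u v Hb Huv))
  (dv_comp2 D f a b u v HD Hf Hab (smooth_ex_dv D' a u v Ha Huv) (smooth_ex_dv D' b u v Hb Huv))).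
unfold dir; simpl; ring.
Qed.

Lemma constant_along (D : R * R -> Prop) (h : R * R) (f : R -> R -> R) (x y r : R) :
  open D -> smooth D f -> (forall u v, D (u, v) -> dir h f u v = 0) ->
  (forall t, 0 <= t <= 1 -> D (x + t * (r * fst h), y + t * (r * snd h))) ->
  f (x + r * fst h) (y + r * snd h) = f x y.
Proof.
intros HD Hf H0 Hp.
set (g := fun t => f (x + t * (r * fst h)) (y + t * (r * snd h))).
assert (E : g 0 = g 1).
{ apply (eq_is_derive g 0 1); [ | lra ].
  intros t Ht.
  replace (@zero R_NormedModule) with (dir (r * fst h, r * snd h) f (x + t * (r * fst h)) (y + t * (r * snd h))).
  - apply (is_derive_path D f (fun t => x + t * (r * fst h)) (fun t => y + t * (r * snd h))); auto.
    + auto_derive; auto; ring.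
    + auto_derive; auto; ring.
  - assert (H := H0 _ _ (Hp t Ht)); unfold dir in *; simpl in *.
    change (r * fst h * du f (x + t * (r * fst h)) (y + t * (r * snd h)) +
      r * snd h * dv f (x + t * (r * fst h)) (y + t * (r * snd h)) = 0).
    rewrite !Rmult_assoc, <- Rmult_plus_distr_l, H; ring. }
unfold g in E; rewrite !Rmult_0_l, !Rmult_1_l, !Rplus_0_r in E; auto.
Qed.

(** * Diamonds: squares in the null coordinates *)

Definition diamond (x0 y0 eps : R) (p : R * R) : Prop :=
  Rabs ((fst p + snd p) - (x0 + y0)) < eps /\ Rabs ((fst p - snd p) - (x0 - y0)) < eps.

Lemma open_diamond (x0 y0 eps : R) : open (diamond x0 y0 eps).
Proof.
intros [u v] [H1 H2]; simpl in *.
set (d := Rmin (eps - Rabs (u + v - (x0 + y0))) (eps - Rabs (u - v - (x0 - y0)))).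
assert (Hd : 0 < d / 2).
{ apply Rdiv_lt_0_compat; [ apply Rmin_glb_lt; lra | lra ]. }
assert (D1 := Rmin_l (eps - Rabs (u + v - (x0 + y0))) (eps - Rabs (u - v - (x0 - y0)))).
assert (D2 := Rmin_r (eps - Rabs (u + v - (x0 + y0))) (eps - Rabs (u - v - (x0 - y0)))).
fold d in D1, D2.
exists (mkposreal _ Hd); intros [a b] [Ha Hb].
change (Rabs (a - u) < d / 2) in Ha; change (Rabs (b - v) < d / 2) in Hb.
split; simpl.
- replace (a + b - (x0 + y0)) with ((u + v - (x0 + y0)) + ((a - u) + (b - v))) by ring.
  apply Rle_lt_trans with (1 := Rabs_triang _ _).
  pose proof (Rabs_triang (a - u) (b - v)); lra.
- replace (a - b - (x0 - y0)) with ((u - v - (x0 - y0)) + ((a - u) + - (b - v))) by ring.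
  apply Rle_lt_trans with (1 := Rabs_triang _ _).
  pose proof (Rabs_triang (a - u) (- (b - v))); rewrite Rabs_Ropp in *; lra.
Qed.

Lemma diamond_center (x0 y0 eps : R) : 0 < eps -> diamond x0 y0 eps (x0, y0).
Proof. intros H; split; simpl; rewrite Rminus_diag, Rabs_R0; auto. Qed.

Lemma Rabs_def1_iff (x m : R) : - m < x < m <-> Rabs x < m.
Proof. split; intros H; [ apply Rabs_def1; lra | apply Rabs_def2 in H; lra ]. Qed.

Lemma between_convex (m X X' t : R) :
  - m < X < m -> - m < X' < m -> 0 <= t <= 1 -> - m < X + t * (X' - X) < m.
Proof. intros H H' Ht; destruct (Rle_lt_dec t (1 / 2)); split; nra. Qed.

Lemma diamond_convex (x0 y0 eps a b a' b' t : R) :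
  diamond x0 y0 eps (a, b) -> diamond x0 y0 eps (a', b') -> 0 <= t <= 1 ->
  diamond x0 y0 eps (a + t * (a' - a), b + t * (b' - b)).
Proof.
unfold diamond; simpl; rewrite <- !Rabs_def1_iff; intros [H1 H2] [H3 H4] Ht; split.
- pose proof (between_convex _ _ _ t H1 H3 Ht); lra.
- pose proof (between_convex _ _ _ t H2 H4 Ht); lra.
Qed.

Lemma diamond_inside (D : R * R -> Prop) (x0 y0 : R) :
  open D -> D (x0, y0) ->
  exists eps, 0 < eps /\ forall q, diamond x0 y0 eps q -> D q.
Proof.
intros HD H; destruct (open_locally_2d D x0 y0 HD H) as [d Hd].
exists d; split; [ apply cond_pos | ].
intros [u v]; unfold diamond; simpl; rewrite <- !Rabs_def1_iff; intros [H1 H2].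
apply Hd; apply Rabs_def1; lra.
Qed.

(** Two points, one in [U] and one in [V], are joined by a segment inside the diamond. Were there no
    common point, the indicator [chi] of [U] along it would be locally constant, hence of zero
    derivative, although it is 1 at one end and 0 at the other. *)
Lemma connected_diamond (x0 y0 eps : R) : connected (diamond x0 y0 eps).
Proof.
intros U V HU HV Hcov [[a b] [Ha Ua]] [[a' b'] [Hb Vb]].
destruct (excluded_middle_informative (exists p, diamond x0 y0 eps p /\ U p /\ V p)) as [ | Hno ]; auto.
exfalso.
set (gam := fun t : R => (a + t * (a' - a), b + t * (b' - b))).
assert (Hg : forall t, filterlim gam (locally t) (locally (gam t))).
{ intros t P [d Hd].
  assert (C1 := ex_derive_continuous (fun t => a + t * (a' - a)) t ltac:(auto_derive; auto)).
  assert (C2 := ex_derive_continuous (fun t => b + t * (b' - b)) t ltac:(auto_derive; auto)).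
  assert (L1 := C1 _ (locally_ball _ d)); assert (L2 := C2 _ (locally_ball _ d)).
  unfold filtermap in L1, L2 |- *; assert (L := filter_and _ _ L1 L2).
  apply (filter_imp (F := locally t) _ _) with (2 := L).
  intros s [B1 B2]; apply Hd; now split. }
set (chi := fun t => if excluded_middle_informative (U (gam t)) then 1 else 0).
assert (E : chi 0 = chi 1).
{ apply (eq_is_derive chi 0 1); [ | lra ].
  intros t Ht.
  assert (Hin : diamond x0 y0 eps (gam t)) by now apply diamond_convex.
  assert (Hloc : locally t (fun s => diamond x0 y0 eps (gam s))).
  { apply (Hg t), (open_diamond x0 y0 eps (gam t) Hin). }
  assert (Hc : exists c, locally t (fun s => c = chi s)).
  { destruct (Hcov _ Hin) as [Ut | Vt].
    - exists 1; apply filter_imp with (fun s => U (gam s)); [ | now apply (Hg t), HU ].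
      intros s Hs; unfold chi; destruct excluded_middle_informative; tauto.
    - exists 0; apply filter_imp with (fun s => V (gam s) /\ diamond x0 y0 eps (gam s)).
      + intros s [Hs Hs']; unfold chi; destruct excluded_middle_informative; auto.
        exfalso; apply Hno; exists (gam s); auto.
      + apply filter_and; auto; now apply (Hg t), HV. }
  destruct Hc as [c Hc].
  apply is_derive_ext_loc with (fun _ => c); auto.
  apply (is_derive_const (V := R_NormedModule)). }
assert (G0 : gam 0 = (a, b)) by (unfold gam; f_equal; ring).
assert (G1 : gam 1 = (a', b')) by (unfold gam; f_equal; ring).
unfold chi in E; rewrite G0, G1 in E.
do 2 destruct excluded_middle_informative; try lra; try tauto.
apply Hno; exists (a', b'); auto.
Qed.

(* For [e = 1] or [e = -1], the point with the same value of [u + e * v] as [(u, v)]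
   and the same value of [u - e * v] as the center. *)
Definition ret1 (x0 y0 e u v : R) : R := (u + e * v + (x0 - e * y0)) / 2.
Definition ret2 (x0 y0 e u v : R) : R := e * (u + e * v - (x0 - e * y0)) / 2.

Lemma diamond_ret (x0 y0 eps e u v : R) :
  e = 1 \/ e = -1 -> diamond x0 y0 eps (u, v) ->
  diamond x0 y0 eps (ret1 x0 y0 e u v, ret2 x0 y0 e u v).
Proof.
unfold diamond, ret1, ret2; simpl; intros He [H1 H2].
apply Rabs_def2 in H1, H2; destruct He; subst e; split; apply Rabs_def1; lra.
Qed.

(** This is what diamonds are made for: the segment in the direction [(1, - e)] from a point to its
    retract stays inside by convexity, so a vanishing derivative in that direction makes the
    function depend on u + e v alone, on the whole diamond. *)
Lemma eq_ret (x0 y0 eps e : R) (f : R -> R -> R) (u v : R) :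
  e = 1 \/ e = -1 -> smooth (diamond x0 y0 eps) f ->
  (forall x y, diamond x0 y0 eps (x, y) -> dir (1, - e) f x y = 0) ->
  diamond x0 y0 eps (u, v) -> f u v = f (ret1 x0 y0 e u v) (ret2 x0 y0 e u v).
Proof.
intros He Hf H0 Huv.
assert (He2 : e * e = 1) by (destruct He; subst e; ring).
(* Moving by [r] along [(1, - e)] changes u - e v by 2 r, because e^2 = 1. *)
set (r := (u - e * v - (x0 - e * y0)) / 2).
assert (E1 : u = ret1 x0 y0 e u v + r * fst (1, - e)) by (unfold ret1, r; simpl; field).
assert (E2 : v = ret2 x0 y0 e u v + r * snd (1, - e)).
{ unfold ret2, r; simpl; transitivity ((e * e) * v); [ rewrite He2; ring | field ]. }
transitivity (f (ret1 x0 y0 e u v + r * fst (1, - e)) (ret2 x0 y0 e u v + r * snd (1, - e))).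
{ now rewrite <- E1, <- E2. }
apply (constant_along (diamond x0 y0 eps)); auto.
- apply open_diamond.
- intros t Ht.
  assert (H := diamond_convex _ _ _ _ _ _ _ _ (diamond_ret x0 y0 eps e u v He Huv) Huv Ht).
  replace (r * fst (1, - e)) with (u - ret1 x0 y0 e u v) by lra.
  replace (r * snd (1, - e)) with (v - ret2 x0 y0 e u v) by lra.
  exact H.
Qed.

(** Two successive retractions, with [e = 1] and then [e = -1], lead from any point to the
    center. *)
Lemma diamond_constant (x0 y0 eps : R) (f : R -> R -> R) (u v : R) :
  smooth (diamond x0 y0 eps) f ->
  (forall x y, diamond x0 y0 eps (x, y) -> dir (1, 1) f x y = 0) ->
  (forall x y, diamond x0 y0 eps (x, y) -> dir (1, -1) f x y = 0) ->
  diamond x0 y0 eps (u, v) -> f u v = f x0 y0.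
Proof.
intros Hf H1 H2 Huv.
assert (L := diamond_ret x0 y0 eps 1 u v (or_introl eq_refl) Huv).
rewrite (eq_ret x0 y0 eps 1 f u v); auto.
rewrite (eq_ret x0 y0 eps (-1) f _ _); auto.
- f_equal; unfold ret1, ret2; field.
- intros x y Hxy; replace (- (-1)) with 1 by ring; auto.
Qed.

Lemma smooth_affine (D : R * R -> Prop) (a b c : R) : open D -> smooth D (fun u v => a * u + b * v + c).
Proof.
intros HD; repeat apply smooth_plus; auto; try apply smooth_mult; auto; try apply smooth_const;
  apply smooth_smooth_n; intros n; [ now apply smooth_n_proj1 | now apply smooth_n_proj2 ].
Qed.

Lemma dir_affine (h : R * R) (a b c u v : R) :
  dir h (fun x y => a * x + b * y + c) u v = a * fst h + b * snd h.
Proof.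
rewrite (dir_is_derive h _ u v a b); [ ring | | ]; auto_derive; auto; ring.
Qed.

Lemma smooth_ret1 (D : R * R -> Prop) (x0 y0 e : R) : open D -> smooth D (ret1 x0 y0 e).
Proof.
intros HD; apply smooth_ext with (fun u v => / 2 * u + e / 2 * v + (x0 - e * y0) / 2); auto.
- intros; unfold ret1; field.
- now apply smooth_affine.
Qed.

Lemma smooth_ret2 (D : R * R -> Prop) (x0 y0 e : R) : open D -> smooth D (ret2 x0 y0 e).
Proof.
intros HD; apply smooth_ext with (fun u v => e / 2 * u + (e * e / 2) * v + - e * (x0 - e * y0) / 2); auto.
- intros; unfold ret2; field.
- now apply smooth_affine.
Qed.

Lemma smooth_ret (x0 y0 eps e : R) (f : R -> R -> R) :
  e = 1 \/ e = -1 -> smooth (diamond x0 y0 eps) f ->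
  smooth (diamond x0 y0 eps) (fun u v => f (ret1 x0 y0 e u v) (ret2 x0 y0 e u v)).
Proof.
intros He Hf; assert (HD := open_diamond x0 y0 eps).
apply (smooth_comp2 (diamond x0 y0 eps)); auto.
- now apply smooth_ret1.
- now apply smooth_ret2.
- intros; now apply diamond_ret.
Qed.

Lemma dir_ret (x0 y0 eps e : R) (f : R -> R -> R) (u v : R) :
  e = 1 \/ e = -1 -> smooth (diamond x0 y0 eps) f -> diamond x0 y0 eps (u, v) ->
  dir (1, e) (fun x y => f (ret1 x0 y0 e x y) (ret2 x0 y0 e x y)) u v =
    dir (1, e) f (ret1 x0 y0 e u v) (ret2 x0 y0 e u v) /\
  dir (1, - e) (fun x y => f (ret1 x0 y0 e x y) (ret2 x0 y0 e x y)) u v = 0.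
Proof.
intros He Hf Huv; assert (HD := open_diamond x0 y0 eps).
assert (E1 : forall h, dir h (ret1 x0 y0 e) u v = (fst h + e * snd h) / 2).
{ intros h; rewrite (dir_ext (fun _ => True) h _ (fun u v => / 2 * u + e / 2 * v + (x0 - e * y0) / 2)).
  - rewrite dir_affine; field.
  - apply open_true.
  - intros; unfold ret1; field.
  - auto. }
assert (E2 : forall h, dir h (ret2 x0 y0 e) u v = e * (fst h + e * snd h) / 2).
{ intros h; rewrite (dir_ext (fun _ => True) h _ (fun u v => e / 2 * u + (e * e / 2) * v + - e * (x0 - e * y0) / 2)).
  - rewrite dir_affine; field.
  - apply open_true.
  - intros; unfold ret2; field.
  - auto. }
assert (Hr := diamond_ret x0 y0 eps e u v He Huv).
split; rewrite (dir_comp2 (diamond x0 y0 eps) (diamond x0 y0 eps)); auto;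
  try (now apply smooth_ret1); try (now apply smooth_ret2);
  rewrite E1, E2; unfold dir; simpl; destruct He; subst e; field.
Qed.

(** Since [g] is a function [phi] of u + e v alone, a primitive of [phi] composed with u + e v does
    it. The only integral of the whole development is taken here. *)
Lemma diamond_antiderivative (x0 y0 eps e : R) (g : R -> R -> R) :
  e = 1 \/ e = -1 -> smooth (diamond x0 y0 eps) g ->
  (forall u v, diamond x0 y0 eps (u, v) -> dir (1, - e) g u v = 0) ->
  exists G, smooth (diamond x0 y0 eps) G /\
    forall h u v, diamond x0 y0 eps (u, v) -> dir h G u v = (fst h + e * snd h) * g u v.
Proof.
intros He Hg H0; assert (HD := open_diamond x0 y0 eps).
set (s0 := x0 + e * y0); set (t0 := x0 - e * y0).
(* The point with u + e v = s and u - e v = t0: [phi] is [g] on the null slice through the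
   center. *)
set (phi := fun s => g ((s + t0) / 2) (e * (s - t0) / 2)).
assert (Hin : forall s, Rabs (s - s0) < eps -> diamond x0 y0 eps ((s + t0) / 2, e * (s - t0) / 2)).
{ unfold diamond, s0, t0; simpl; intros s Hs.
  assert (0 < eps) by (pose proof (Rabs_pos (s - (x0 + e * y0))); lra).
  apply Rabs_def2 in Hs; destruct He; subst e; split; apply Rabs_def1; lra. }
assert (Hc : forall s, Rabs (s - s0) < eps -> continuous phi s).
{ intros s Hs; apply (ex_derive_continuous phi); eexists.
  apply (is_derive_path (diamond x0 y0 eps) g (fun s => (s + t0) / 2) (fun s => e * (s - t0) / 2)); auto.
  - auto_derive; auto.
  - auto_derive; auto. }
assert (Hs : forall s, Rabs (s - s0) < eps -> is_derive (fun s => RInt phi s0 s) s (phi s)).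
{ intros s Hs; apply (is_derive_RInt phi _ s0); [ | now apply Hc ].
  assert (Hd : 0 < eps - Rabs (s - s0)) by lra.
  exists (mkposreal _ Hd); intros s' Hs'.
  change (Rabs (s' - s) < eps - Rabs (s - s0)) in Hs'.
  apply (RInt_correct phi), (ex_RInt_continuous phi).
  intros x [Hx1 Hx2]; apply Hc.
  assert (Rabs (s' - s0) < eps).
  { replace (s' - s0) with ((s' - s) + (s - s0)) by ring.
    apply Rle_lt_trans with (1 := Rabs_triang _ _); lra. }
  apply Rabs_def2 in H; unfold Rmin, Rmax in *.
  assert (0 < eps) by lra.
  apply Rabs_def1; destruct (Rle_dec s0 s'); lra. }
assert (Hb : forall u v, diamond x0 y0 eps (u, v) -> Rabs (1 * u + e * v + 0 - s0) < eps).
{ unfold diamond, s0; simpl; intros u v [H1 H2].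
  destruct He; subst e; [ clear H2 | clear H1 ].
  - replace (1 * u + 1 * v + 0 - (x0 + 1 * y0)) with (u + v - (x0 + y0)) by ring; auto.
  - replace (1 * u + (-1) * v + 0 - (x0 + (-1) * y0)) with (u - v - (x0 - y0)) by ring; auto. }
assert (Hphi : forall u v, diamond x0 y0 eps (u, v) -> g u v = phi (1 * u + e * v + 0)).
{ intros u v Huv; rewrite (eq_ret x0 y0 eps e g); auto.
  unfold phi, ret1, ret2, t0; f_equal; field. }
exists (fun u v => RInt phi s0 (1 * u + e * v + 0)); split.
- apply (smooth_comp (diamond x0 y0 eps) (fun s => RInt phi s0 s) phi (fun u v => 1 * u + e * v + 0)); auto.
  + now apply smooth_affine.
  + apply smooth_ext with g; auto.
- intros h u v Huv.
  rewrite (dir_comp (diamond x0 y0 eps) h (fun s => RInt phi s0 s) (phi (1 * u + e * v + 0))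
    (fun u v => 1 * u + e * v + 0)); auto.
  + rewrite dir_affine, <- Hphi; auto; ring.
  + now apply smooth_affine.
Qed.

(** * Minkowski products and vector fields *)

Lemma R4_ext (p q : R4) :
  coord1 p = coord1 q -> coord2 p = coord2 q -> coord3 p = coord3 q -> coord4 p = coord4 q -> p = q.
Proof. destruct p as [[[]]], q as [[[]]]; unfold coord1, coord2, coord3, coord4; simpl; congruence. Qed.

Lemma mink_coord (p q : R4) :
  mink p q = coord1 p * coord1 q + coord2 p * coord2 q + coord3 p * coord3 q - coord4 p * coord4 q.
Proof. destruct p as [[[]]], q as [[[]]]; reflexivity. Qed.

Lemma coord_plus (p q : R4) :
  coord1 (plus p q) = coord1 p + coord1 q /\ coord2 (plus p q) = coord2 p + coord2 q /\
  coord3 (plus p q) = coord3 p + coord3 q /\ coord4 (plus p q) = coord4 p + coord4 q.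
Proof. repeat split; reflexivity. Qed.

Lemma coord_scal (k : R) (p : R4) :
  coord1 (scal k p) = k * coord1 p /\ coord2 (scal k p) = k * coord2 p /\
  coord3 (scal k p) = k * coord3 p /\ coord4 (scal k p) = k * coord4 p.
Proof. repeat split; reflexivity. Qed.

Lemma mink_sym (p q : R4) : mink p q = mink q p.
Proof. rewrite !mink_coord; ring. Qed.

Lemma mink_plus_l (p q r : R4) : mink (plus p q) r = mink p r + mink q r.
Proof.
rewrite !mink_coord; destruct (coord_plus p q) as (-> & -> & -> & ->); ring.
Qed.

Lemma mink_plus_r (p q r : R4) : mink r (plus p q) = mink r p + mink r q.
Proof. rewrite !(mink_sym r); apply mink_plus_l. Qed.

Lemma mink_scal_l (k : R) (p r : R4) : mink (scal k p) r = k * mink p r.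
Proof.
rewrite !mink_coord; destruct (coord_scal k p) as (-> & -> & -> & ->); ring.
Qed.

Lemma mink_scal_r (k : R) (p r : R4) : mink r (scal k p) = k * mink r p.
Proof. rewrite !(mink_sym r); apply mink_scal_l. Qed.

Lemma R4_opp_scal (p : R4) : opp p = scal (-1) p.
Proof.
apply R4_ext.
- change (- coord1 p = -1 * coord1 p); ring.
- change (- coord2 p = -1 * coord2 p); ring.
- change (- coord3 p = -1 * coord3 p); ring.
- change (- coord4 p = -1 * coord4 p); ring.
Qed.

Lemma R4_minus_scal (p q : R4) : minus p q = plus p (scal (-1) q).
Proof. unfold minus; now rewrite R4_opp_scal. Qed.

Ltac R4_coords :=
  repeat match goal with
  | |- context [coord1 (@plus ?G ?p ?q)] => change (coord1 (@plus G p q)) with (coord1 p + coord1 q)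
  | |- context [coord1 (@minus ?G ?p ?q)] => change (coord1 (@minus G p q)) with (coord1 p - coord1 q)
  | |- context [coord1 (@scal ?K ?G ?k ?p)] => change (coord1 (@scal K G k p)) with (k * coord1 p)
  | |- context [coord1 (@opp ?G ?p)] => change (coord1 (@opp G p)) with (- coord1 p)
  | |- context [coord1 (@zero ?G)] => change (coord1 (@zero G)) with 0
  | |- context [coord2 (@plus ?G ?p ?q)] => change (coord2 (@plus G p q)) with (coord2 p + coord2 q)
  | |- context [coord2 (@minus ?G ?p ?q)] => change (coord2 (@minus G p q)) with (coord2 p - coord2 q)
  | |- context [coord2 (@scal ?K ?G ?k ?p)] => change (coord2 (@scal K G k p)) with (k * coord2 p)
  | |- context [coord2 (@opp ?G ?p)] => change (coord2 (@opp G p)) with (- coord2 p)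
  | |- context [coord2 (@zero ?G)] => change (coord2 (@zero G)) with 0
  | |- context [coord3 (@plus ?G ?p ?q)] => change (coord3 (@plus G p q)) with (coord3 p + coord3 q)
  | |- context [coord3 (@minus ?G ?p ?q)] => change (coord3 (@minus G p q)) with (coord3 p - coord3 q)
  | |- context [coord3 (@scal ?K ?G ?k ?p)] => change (coord3 (@scal K G k p)) with (k * coord3 p)
  | |- context [coord3 (@opp ?G ?p)] => change (coord3 (@opp G p)) with (- coord3 p)
  | |- context [coord3 (@zero ?G)] => change (coord3 (@zero G)) with 0
  | |- context [coord4 (@plus ?G ?p ?q)] => change (coord4 (@plus G p q)) with (coord4 p + coord4 q)
  | |- context [coord4 (@minus ?G ?p ?q)] => change (coord4 (@minus G p q)) with (coord4 p - coord4 q)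
  | |- context [coord4 (@scal ?K ?G ?k ?p)] => change (coord4 (@scal K G k p)) with (k * coord4 p)
  | |- context [coord4 (@opp ?G ?p)] => change (coord4 (@opp G p)) with (- coord4 p)
  | |- context [coord4 (@zero ?G)] => change (coord4 (@zero G)) with 0
  end.

Ltac R4_ring := apply R4_ext; R4_coords; ring.

Lemma mink_opp_l (p r : R4) : mink (opp p) r = - mink p r.
Proof. rewrite R4_opp_scal, mink_scal_l; ring. Qed.

Lemma mink_opp_r (p r : R4) : mink r (opp p) = - mink r p.
Proof. rewrite R4_opp_scal, mink_scal_r; ring. Qed.

Lemma mink_minus_l (p q r : R4) : mink (minus p q) r = mink p r - mink q r.
Proof. rewrite R4_minus_scal, mink_plus_l, mink_scal_l; ring. Qed.

Lemma mink_minus_r (p q r : R4) : mink r (minus p q) = mink r p - mink r q.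
Proof. rewrite !(mink_sym r); apply mink_minus_l. Qed.

Lemma mink_zero_l (r : R4) : mink (zero : R4) r = 0.
Proof. rewrite mink_coord; simpl; unfold coord1, coord2, coord3, coord4, zero; simpl; unfold zero; simpl; ring. Qed.

Lemma mink_zero_r (r : R4) : mink r (zero : R4) = 0.
Proof. rewrite mink_sym; apply mink_zero_l. Qed.

(* The products are stated again because the algebraic structure on [R4] found by
   unification depends on the shape of the vectors. *)
Ltac mink_expand :=
  let step t e pf := (let H := fresh in assert (H : t = e) by exact pf; rewrite H; clear H) in
  repeat match goal with
  | |- context [mink (@plus ?G ?p ?q) ?r] => step (mink (@plus G p q) r) (mink p r + mink q r) (mink_plus_l p q r)
  | |- context [mink ?r (@plus ?G ?p ?q)] => step (mink r (@plus G p q)) (mink r p + mink r q) (mink_plus_r p q r)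
  | |- context [mink (@minus ?G ?p ?q) ?r] => step (mink (@minus G p q) r) (mink p r - mink q r) (mink_minus_l p q r)
  | |- context [mink ?r (@minus ?G ?p ?q)] => step (mink r (@minus G p q)) (mink r p - mink r q) (mink_minus_r p q r)
  | |- context [mink (@opp ?G ?p) ?r] => step (mink (@opp G p) r) (- mink p r) (mink_opp_l p r)
  | |- context [mink ?r (@opp ?G ?p)] => step (mink r (@opp G p)) (- mink r p) (mink_opp_r p r)
  | |- context [mink (@scal ?K ?G ?k ?p) ?r] => step (mink (@scal K G k p) r) (k * mink p r) (mink_scal_l k p r)
  | |- context [mink ?r (@scal ?K ?G ?k ?p)] => step (mink r (@scal K G k p)) (k * mink r p) (mink_scal_r k p r)
  | |- context [mink (@zero ?G) ?r] => step (mink (@zero G) r) 0 (mink_zero_l r)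
  | |- context [mink ?r (@zero ?G)] => step (mink r (@zero G)) 0 (mink_zero_r r)
  end.

(** * Gram determinants and nondegeneracy *)

Definition det4 (p q r s : R4) : R :=
  let '(p1, p2, p3, p4) := p in let '(q1, q2, q3, q4) := q in
  let '(r1, r2, r3, r4) := r in let '(s1, s2, s3, s4) := s in
  (p1 * q2 - p2 * q1) * (r3 * s4 - r4 * s3) - (p1 * q3 - p3 * q1) * (r2 * s4 - r4 * s2)
  + (p1 * q4 - p4 * q1) * (r2 * s3 - r3 * s2) + (p2 * q3 - p3 * q2) * (r1 * s4 - r4 * s1)
  - (p2 * q4 - p4 * q2) * (r1 * s3 - r3 * s1) + (p3 * q4 - p4 * q3) * (r1 * s2 - r2 * s1).

Definition gram_row (e1 e2 e3 e4 p : R4) : R4 := (mink p e1, mink p e2, mink p e3, mink p e4).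

Definition gram (e1 e2 e3 e4 : R4) : R :=
  det4 (gram_row e1 e2 e3 e4 e1) (gram_row e1 e2 e3 e4 e2)
       (gram_row e1 e2 e3 e4 e3) (gram_row e1 e2 e3 e4 e4).

(** The Gram matrix is A J A^T with det J = -1, where A has the rows e1, ..., e4 and [det4], the
    Laplace expansion by 2 x 2 minors, is its determinant. *)
Lemma gram_det (e1 e2 e3 e4 : R4) : gram e1 e2 e3 e4 = - (det4 e1 e2 e3 e4) ^ 2.
Proof.
destruct e1 as [[[]]], e2 as [[[]]], e3 as [[[]]], e4 as [[[]]].
unfold gram, gram_row, det4, mink; ring.
Qed.

Lemma mink_ext (e1 e2 e3 e4 w w' : R4) :
  gram e1 e2 e3 e4 <> 0 ->
  mink w e1 = mink w' e1 -> mink w e2 = mink w' e2 ->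
  mink w e3 = mink w' e3 -> mink w e4 = mink w' e4 -> w = w'.
Proof.
intros Hg H1 H2 H3 H4.
rewrite gram_det in Hg.
assert (Hd : det4 e1 e2 e3 e4 <> 0) by (intros E; apply Hg; rewrite E; ring).
(* Cramer's rule: [i] expanded in the basis e1, ..., e4 and paired with [x]. Taking [i] among the
   standard basis vectors recovers the coordinates of [x] from its four products. *)
assert (cramer : forall x i : R4,
  det4 e1 e2 e3 e4 * (coord1 i * coord1 x + coord2 i * coord2 x + coord3 i * coord3 x - coord4 i * coord4 x) =
  mink x e1 * det4 i e2 e3 e4 + mink x e2 * det4 e1 i e3 e4 + mink x e3 * det4 e1 e2 i e4 + mink x e4 * det4 e1 e2 e3 i).
{ clear; intros x i; destruct e1 as [[[]]], e2 as [[[]]], e3 as [[[]]], e4 as [[[]]], x as [[[]]], i as [[[]]].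
  unfold det4, mink, coord1, coord2, coord3, coord4; simpl; ring. }
assert (E : forall i : R4,
  coord1 i * coord1 w + coord2 i * coord2 w + coord3 i * coord3 w - coord4 i * coord4 w =
  coord1 i * coord1 w' + coord2 i * coord2 w' + coord3 i * coord3 w' - coord4 i * coord4 w').
{ intros i; apply Rmult_eq_reg_l with (2 := Hd); now rewrite !cramer, H1, H2, H3, H4. }
apply R4_ext.
- specialize (E (1, 0, 0, 0)); unfold coord1, coord2, coord3, coord4 in *; simpl in E; lra.
- specialize (E (0, 1, 0, 0)); unfold coord1, coord2, coord3, coord4 in *; simpl in E; lra.
- specialize (E (0, 0, 1, 0)); unfold coord1, coord2, coord3, coord4 in *; simpl in E; lra.
- specialize (E (0, 0, 0, 1)); unfold coord1, coord2, coord3, coord4 in *; simpl in E; lra.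
Qed.

(** * Directional derivatives of vector fields *)

Definition vdir (h : R * R) (w : R -> R -> R4) (u v : R) : R4 :=
  (dir h (fun x y => coord1 (w x y)) u v, dir h (fun x y => coord2 (w x y)) u v,
   dir h (fun x y => coord3 (w x y)) u v, dir h (fun x y => coord4 (w x y)) u v).

Lemma dir_u (f : R -> R -> R) : dir (1, 0) f = du f.
Proof. do 2 (apply functional_extensionality; intro); unfold dir; simpl; ring. Qed.

Lemma dir_v (f : R -> R -> R) : dir (0, 1) f = dv f.
Proof. do 2 (apply functional_extensionality; intro); unfold dir; simpl; ring. Qed.

Lemma partial_derive_10 (f : R -> R -> R) : partial_derive 1 0 f = dir (1, 0) f.
Proof. now rewrite dir_u. Qed.

Lemma partial_derive_01 (f : R -> R -> R) : partial_derive 0 1 f = dir (0, 1) f.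
Proof. now rewrite dir_v. Qed.

Lemma partial_derive_20 (f : R -> R -> R) : partial_derive 2 0 f = dir (1, 0) (dir (1, 0) f).
Proof. now rewrite !dir_u. Qed.

Lemma partial_derive_11 (f : R -> R -> R) : partial_derive 1 1 f = dir (1, 0) (dir (0, 1) f).
Proof. now rewrite dir_u, dir_v. Qed.

Lemma partial_derive_02 (f : R -> R -> R) : partial_derive 0 2 f = dir (0, 1) (dir (0, 1) f).
Proof. now rewrite !dir_v. Qed.

Lemma partial4_10 (w : R -> R -> R4) : partial4 1 0 w = vdir (1, 0) w.
Proof. unfold partial4, vdir; now rewrite !partial_derive_10. Qed.

Lemma partial4_01 (w : R -> R -> R4) : partial4 0 1 w = vdir (0, 1) w.
Proof. unfold partial4, vdir; now rewrite !partial_derive_01. Qed.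

Lemma partial4_20 (w : R -> R -> R4) : partial4 2 0 w = vdir (1, 0) (vdir (1, 0) w).
Proof. unfold partial4; now rewrite !partial_derive_20. Qed.

Lemma partial4_11 (w : R -> R -> R4) : partial4 1 1 w = vdir (1, 0) (vdir (0, 1) w).
Proof. unfold partial4; now rewrite !partial_derive_11. Qed.

Lemma box_dir (D : R * R -> Prop) (f : R -> R -> R) (u v : R) :
  open D -> smooth D f -> D (u, v) -> box f u v = dir (1, 1) (dir (1, -1) f) u v.
Proof.
intros HD Hf Huv; unfold box; rewrite partial_derive_20, partial_derive_02.
assert (E : forall h k, dir h (dir k f) u v =
  fst h * (fst k * dir (1, 0) (dir (1, 0) f) u v + snd k * dir (1, 0) (dir (0, 1) f) u v) +
  snd h * (fst k * dir (1, 0) (dir (0, 1) f) u v + snd k * dir (0, 1) (dir (0, 1) f) u v)).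
{ intros h k.
  rewrite (dir_comm D (1, 0) (0, 1)) at 2; auto.
  rewrite !dir_u, !dir_v.
  unfold dir at 2.
  assert (Hu := smooth_du D f Hf); assert (Hv := smooth_dv D f Hf).
  rewrite (dir_plus D); auto; try (apply smooth_mult; auto; apply smooth_const).
  rewrite (dir_mult D), (dir_mult D), !dir_const; auto; try apply smooth_const.
  unfold dir; ring. }
rewrite (E (1, 1) (1, -1)); simpl; ring.
Qed.

Lemma dir_linear (h : R * R) (f : R -> R -> R) (u v : R) :
  dir h f u v = fst h * dir (1, 0) f u v + snd h * dir (0, 1) f u v.
Proof. unfold dir; simpl; ring. Qed.

Lemma vdir_linear (h : R * R) (w : R -> R -> R4) (u v : R) :
  vdir h w u v = plus (scal (fst h) (vdir (1, 0) w u v)) (scal (snd h) (vdir (0, 1) w u v)).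
Proof. unfold vdir; apply R4_ext; apply dir_linear. Qed.

Lemma smooth4_ext (D : R * R -> Prop) (w w' : R -> R -> R4) :
  open D -> (forall x y, D (x, y) -> w x y = w' x y) -> smooth4 D w -> smooth4 D w'.
Proof.
intros HD H (H1 & H2 & H3 & H4).
split; [ | split; [ | split ] ].
- apply smooth_ext with (3 := H1); auto; intros; now rewrite H.
- apply smooth_ext with (3 := H2); auto; intros; now rewrite H.
- apply smooth_ext with (3 := H3); auto; intros; now rewrite H.
- apply smooth_ext with (3 := H4); auto; intros; now rewrite H.
Qed.

Lemma vdir_ext (D : R * R -> Prop) (h : R * R) (w w' : R -> R -> R4) (u v : R) :
  open D -> (forall x y, D (x, y) -> w x y = w' x y) -> D (u, v) -> vdir h w u v = vdir h w' u v.
Proof.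
intros HD H Huv; unfold vdir.
rewrite (dir_ext D h (fun x y => coord1 (w x y)) (fun x y => coord1 (w' x y))),
  (dir_ext D h (fun x y => coord2 (w x y)) (fun x y => coord2 (w' x y))),
  (dir_ext D h (fun x y => coord3 (w x y)) (fun x y => coord3 (w' x y))),
  (dir_ext D h (fun x y => coord4 (w x y)) (fun x y => coord4 (w' x y))); auto;
  intros; now rewrite H.
Qed.

Lemma smooth4_vdir (D : R * R -> Prop) (h : R * R) (w : R -> R -> R4) :
  open D -> smooth4 D w -> smooth4 D (vdir h w).
Proof.
intros HD (H1 & H2 & H3 & H4); repeat split; now apply smooth_dir.
Qed.

Lemma smooth4_plus (D : R * R -> Prop) (w w' : R -> R -> R4) :
  open D -> smooth4 D w -> smooth4 D w' -> smooth4 D (fun u v => plus (w u v) (w' u v)).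
Proof.
intros HD (H1 & H2 & H3 & H4) (H1' & H2' & H3' & H4').
exact (conj (smooth_plus D _ _ HD H1 H1') (conj (smooth_plus D _ _ HD H2 H2')
  (conj (smooth_plus D _ _ HD H3 H3') (smooth_plus D _ _ HD H4 H4')))).
Qed.

Lemma smooth4_scal (D : R * R -> Prop) (f : R -> R -> R) (w : R -> R -> R4) :
  open D -> smooth D f -> smooth4 D w -> smooth4 D (fun u v => scal (f u v) (w u v)).
Proof.
intros HD Hf (H1 & H2 & H3 & H4).
exact (conj (smooth_mult D _ _ HD Hf H1) (conj (smooth_mult D _ _ HD Hf H2)
  (conj (smooth_mult D _ _ HD Hf H3) (smooth_mult D _ _ HD Hf H4)))).
Qed.

Lemma smooth4_minus (D : R * R -> Prop) (w w' : R -> R -> R4) :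
  open D -> smooth4 D w -> smooth4 D w' -> smooth4 D (fun u v => minus (w u v) (w' u v)).
Proof.
intros HD Hw Hw'.
apply smooth4_ext with (fun u v => plus (w u v) (scal (-1) (w' u v))); auto.
- intros; now rewrite R4_minus_scal.
- apply smooth4_plus; auto; apply smooth4_scal; auto; apply smooth_const.
Qed.

Lemma smooth4_const (D : R * R -> Prop) (p : R4) : smooth4 D (fun _ _ => p).
Proof. repeat split; apply smooth_const. Qed.

Lemma smooth_mink (D : R * R -> Prop) (w w' : R -> R -> R4) :
  open D -> smooth4 D w -> smooth4 D w' -> smooth D (fun u v => mink (w u v) (w' u v)).
Proof.
intros HD (H1 & H2 & H3 & H4) (H1' & H2' & H3' & H4').
apply smooth_ext with (fun u v => coord1 (w u v) * coord1 (w' u v) + coord2 (w u v) * coord2 (w' u v)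
  + coord3 (w u v) * coord3 (w' u v) - coord4 (w u v) * coord4 (w' u v)); auto.
- intros; now rewrite mink_coord.
- apply smooth_minus; auto; repeat apply smooth_plus; auto; now apply smooth_mult.
Qed.

Lemma vdir_plus (D : R * R -> Prop) (h : R * R) (w w' : R -> R -> R4) (u v : R) :
  smooth4 D w -> smooth4 D w' -> D (u, v) ->
  vdir h (fun x y => plus (w x y) (w' x y)) u v = plus (vdir h w u v) (vdir h w' u v).
Proof.
intros (H1 & H2 & H3 & H4) (H1' & H2' & H3' & H4') Huv; apply R4_ext.
- exact (dir_plus D h _ _ u v H1 H1' Huv).
- exact (dir_plus D h _ _ u v H2 H2' Huv).
- exact (dir_plus D h _ _ u v H3 H3' Huv).
- exact (dir_plus D h _ _ u v H4 H4' Huv).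
Qed.

Lemma vdir_scal (D : R * R -> Prop) (h : R * R) (f : R -> R -> R) (w : R -> R -> R4) (u v : R) :
  smooth D f -> smooth4 D w -> D (u, v) ->
  vdir h (fun x y => scal (f x y) (w x y)) u v =
  plus (scal (dir h f u v) (w u v)) (scal (f u v) (vdir h w u v)).
Proof.
intros Hf (H1 & H2 & H3 & H4) Huv; apply R4_ext.
- exact (dir_mult D h _ _ u v Hf H1 Huv).
- exact (dir_mult D h _ _ u v Hf H2 Huv).
- exact (dir_mult D h _ _ u v Hf H3 Huv).
- exact (dir_mult D h _ _ u v Hf H4 Huv).
Qed.

Lemma vdir_minus (D : R * R -> Prop) (h : R * R) (w w' : R -> R -> R4) (u v : R) :
  smooth4 D w -> smooth4 D w' -> D (u, v) ->
  vdir h (fun x y => minus (w x y) (w' x y)) u v = minus (vdir h w u v) (vdir h w' u v).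
Proof.
intros (H1 & H2 & H3 & H4) (H1' & H2' & H3' & H4') Huv; apply R4_ext.
- exact (dir_minus D h _ _ u v H1 H1' Huv).
- exact (dir_minus D h _ _ u v H2 H2' Huv).
- exact (dir_minus D h _ _ u v H3 H3' Huv).
- exact (dir_minus D h _ _ u v H4 H4' Huv).
Qed.

Lemma vdir_const (h : R * R) (p : R4) (u v : R) : vdir h (fun _ _ => p) u v = zero.
Proof.
apply R4_ext.
- exact (dir_const h (coord1 p) u v).
- exact (dir_const h (coord2 p) u v).
- exact (dir_const h (coord3 p) u v).
- exact (dir_const h (coord4 p) u v).
Qed.

Lemma dir_mink (D : R * R -> Prop) (h : R * R) (w w' : R -> R -> R4) (u v : R) :
  open D -> smooth4 D w -> smooth4 D w' -> D (u, v) ->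
  dir h (fun x y => mink (w x y) (w' x y)) u v = mink (vdir h w u v) (w' u v) + mink (w u v) (vdir h w' u v).
Proof.
intros HD (H1 & H2 & H3 & H4) (H1' & H2' & H3' & H4') Huv.
rewrite (dir_ext D h _ (fun u v => coord1 (w u v) * coord1 (w' u v) + coord2 (w u v) * coord2 (w' u v)
  + coord3 (w u v) * coord3 (w' u v) - coord4 (w u v) * coord4 (w' u v))); auto.
- rewrite (dir_minus D), !(dir_plus D), !(dir_mult D), !mink_coord; auto;
    try (repeat apply smooth_plus; auto; apply smooth_mult; now auto).
  unfold vdir, coord1, coord2, coord3, coord4; simpl; ring.
- intros; apply mink_coord.
Qed.

Lemma vdir_comm (D : R * R -> Prop) (h k : R * R) (w : R -> R -> R4) (u v : R) :
  open D -> smooth4 D w -> D (u, v) -> vdir h (vdir k w) u v = vdir k (vdir h w) u v.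
Proof.
intros HD (H1 & H2 & H3 & H4) Huv; apply R4_ext.
- exact (dir_comm D h k _ u v HD H1 Huv).
- exact (dir_comm D h k _ u v HD H2 Huv).
- exact (dir_comm D h k _ u v HD H3 Huv).
- exact (dir_comm D h k _ u v HD H4 Huv).
Qed.

Create HintDb smo.
#[local] Hint Resolve smooth_plus smooth_mult smooth_opp smooth_minus smooth_const
  smooth4_plus smooth4_scal smooth4_minus smooth4_const smooth_mink smooth4_vdir smooth_dir : smo.

Lemma diamond_constant4 (x0 y0 eps : R) (w : R -> R -> R4) (u v : R) :
  smooth4 (diamond x0 y0 eps) w ->
  (forall x y, diamond x0 y0 eps (x, y) -> vdir (1, 1) w x y = zero) ->
  (forall x y, diamond x0 y0 eps (x, y) -> vdir (1, -1) w x y = zero) ->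
  diamond x0 y0 eps (u, v) -> w u v = w x0 y0.
Proof.
intros (w1 & w2 & w3 & w4) H1 H2 Huv; apply R4_ext.
- apply (diamond_constant x0 y0 eps (fun x y => coord1 (w x y))); auto; intros x y Hxy;
    [ exact (f_equal coord1 (H1 x y Hxy)) | exact (f_equal coord1 (H2 x y Hxy)) ].
- apply (diamond_constant x0 y0 eps (fun x y => coord2 (w x y))); auto; intros x y Hxy;
    [ exact (f_equal coord2 (H1 x y Hxy)) | exact (f_equal coord2 (H2 x y Hxy)) ].
- apply (diamond_constant x0 y0 eps (fun x y => coord3 (w x y))); auto; intros x y Hxy;
    [ exact (f_equal coord3 (H1 x y Hxy)) | exact (f_equal coord3 (H2 x y Hxy)) ].
- apply (diamond_constant x0 y0 eps (fun x y => coord4 (w x y))); auto; intros x y Hxy;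
    [ exact (f_equal coord4 (H1 x y Hxy)) | exact (f_equal coord4 (H2 x y Hxy)) ].
Qed.

(** * Null pairs and their structure equations *)

Record null_pair (D : R * R -> Prop) (h k : R * R) (a b : R -> R -> R4) : Prop := {
  np_smooth_a : smooth4 D a;
  np_smooth_b : smooth4 D b;
  np_aa : forall u v, D (u, v) -> mink (a u v) (a u v) = 0;
  np_bb : forall u v, D (u, v) -> mink (b u v) (b u v) = 0;
  np_ab : forall u v, D (u, v) -> mink (a u v) (b u v) <> 0;
  np_dka : forall u v, D (u, v) -> vdir k a u v = zero;
  np_dhb : forall u v, D (u, v) -> vdir h b u v = zero;
  np_dha : forall u v, D (u, v) -> mink (vdir h a u v) (vdir h a u v) = 4;
  np_dkb : forall u v, D (u, v) -> mink (vdir k b u v) (vdir k b u v) = 4 }.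

Arguments np_smooth_a {D h k a b}.
Arguments np_smooth_b {D h k a b}.
Arguments np_aa {D h k a b}.
Arguments np_bb {D h k a b}.
Arguments np_ab {D h k a b}.
Arguments np_dka {D h k a b}.
Arguments np_dhb {D h k a b}.
Arguments np_dha {D h k a b}.
Arguments np_dkb {D h k a b}.

Definition np_f (a b : R -> R -> R4) (u v : R) : R := mink (a u v) (b u v).

(** The component of d_h a orthogonal to both [a] and [b]: d_h a is already orthogonal to [a], and
    its product with [b] is d_h f, so that only a multiple of [a] has to be removed. *)
Definition np_P (h : R * R) (a b : R -> R -> R4) (u v : R) : R4 :=
  minus (vdir h a u v) (scal (dir h (np_f a b) u v / np_f a b u v) (a u v)).

Definition np_c (h k : R * R) (a b : R -> R -> R4) (u v : R) : R :=
  mink (np_P h a b u v) (np_P k b a u v).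

Lemma np_f_sym (a b : R -> R -> R4) : np_f b a = np_f a b.
Proof. do 2 (apply functional_extensionality; intro); apply mink_sym. Qed.

Lemma np_c_sym (h k : R * R) (a b : R -> R -> R4) : np_c k h b a = np_c h k a b.
Proof. do 2 (apply functional_extensionality; intro); apply mink_sym. Qed.

(** This symmetry is why [h] and [k] are kept abstract: every fact proved about P = [np_P h a b]
    also holds for Q = [np_P k b a] with the directions exchanged. *)
Lemma null_pair_sym (D : R * R -> Prop) (h k : R * R) (a b : R -> R -> R4) :
  null_pair D h k a b -> null_pair D k h b a.
Proof.
intros []; constructor; auto; intros; rewrite mink_sym; auto.
Qed.

Section NullPair.
Context {D : R * R -> Prop} {h k : R * R} {a b : R -> R -> R4}.
Context (HD : open D) (N : null_pair D h k a b).

Let Ha : smooth4 D a := np_smooth_a N.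
Let Hb : smooth4 D b := np_smooth_b N.
Let f := np_f a b.
Let P := np_P h a b.

Lemma np_smooth_f : smooth D f.
Proof. now apply smooth_mink. Qed.

Lemma np_f_neq0 (u v : R) : D (u, v) -> f u v <> 0.
Proof. apply (np_ab N). Qed.

Lemma np_smooth_P : smooth4 D P.
Proof.
unfold P, np_P; apply smooth4_minus; auto with smo.
apply smooth4_scal; auto; apply smooth_div; auto.
- apply np_f_neq0.
- apply smooth_dir; auto; apply np_smooth_f.
- apply np_smooth_f.
Qed.

Lemma np_a_dha (u v : R) : D (u, v) -> mink (vdir h a u v) (a u v) = 0.
Proof.
intros Huv; assert (E := dir_mink D h a a u v HD Ha Ha Huv).
rewrite (dir_ext D h _ (fun _ _ => 0) u v HD) in E; auto.
- rewrite dir_const, (mink_sym (a u v)) in E; lra.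
- apply (np_aa N).
Qed.

Lemma np_dhf (u v : R) : D (u, v) -> dir h f u v = mink (vdir h a u v) (b u v).
Proof.
intros Huv; unfold f, np_f; rewrite (dir_mink D); auto.
rewrite (np_dhb N u v Huv), mink_zero_r; ring.
Qed.

Lemma np_dkf (u v : R) : D (u, v) -> dir k f u v = mink (a u v) (vdir k b u v).
Proof.
intros Huv; unfold f, np_f; rewrite (dir_mink D); auto.
rewrite (np_dka N u v Huv), mink_zero_l; ring.
Qed.

Lemma np_dhkb (u v : R) : D (u, v) -> vdir h (vdir k b) u v = zero.
Proof.
intros Huv; rewrite (vdir_comm D); auto.
rewrite (vdir_ext D k _ (fun _ _ => zero)); auto.
- apply vdir_const.
- apply (np_dhb N).
Qed.

Lemma np_dkha (u v : R) : D (u, v) -> vdir k (vdir h a) u v = zero.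
Proof.
intros Huv; rewrite (vdir_comm D); auto.
rewrite (vdir_ext D h _ (fun _ _ => zero)); auto.
- apply vdir_const.
- apply (np_dka N).
Qed.

Lemma np_dhkf (u v : R) : D (u, v) -> dir h (dir k f) u v = mink (vdir h a u v) (vdir k b u v).
Proof.
intros Huv; rewrite (dir_ext D h _ (fun x y => mink (a x y) (vdir k b x y))); auto.
- rewrite (dir_mink D), np_dhkb, mink_zero_r; auto with smo; ring.
- apply np_dkf.
Qed.

Lemma np_P_a (u v : R) : D (u, v) -> mink (P u v) (a u v) = 0.
Proof.
intros Huv; unfold P, np_P; mink_expand.
rewrite np_a_dha, (np_aa N u v Huv); auto; ring.
Qed.

Lemma np_P_b (u v : R) : D (u, v) -> mink (P u v) (b u v) = 0.
Proof.
intros Huv; unfold P, np_P; mink_expand.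
rewrite <- np_dhf; auto; fold f; change (mink (a u v) (b u v)) with (f u v).
field; now apply np_f_neq0.
Qed.

Lemma np_P_dha (u v : R) : D (u, v) -> mink (P u v) (vdir h a u v) = 4.
Proof.
intros Huv; unfold P, np_P; mink_expand.
rewrite (mink_sym (a u v)), np_a_dha, (np_dha N u v Huv); auto; ring.
Qed.

Lemma np_P_P (u v : R) : D (u, v) -> mink (P u v) (P u v) = 4.
Proof.
intros Huv; unfold P at 2, np_P; mink_expand.
rewrite np_P_dha, np_P_a; auto; ring.
Qed.

Lemma np_dha_P (u v : R) : vdir h a u v = plus (P u v) (scal (dir h f u v / f u v) (a u v)).
Proof.
unfold P, np_P; fold f; R4_ring.
Qed.

(** The quotient d_h f / f is the coefficient of [a] in d_h a; the numerator on the right will turn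
    out to be [np_c]. *)
Lemma np_dk_quot (u v : R) : D (u, v) ->
  dir k (fun x y => dir h f x y / f x y) u v =
  (dir h (dir k f) u v - dir h f u v * dir k f u v / f u v) / f u v.
Proof.
intros Huv; assert (Hf := np_smooth_f).
rewrite (dir_div D); auto with smo.
- rewrite (dir_comm D k h); auto; field; now apply np_f_neq0.
- apply np_f_neq0.
Qed.

End NullPair.

Section NullPairTransport.
Context {D : R * R -> Prop} {h k : R * R} {a b : R -> R -> R4}.
Context (HD : open D) (N : null_pair D h k a b).

Let N' : null_pair D k h b a := null_pair_sym D h k a b N.
Let Ha : smooth4 D a := np_smooth_a N.
Let Hb : smooth4 D b := np_smooth_b N.
Let f := np_f a b.
Let P := np_P h a b.
Let Q := np_P k b a.
Let c := np_c h k a b.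

Lemma np_dha_Q (u v : R) : D (u, v) -> mink (vdir h a u v) (Q u v) = c u v.
Proof.
intros Huv; rewrite (np_dha_P (b := b)); mink_expand.
rewrite (mink_sym (a u v)), (np_P_b HD N'); auto.
unfold c, np_c, P, Q; ring.
Qed.

(** [P] may be replaced by d_h a, since [a] is orthogonal to [Q]; expanding [Q] then leaves only
    <d_h a, d_k b> = d_h d_k f and <d_h a, b> = d_h f. *)
Lemma np_c_eq (u v : R) : D (u, v) ->
  c u v = dir h (dir k f) u v - dir h f u v * dir k f u v / f u v.
Proof.
intros Huv; rewrite <- np_dha_Q; auto.
unfold Q, np_P; mink_expand.
rewrite (np_f_sym a b); fold f.
unfold f; rewrite (np_dhkf HD N), <- (np_dhf HD N); auto; field; now apply (np_f_neq0 N).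
Qed.

Lemma np_smooth_c : smooth D c.
Proof. apply smooth_mink; auto; [ now apply (np_smooth_P HD N) | now apply (np_smooth_P HD N') ]. Qed.

(** Both d_k d_h a and d_k a vanish, so that only the coefficient d_h f / f of [a] is
    differentiated, and its k-derivative is c / f. *)
Lemma np_dkP (u v : R) : D (u, v) -> vdir k P u v = scal (- (c u v / f u v)) (a u v).
Proof.
intros Huv; unfold P, np_P.
assert (Hf := np_smooth_f HD N).
assert (Hq : smooth D (fun x y => dir h f x y / f x y)).
{ apply smooth_div; auto with smo; apply (np_f_neq0 N). }
rewrite (vdir_minus D k (vdir h a) (fun x y => scal (dir h f x y / f x y) (a x y))); auto with smo.
rewrite (vdir_scal D k (fun x y => dir h f x y / f x y)); auto.
rewrite (np_dkha HD N), (np_dka N), (np_dk_quot HD N); auto.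
fold f; rewrite <- np_c_eq; auto.
R4_ring.
Qed.

End NullPairTransport.

Section NullPairFrame.
Context {D : R * R -> Prop} {h k : R * R} {a b : R -> R -> R4}.
Context (HD : open D) (N : null_pair D h k a b).

Let N' : null_pair D k h b a := null_pair_sym D h k a b N.
Let Ha : smooth4 D a := np_smooth_a N.
Let Hb : smooth4 D b := np_smooth_b N.
Let f := np_f a b.
Let P := np_P h a b.
Let Q := np_P k b a.
Let c := np_c h k a b.
Let HP : smooth4 D P := np_smooth_P HD N.
Let HQ : smooth4 D Q := np_smooth_P HD N'.

Lemma np_dhQ (u v : R) : D (u, v) -> vdir h Q u v = scal (- (c u v / f u v)) (b u v).
Proof.
intros Huv; unfold c, f; rewrite <- np_c_sym, <- np_f_sym; now apply (np_dkP HD N').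
Qed.

(** Differentiating <P, a> = 0 along [h] gives -<P, d_h a>, and <P, d_h a> = <P, P> = 4. *)
Lemma np_dhP_a (u v : R) : D (u, v) -> mink (vdir h P u v) (a u v) = -4.
Proof.
intros Huv; assert (E := dir_mink D h P a u v HD HP Ha Huv).
rewrite (dir_ext D h _ (fun _ _ => 0) u v HD) in E; auto.
- rewrite dir_const in E; unfold P in E; rewrite (np_P_dha HD N) in E; auto; unfold P; lra.
- intros; now apply (np_P_a HD N).
Qed.

Lemma np_dhP_b (u v : R) : D (u, v) -> mink (vdir h P u v) (b u v) = 0.
Proof.
intros Huv; assert (E := dir_mink D h P b u v HD HP Hb Huv).
rewrite (dir_ext D h _ (fun _ _ => 0) u v HD) in E; auto.
- rewrite dir_const, (np_dhb N), mink_zero_r in E; auto; lra.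
- intros; now apply (np_P_b HD N).
Qed.

Lemma np_dhP_P (u v : R) : D (u, v) -> mink (vdir h P u v) (P u v) = 0.
Proof.
intros Huv; assert (E := dir_mink D h P P u v HD HP HP Huv).
rewrite (dir_ext D h _ (fun _ _ => 4) u v HD) in E; auto.
- rewrite dir_const, (mink_sym (P u v)) in E; lra.
- intros; now apply (np_P_P HD N).
Qed.

Lemma np_P_Q (u v : R) : mink (P u v) (Q u v) = c u v.
Proof. reflexivity. Qed.

(** In the derivative of <P, Q> the other term vanishes, because d_h Q is a multiple of [b], which
    is orthogonal to [P]. *)
Lemma np_dhP_Q (u v : R) : D (u, v) -> mink (vdir h P u v) (Q u v) = dir h c u v.
Proof.
intros Huv; assert (E := dir_mink D h P Q u v HD HP HQ Huv).
rewrite np_dhQ, mink_scal_r in E; auto.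
unfold P at 3 in E; rewrite (np_P_b HD N) in E; auto.
change (dir h c u v = mink (vdir h P u v) (Q u v) + - (c u v / f u v) * 0) in E; lra.
Qed.

(** The planes spanned by a, b and by P, Q are orthogonal; they contribute the factors -f^2 and 16 -
    c^2. *)
Lemma np_gram (u v : R) : D (u, v) ->
  gram (a u v) (b u v) (P u v) (Q u v) = - (f u v) ^ 2 * (16 - (c u v) ^ 2).
Proof.
intros Huv; unfold gram, gram_row, det4.
rewrite (mink_sym (a u v) (P u v)), (mink_sym (b u v) (P u v)), (mink_sym (a u v) (Q u v)), (mink_sym (b u v) (Q u v)),
  (mink_sym (Q u v) (P u v)), (mink_sym (b u v) (a u v)).
unfold P, Q; rewrite (np_P_a HD N), (np_P_b HD N), (np_P_a HD N'), (np_P_b HD N'), (np_P_P HD N), (np_P_P HD N'),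
  (np_aa N), (np_bb N); auto.
change (mink (a u v) (b u v)) with (f u v); change (mink (np_P h a b u v) (np_P k b a u v)) with (c u v).
generalize (f u v) (c u v); intros; ring.
Qed.

Lemma np_gram_neq0 (u v : R) : D (u, v) -> 16 - (c u v) ^ 2 <> 0 ->
  gram (a u v) (b u v) (P u v) (Q u v) <> 0.
Proof.
intros Huv Hc; rewrite np_gram; auto.
apply Rmult_integral_contrapositive_currified; auto.
apply Ropp_neq_0_compat, pow_nonzero; now apply (np_f_neq0 N).
Qed.

(** [np_X] and [np_Y] are the coefficients of [P] and [Q] in d_h P. They solve 4 X + c Y = <d_h P,
    P> = 0 and c X + 4 Y = <d_h P, Q> = d_h c. *)
Definition np_X (u v : R) : R := - (c u v * dir h c u v) / (16 - (c u v) ^ 2).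
Definition np_Y (u v : R) : R := 4 * dir h c u v / (16 - (c u v) ^ 2).

Lemma np_dhP (u v : R) : D (u, v) -> 16 - (c u v) ^ 2 <> 0 ->
  vdir h P u v = plus (scal (- (4 / f u v)) (b u v)) (plus (scal (np_X u v) (P u v)) (scal (np_Y u v) (Q u v))).
Proof.
intros Huv Hc; assert (Hf := np_f_neq0 N u v Huv); fold f in Hf.
apply (mink_ext (a u v) (b u v) (P u v) (Q u v)); [ now apply np_gram_neq0 | .. ]; mink_expand.
- rewrite np_dhP_a, (mink_sym (b u v) (a u v)); auto.
  unfold P, Q; rewrite (np_P_a HD N), (np_P_b HD N'); auto.
  change (mink (a u v) (b u v)) with (f u v); field; auto.
- rewrite np_dhP_b, (np_bb N); auto.
  unfold P, Q; rewrite (np_P_b HD N), (np_P_a HD N'); auto; ring.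
- rewrite np_dhP_P, (mink_sym (Q u v) (P u v)), (mink_sym (b u v) (P u v)), np_P_Q; auto.
  unfold P; rewrite (np_P_b HD N), (np_P_P HD N); auto.
  unfold np_X, np_Y; field; auto.
- rewrite np_dhP_Q, (mink_sym (b u v) (Q u v)), np_P_Q; auto.
  unfold Q; rewrite (np_P_a HD N'), (np_P_P HD N'); auto.
  unfold np_X, np_Y; field; auto.
Qed.

End NullPairFrame.

(** Differentiate d_h c = <d_h P, Q> along [k]. From d_k d_h P = d_h (-(c/f) a) comes -c^2 / f,
    since <a, Q> = 0 and <d_h a, Q> = c; from <d_h P, d_k Q>, with d_h P expanded in the frame, come
    16 / f, through <b, d_k Q> = -4, and the product of [np_X] with d_k c. *)
Lemma np_dhkc (D : R * R -> Prop) (h k : R * R) (a b : R -> R -> R4) (u v : R) :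
  open D -> null_pair D h k a b -> D (u, v) ->
  let f := np_f a b u v in
  let c := np_c h k a b in
  16 - (c u v) ^ 2 <> 0 ->
  dir k (dir h c) u v = (16 - (c u v) ^ 2) / f
    - c u v * dir h c u v * dir k c u v / (16 - (c u v) ^ 2).
Proof.
intros HD N Huv f c Hc.
assert (N' := null_pair_sym D h k a b N).
assert (Hf := np_f_neq0 N u v Huv); change (f <> 0) in Hf.
assert (HP := np_smooth_P HD N); assert (HQ := np_smooth_P HD N').
assert (Ha := np_smooth_a N).
assert (Hcs := np_smooth_c HD N); fold c in Hcs.
assert (Hfs := np_smooth_f HD N).
rewrite (dir_ext D k (dir h c) (fun x y => mink (vdir h (np_P h a b) x y) (np_P k b a x y))); auto.
2: { intros; symmetry; now apply (np_dhP_Q HD N). }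
rewrite (dir_mink D), (vdir_comm D); auto with smo.
assert (Hr : smooth D (fun x y => - (c x y / np_f a b x y))).
{ apply smooth_opp; auto; apply smooth_div; auto; apply (np_f_neq0 N). }
rewrite (vdir_ext D h (vdir k (np_P h a b)) (fun x y => scal (- (c x y / np_f a b x y)) (a x y))); auto.
2: { intros; now apply (np_dkP HD N). }
rewrite (vdir_scal D h (fun x y => - (c x y / np_f a b x y))); auto.
rewrite (np_dhP HD N); auto; mink_expand.
rewrite (mink_sym (a u v)), (np_P_b HD N'), (np_dha_Q HD N); auto.
rewrite !(mink_sym _ (vdir k (np_P k b a) u v)).
rewrite (np_dhP_a HD N'), (np_dhP_P HD N'), (np_dhP_Q HD N'), (np_c_sym h k a b); auto.
unfold np_X; fold c f.
fold c in Hc; field; auto.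
Qed.

(* The linear map sending the frame [(a1, b1, P1, Q1)] to [(a2, b2, P2, Q2)], provided that
   both have the same products. *)
Definition transfer (h k : R * R) (a1 b1 a2 b2 : R -> R -> R4) (w : R4) (u v : R) : R4 :=
  let f := np_f a1 b1 u v in
  let c := np_c h k a1 b1 u v in
  let p := mink w (np_P h a1 b1 u v) in
  let q := mink w (np_P k b1 a1 u v) in
  plus (plus (scal (mink w (b1 u v) / f) (a2 u v)) (scal (mink w (a1 u v) / f) (b2 u v)))
       (plus (scal ((4 * p - c * q) / (16 - c * c)) (np_P h a2 b2 u v))
             (scal ((4 * q - c * p) / (16 - c * c)) (np_P k b2 a2 u v))).

Lemma transfer_sym (h k : R * R) (a1 b1 a2 b2 : R -> R -> R4) (w : R4) (u v : R) :
  transfer k h b1 a1 b2 a2 w u v = transfer h k a1 b1 a2 b2 w u v.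
Proof.
unfold transfer; rewrite (np_f_sym a1 b1), (np_c_sym h k a1 b1).
generalize (np_P h a1 b1 u v) (np_P k b1 a1 u v) (np_P h a2 b2 u v) (np_P k b2 a2 u v)
  (a1 u v) (b1 u v) (a2 u v) (b2 u v) (np_f a1 b1 u v) (np_c h k a1 b1 u v).
intros; unfold Rdiv; R4_ring.
Qed.

(** * The constant isometry between two null pairs with the same product *)

Lemma np_c_ext (D : R * R -> Prop) (h k : R * R) (a1 b1 a2 b2 : R -> R -> R4) (u v : R) :
  open D -> null_pair D h k a1 b1 -> null_pair D h k a2 b2 ->
  (forall x y, D (x, y) -> np_f a1 b1 x y = np_f a2 b2 x y) ->
  D (u, v) -> np_c h k a1 b1 u v = np_c h k a2 b2 u v.
Proof.
intros HD N1 N2 Hf Huv.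
assert (Hd : forall l x y, D (x, y) -> dir l (np_f a1 b1) x y = dir l (np_f a2 b2) x y).
{ intros; now apply (dir_ext D). }
rewrite (np_c_eq HD N1), (np_c_eq HD N2), Hf, !Hd; auto.
now rewrite (dir_ext D h (dir k (np_f a1 b1)) (dir k (np_f a2 b2))); auto.
Qed.

(** In both frames the h-derivatives of a, b, P, Q are the same combinations of the frame vectors,
    with coefficients built from f, c and their derivatives, and c is itself determined by f. The
    coefficients of [w] therefore vary in the way that compensates the motion of the second
    frame. *)
Lemma vdir_transfer (D : R * R -> Prop) (h k : R * R) (a1 b1 a2 b2 : R -> R -> R4) (w : R4) (u v : R) :
  open D -> null_pair D h k a1 b1 -> null_pair D h k a2 b2 ->
  (forall x y, D (x, y) -> np_f a1 b1 x y = np_f a2 b2 x y) ->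
  (forall x y, D (x, y) -> 16 - (np_c h k a1 b1 x y) ^ 2 <> 0) ->
  D (u, v) ->
  smooth4 D (transfer h k a1 b1 a2 b2 w) /\ vdir h (transfer h k a1 b1 a2 b2 w) u v = zero.
Proof.
intros HD N1 N2 Hf Hc Huv.
assert (N1' := null_pair_sym _ _ _ _ _ N1).
assert (N2' := null_pair_sym _ _ _ _ _ N2).
assert (Ec : forall x y, D (x, y) -> np_c h k a1 b1 x y = np_c h k a2 b2 x y).
{ intros; now apply (np_c_ext D). }
assert (Efh : dir h (np_f a1 b1) u v = dir h (np_f a2 b2) u v) by now apply (dir_ext D).
assert (Ech : dir h (np_c h k a1 b1) u v = dir h (np_c h k a2 b2) u v) by now apply (dir_ext D).
assert (Ef := Hf u v Huv); assert (Ecc := Ec u v Huv).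
assert (sa1 := np_smooth_a N1); assert (sb1 := np_smooth_b N1).
assert (sa2 := np_smooth_a N2); assert (sb2 := np_smooth_b N2).
assert (sP1 := np_smooth_P HD N1); assert (sP2 := np_smooth_P HD N2).
assert (sQ1 := np_smooth_P HD N1'); assert (sQ2 := np_smooth_P HD N2').
assert (sc := np_smooth_c HD N1).
assert (sf := np_smooth_f HD N1).
assert (nf := np_f_neq0 N1).
assert (nc : forall x y, D (x, y) -> 16 - np_c h k a1 b1 x y * np_c h k a1 b1 x y <> 0).
{ intros x y Hxy E; apply (Hc x y Hxy); rewrite <- E; ring. }
set (al := fun x y => mink w (b1 x y) / np_f a1 b1 x y).
set (be := fun x y => mink w (a1 x y) / np_f a1 b1 x y).
set (p := fun x y => mink w (np_P h a1 b1 x y)).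
set (q := fun x y => mink w (np_P k b1 a1 x y)).
set (c := np_c h k a1 b1) in *.
set (f := np_f a1 b1) in *.
(* The coefficients of [w] along [P] and [Q] are found from its products with them by inverting the
   matrix (4 c; c 4), of determinant 16 - c^2. *)
set (ga := fun x y => (4 * p x y - c x y * q x y) / (16 - c x y * c x y)).
set (de := fun x y => (4 * q x y - c x y * p x y) / (16 - c x y * c x y)).
assert (swb : smooth D (fun x y => mink w (b1 x y))) by (apply (smooth_mink D (fun _ _ => w)); auto with smo).
assert (swa : smooth D (fun x y => mink w (a1 x y))) by (apply (smooth_mink D (fun _ _ => w)); auto with smo).
assert (sp : smooth D p) by (apply (smooth_mink D (fun _ _ => w)); auto with smo).
assert (sq : smooth D q) by (apply (smooth_mink D (fun _ _ => w)); auto with smo).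
assert (sal : smooth D al) by (apply smooth_div; auto).
assert (sbe : smooth D be) by (apply smooth_div; auto).
assert (sga : smooth D ga) by (apply smooth_div; auto with smo).
assert (sde : smooth D de) by (apply smooth_div; auto with smo).
assert (E : forall x y, transfer h k a1 b1 a2 b2 w x y =
  plus (plus (scal (al x y) (a2 x y)) (scal (be x y) (b2 x y)))
       (plus (scal (ga x y) (np_P h a2 b2 x y)) (scal (de x y) (np_P k b2 a2 x y)))) by reflexivity.
split.
- apply smooth4_ext with (2 := fun x y _ => eq_sym (E x y)); auto with smo.
- rewrite (vdir_ext D h _ _ u v HD (fun x y _ => E x y) Huv).
  rewrite (vdir_plus D h (fun x y => plus (scal (al x y) (a2 x y)) (scal (be x y) (b2 x y)))), !(vdir_plus D);
    auto with smo.
  rewrite !(vdir_scal D); auto.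
  assert (dw : forall g, smooth4 D g -> dir h (fun x y => mink w (g x y)) u v = mink w (vdir h g u v)).
  { intros g Hg; rewrite (dir_mink D h (fun _ _ => w)), vdir_const; auto with smo; mink_expand; ring. }
  assert (dp : dir h p u v = mink w (vdir h (np_P h a1 b1) u v)) by now apply dw.
  assert (dq : dir h q u v = mink w (vdir h (np_P k b1 a1) u v)) by now apply dw.
  assert (dal : dir h al u v = - al u v * dir h f u v / f u v).
  { unfold al; rewrite (dir_div D); auto; rewrite dw, (np_dhb N1), mink_zero_r; auto.
    change (np_f a1 b1) with f; field; auto. }
  assert (dbe : dir h be u v = p u v / f u v).
  { unfold be; rewrite (dir_div D); auto; rewrite dw, (np_dha_P (b := b1)); auto; mink_expand.
    change (np_f a1 b1) with f; unfold p; field; auto. }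
  assert (dden : dir h (fun x y => 16 - c x y * c x y) u v = - 2 * c u v * dir h c u v).
  { rewrite (dir_minus D), dir_const, (dir_mult D); auto with smo; ring. }
  assert (dga : dir h ga u v = ((4 * dir h p u v - dir h c u v * q u v - c u v * dir h q u v) *
     (16 - c u v * c u v) + (4 * p u v - c u v * q u v) * (2 * c u v * dir h c u v)) / (16 - c u v * c u v) ^ 2).
  { unfold ga; rewrite (dir_div D), dden, (dir_minus D), !(dir_mult D), dir_const; auto with smo.
    field; auto. }
  assert (dde : dir h de u v = ((4 * dir h q u v - dir h c u v * p u v - c u v * dir h p u v) *
     (16 - c u v * c u v) + (4 * q u v - c u v * p u v) * (2 * c u v * dir h c u v)) / (16 - c u v * c u v) ^ 2).
  { unfold de; rewrite (dir_div D), dden, (dir_minus D), !(dir_mult D), dir_const; auto with smo.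
    field; auto. }
  rewrite dga, dde, dal, dbe, dp, dq.
  rewrite (np_dhQ HD N1), (np_dhQ HD N2), (np_dhP HD N1), (np_dhP HD N2); auto.
  2: rewrite <- Ecc; auto.
  rewrite (np_dhb N2), (np_dha_P (b := b2) u v); auto.
  mink_expand; unfold np_X, np_Y; rewrite <- Ef, <- Efh, <- Ecc, <- Ech.
  fold c f.
  change (mink w (np_P h a1 b1 u v)) with (p u v); change (mink w (np_P k b1 a1 u v)) with (q u v).
  replace (mink w (b1 u v)) with (al u v * f u v) by (unfold al; field; auto).
  unfold ga, de.
  assert (n1 := nf u v Huv); assert (n2 := nc u v Huv); assert (n3 := Hc u v Huv).
  generalize (np_P h a2 b2 u v) (np_P k b2 a2 u v) (a2 u v) (b2 u v) (dir h c u v) (dir h f u v).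
  revert n1 n2 n3.
  generalize (p u v) (q u v) (al u v) (f u v) (c u v).
  clear; intros.
  apply R4_ext; R4_coords; field; auto.
Qed.

Lemma transfer_constant (x0 y0 eps : R) (a1 b1 a2 b2 : R -> R -> R4) (w : R4) (u v : R) :
  let D := diamond x0 y0 eps in
  null_pair D (1, 1) (1, -1) a1 b1 -> null_pair D (1, 1) (1, -1) a2 b2 ->
  (forall x y, D (x, y) -> np_f a1 b1 x y = np_f a2 b2 x y) ->
  (forall x y, D (x, y) -> 16 - (np_c (1, 1) (1, -1) a1 b1 x y) ^ 2 <> 0) ->
  D (u, v) -> transfer (1, 1) (1, -1) a1 b1 a2 b2 w u v = transfer (1, 1) (1, -1) a1 b1 a2 b2 w x0 y0.
Proof.
intros D N1 N2 Hf Hc Huv.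
assert (HD : open D) by apply open_diamond.
assert (N1' := null_pair_sym _ _ _ _ _ N1); assert (N2' := null_pair_sym _ _ _ _ _ N2).
set (T := transfer (1, 1) (1, -1) a1 b1 a2 b2 w).
(* Exchanging the roles of the two directions does not change the map, so the k-derivative is
   covered by the lemma on the h-derivative. *)
assert (ET : transfer (1, -1) (1, 1) b1 a1 b2 a2 w = T).
{ do 2 (apply functional_extensionality; intro); apply transfer_sym. }
assert (dh : forall x y, D (x, y) -> vdir (1, 1) T x y = zero).
{ intros x y Hxy; now apply (vdir_transfer D (1, 1) (1, -1) a1 b1 a2 b2 w x y). }
assert (dk : forall x y, D (x, y) -> vdir (1, -1) T x y = zero).
{ intros x y Hxy; rewrite <- ET.
  apply (vdir_transfer D (1, -1) (1, 1) b1 a1 b2 a2 w x y); auto.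
  - intros; rewrite (np_f_sym a1 b1), (np_f_sym a2 b2); auto.
  - intros; rewrite np_c_sym; auto. }
apply (diamond_constant4 x0 y0 eps T); auto.
now apply (vdir_transfer D (1, 1) (1, -1) a1 b1 a2 b2 w u v).
Qed.

Lemma transfer_linear (h k : R * R) (a1 b1 a2 b2 : R -> R -> R4) (u v : R) :
  (forall w w', transfer h k a1 b1 a2 b2 (plus w w') u v =
     plus (transfer h k a1 b1 a2 b2 w u v) (transfer h k a1 b1 a2 b2 w' u v)) /\
  (forall (r : R) w, transfer h k a1 b1 a2 b2 (scal r w) u v = scal r (transfer h k a1 b1 a2 b2 w u v)).
Proof.
unfold transfer.
generalize (np_P h a1 b1 u v) (np_P k b1 a1 u v) (np_P h a2 b2 u v) (np_P k b2 a2 u v)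
  (a1 u v) (b1 u v) (a2 u v) (b2 u v) (np_f a1 b1 u v) (np_c h k a1 b1 u v).
split; intros; mink_expand; unfold Rdiv; R4_ring.
Qed.

(** The right-hand side involves the first pair only. Used with the second pair and again with the
    first pair as target, it shows that the transfer map preserves products. *)
Lemma mink_transfer_transfer (D : R * R -> Prop) (h k : R * R) (a1 b1 a2 b2 : R -> R -> R4)
    (w w' : R4) (u v : R) :
  open D -> null_pair D h k a2 b2 -> D (u, v) ->
  np_f a1 b1 u v = np_f a2 b2 u v -> np_c h k a1 b1 u v = np_c h k a2 b2 u v ->
  let f := np_f a1 b1 u v in
  let c := np_c h k a1 b1 u v in
  let al x := mink x (b1 u v) / f in
  let be x := mink x (a1 u v) / f in
  let ga x := (4 * mink x (np_P h a1 b1 u v) - c * mink x (np_P k b1 a1 u v)) / (16 - c * c) in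
  let de x := (4 * mink x (np_P k b1 a1 u v) - c * mink x (np_P h a1 b1 u v)) / (16 - c * c) in
  mink (transfer h k a1 b1 a2 b2 w u v) (transfer h k a1 b1 a2 b2 w' u v) =
  (al w * be w' + be w * al w') * f + 4 * (ga w * ga w' + de w * de w') + c * (ga w * de w' + de w * ga w').
Proof.
intros HD N2 Huv Ef Ec f c al be ga de.
assert (N2' := null_pair_sym _ _ _ _ _ N2).
unfold transfer; fold f c.
change (mink (plus (plus (scal (al w) (a2 u v)) (scal (be w) (b2 u v)))
    (plus (scal (ga w) (np_P h a2 b2 u v)) (scal (de w) (np_P k b2 a2 u v))))
  (plus (plus (scal (al w') (a2 u v)) (scal (be w') (b2 u v)))
    (plus (scal (ga w') (np_P h a2 b2 u v)) (scal (de w') (np_P k b2 a2 u v)))) =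
  (al w * be w' + be w * al w') * f + 4 * (ga w * ga w' + de w * de w') + c * (ga w * de w' + de w * ga w')).
generalize (al w) (be w) (ga w) (de w) (al w') (be w') (ga w') (de w').
intros; mink_expand.
rewrite (mink_sym (a2 u v) (np_P h a2 b2 u v)), (mink_sym (b2 u v) (np_P h a2 b2 u v)),
  (mink_sym (a2 u v) (np_P k b2 a2 u v)), (mink_sym (b2 u v) (np_P k b2 a2 u v)),
  (mink_sym (np_P k b2 a2 u v) (np_P h a2 b2 u v)), (mink_sym (b2 u v) (a2 u v)).
rewrite (np_P_a HD N2), (np_P_b HD N2), (np_P_a HD N2'), (np_P_b HD N2'), (np_P_P HD N2), (np_P_P HD N2'),
  (np_aa N2), (np_bb N2); auto.
change (mink (a2 u v) (b2 u v)) with (np_f a2 b2 u v).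
change (mink (np_P h a2 b2 u v) (np_P k b2 a2 u v)) with (np_c h k a2 b2 u v).
rewrite <- Ef, <- Ec; fold f c; clearbody f c; ring.
Qed.

Lemma transfer_frame (D : R * R -> Prop) (h k : R * R) (a1 b1 a2 b2 : R -> R -> R4) (u v : R) :
  open D -> null_pair D h k a1 b1 -> D (u, v) ->
  transfer h k a1 b1 a2 b2 (a1 u v) u v = a2 u v /\
  transfer h k a1 b1 a2 b2 (b1 u v) u v = b2 u v.
Proof.
intros HD N1 Huv.
assert (N1' := null_pair_sym _ _ _ _ _ N1).
assert (nf := np_f_neq0 N1 u v Huv).
unfold transfer.
rewrite (mink_sym (a1 u v) (np_P h a1 b1 u v)), (mink_sym (b1 u v) (np_P h a1 b1 u v)),
  (mink_sym (a1 u v) (np_P k b1 a1 u v)), (mink_sym (b1 u v) (np_P k b1 a1 u v)), (mink_sym (b1 u v) (a1 u v)).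
rewrite (np_P_a HD N1), (np_P_b HD N1), (np_P_a HD N1'), (np_P_b HD N1'),
  (np_aa N1), (np_bb N1); auto.
change (mink (a1 u v) (b1 u v)) with (np_f a1 b1 u v).
revert nf.
generalize (np_P h a2 b2 u v) (np_P k b2 a2 u v) (a2 u v) (b2 u v) (np_f a1 b1 u v) (np_c h k a1 b1 u v).
intros p q a b f c nf.
replace (f / f) with 1 by (field; auto).
replace (0 / f) with 0 by (field; auto).
rewrite !Rmult_0_r; unfold Rdiv; rewrite !Rminus_diag, !Rmult_0_l.
split; R4_ring.
Qed.

Lemma transfer_id (D : R * R -> Prop) (h k : R * R) (a b : R -> R -> R4) (w : R4) (u v : R) :
  open D -> null_pair D h k a b -> D (u, v) -> 16 - (np_c h k a b u v) ^ 2 <> 0 ->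
  transfer h k a b a b w u v = w.
Proof.
intros HD N Huv Hc.
assert (N' := null_pair_sym _ _ _ _ _ N).
assert (nf := np_f_neq0 N u v Huv).
apply (mink_ext (a u v) (b u v) (np_P h a b u v) (np_P k b a u v)).
- now apply (np_gram_neq0 HD N).
- unfold transfer; mink_expand.
  rewrite (mink_sym (b u v) (a u v)), (np_P_a HD N), (np_P_b HD N'), (np_aa N); auto.
  change (mink (a u v) (b u v)) with (np_f a b u v).
  rewrite !Rmult_0_r; field; auto.
- unfold transfer; mink_expand.
  rewrite (np_P_b HD N), (np_P_a HD N'), (np_bb N); auto.
  change (mink (a u v) (b u v)) with (np_f a b u v).
  rewrite !Rmult_0_r; field; auto.
- unfold transfer; mink_expand.
  rewrite (mink_sym (a u v)), (mink_sym (b u v)), (mink_sym (np_P k b a u v)), (np_P_P HD N), (np_P_a HD N), (np_P_b HD N); auto.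
  change (mink (np_P h a b u v) (np_P k b a u v)) with (np_c h k a b u v).
  revert Hc; generalize (np_c h k a b u v); intros c Hc.
  rewrite !Rmult_0_r; field; contradict Hc; rewrite <- Hc; ring.
- unfold transfer; mink_expand.
  rewrite (mink_sym (a u v)), (mink_sym (b u v)), (np_P_P HD N'), (np_P_a HD N'), (np_P_b HD N'); auto.
  change (mink (np_P h a b u v) (np_P k b a u v)) with (np_c h k a b u v).
  revert Hc; generalize (np_c h k a b u v); intros c Hc.
  rewrite !Rmult_0_r; field; contradict Hc; rewrite <- Hc; ring.
Qed.

Lemma null_pair_unique (x0 y0 eps : R) (a1 b1 a2 b2 : R -> R -> R4) :
  let D := diamond x0 y0 eps in
  0 < eps ->
  null_pair D (1, 1) (1, -1) a1 b1 -> null_pair D (1, 1) (1, -1) a2 b2 ->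
  (forall x y, D (x, y) -> np_f a1 b1 x y = np_f a2 b2 x y) ->
  (forall x y, D (x, y) -> 16 - (np_c (1, 1) (1, -1) a1 b1 x y) ^ 2 <> 0) ->
  exists L : R4 -> R4,
    (forall p q, L (plus p q) = plus (L p) (L q)) /\
    (forall (r : R) p, L (scal r p) = scal r (L p)) /\
    (forall p q, mink (L p) (L q) = mink p q) /\
    (forall u v, D (u, v) -> L (a1 u v) = a2 u v /\ L (b1 u v) = b2 u v).
Proof.
intros D Heps N1 N2 Hf Hc.
assert (HD : open D) by apply open_diamond.
assert (H0 : D (x0, y0)) by now apply diamond_center.
exists (fun w => transfer (1, 1) (1, -1) a1 b1 a2 b2 w x0 y0).
destruct (transfer_linear (1, 1) (1, -1) a1 b1 a2 b2 x0 y0) as [T1 T2].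
split; [ | split; [ | split ] ]; auto.
- intros p q.
  (* The transfer of a pair to itself is the identity and has the same products as the transfer to
     the second pair. *)
  transitivity (mink (transfer (1, 1) (1, -1) a1 b1 a1 b1 p x0 y0) (transfer (1, 1) (1, -1) a1 b1 a1 b1 q x0 y0)).
  + rewrite (mink_transfer_transfer D (1, 1) (1, -1) a1 b1 a2 b2), (mink_transfer_transfer D (1, 1) (1, -1) a1 b1 a1 b1); auto.
    now apply (np_c_ext D).
  + rewrite !(transfer_id D); auto.
- intros u v Huv.
  rewrite <- !(transfer_constant x0 y0 eps a1 b1 a2 b2 _ u v); auto.
  now apply (transfer_frame D).
Qed.

Lemma R4_basis (p : R4) :
  p = plus (plus (scal (coord1 p) (1, 0, 0, 0)) (scal (coord2 p) (0, 1, 0, 0)))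
           (plus (scal (coord3 p) (0, 0, 1, 0)) (scal (coord4 p) (0, 0, 0, 1))).
Proof.
apply R4_ext; R4_coords; unfold coord1, coord2, coord3, coord4; simpl; ring.
Qed.

(** A linear [L] is a combination of the coordinates with constant vector coefficients, the images
    of the standard basis, so it commutes with differentiation. *)
Lemma vdir_linear_map (D : R * R -> Prop) (h : R * R) (L : R4 -> R4) (w : R -> R -> R4) (u v : R) :
  (forall p q, L (plus p q) = plus (L p) (L q)) ->
  (forall (r : R) p, L (scal r p) = scal r (L p)) ->
  open D -> smooth4 D w -> D (u, v) ->
  smooth4 D (fun x y => L (w x y)) /\ vdir h (fun x y => L (w x y)) u v = L (vdir h w u v).
Proof.
intros L1 L2 HD Hw Huv.
assert (E : forall p, L p =
  plus (plus (scal (coord1 p) (L (1, 0, 0, 0))) (scal (coord2 p) (L (0, 1, 0, 0))))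
       (plus (scal (coord3 p) (L (0, 0, 1, 0))) (scal (coord4 p) (L (0, 0, 0, 1))))).
{ intros p; rewrite (R4_basis p) at 1; now rewrite !L1, !L2. }
destruct Hw as (w1 & w2 & w3 & w4).
set (t1 := (fun x y => scal (coord1 (w x y)) (L (1, 0, 0, 0))) : R -> R -> R4).
set (t2 := (fun x y => scal (coord2 (w x y)) (L (0, 1, 0, 0))) : R -> R -> R4).
set (t3 := (fun x y => scal (coord3 (w x y)) (L (0, 0, 1, 0))) : R -> R -> R4).
set (t4 := (fun x y => scal (coord4 (w x y)) (L (0, 0, 0, 1))) : R -> R -> R4).
assert (s1 : smooth4 D t1) by (apply smooth4_scal; auto with smo).
assert (s2 : smooth4 D t2) by (apply smooth4_scal; auto with smo).
assert (s3 : smooth4 D t3) by (apply smooth4_scal; auto with smo).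
assert (s4 : smooth4 D t4) by (apply smooth4_scal; auto with smo).
assert (E' : forall x y, L (w x y) = plus (plus (t1 x y) (t2 x y)) (plus (t3 x y) (t4 x y))).
{ intros x y; apply E. }
split.
- apply smooth4_ext with (2 := fun x y _ => eq_sym (E' x y)); auto with smo.
- rewrite (vdir_ext D h _ _ u v HD (fun x y _ => E' x y) Huv), E.
  rewrite (vdir_plus D h (fun x y => plus (t1 x y) (t2 x y)) (fun x y => plus (t3 x y) (t4 x y))),
    (vdir_plus D h t1 t2), (vdir_plus D h t3 t4); auto with smo.
  unfold t1, t2, t3, t4.
  rewrite (vdir_scal D h (fun x y => coord1 (w x y))), (vdir_scal D h (fun x y => coord2 (w x y))),
    (vdir_scal D h (fun x y => coord3 (w x y))), (vdir_scal D h (fun x y => coord4 (w x y))), !vdir_const; auto with smo.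
  change (coord1 (vdir h w u v)) with (dir h (fun x y => coord1 (w x y)) u v).
  change (coord2 (vdir h w u v)) with (dir h (fun x y => coord2 (w x y)) u v).
  change (coord3 (vdir h w u v)) with (dir h (fun x y => coord3 (w x y)) u v).
  change (coord4 (vdir h w u v)) with (dir h (fun x y => coord4 (w x y)) u v).
  R4_ring.
Qed.

(** * The second fundamental tensor through directional derivatives *)

Lemma flat_conn_vdir (X : tfield) (w : R -> R -> R4) (u v : R) : flat_conn X w u v = vdir (X u v) w u v.
Proof. unfold flat_conn; now rewrite partial4_10, partial4_01, <- vdir_linear. Qed.

Lemma push_vdir (z : R -> R -> R4) (a : R * R) (u v : R) : push z a u v = vdir a z u v.
Proof. unfold push; now rewrite partial4_10, partial4_01, <- vdir_linear. Qed.

Lemma mink_normal_part (z : R -> R -> R4) (u v : R) (w e : R4) :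
  mink e (vdir (1, 0) z u v) = 0 -> mink e (vdir (0, 1) z u v) = 0 ->
  mink (normal_part z u v w) e = mink w e.
Proof.
intros H1 H2; unfold normal_part; rewrite partial4_10, partial4_01; mink_expand.
rewrite !(mink_sym (vdir _ _ _ _) e), H1, H2; ring.
Qed.

Lemma fE_vdir (z : R -> R -> R4) (u v : R) : fE z u v = mink (vdir (1, 0) z u v) (vdir (1, 0) z u v).
Proof. unfold fE; now rewrite partial4_10. Qed.
Lemma fF_vdir (z : R -> R -> R4) (u v : R) : fF z u v = mink (vdir (1, 0) z u v) (vdir (0, 1) z u v).
Proof. unfold fF; now rewrite partial4_10, partial4_01. Qed.
Lemma fG_vdir (z : R -> R -> R4) (u v : R) : fG z u v = mink (vdir (0, 1) z u v) (vdir (0, 1) z u v).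
Proof. unfold fG; now rewrite partial4_01. Qed.

Lemma normal_part_orth (z : R -> R -> R4) (u v : R) (w : R4) :
  fE z u v * fG z u v - fF z u v ^ 2 <> 0 ->
  mink (normal_part z u v w) (vdir (1, 0) z u v) = 0 /\ mink (normal_part z u v w) (vdir (0, 1) z u v) = 0.
Proof.
intros HW; unfold normal_part; rewrite partial4_10, partial4_01; mink_expand.
rewrite (mink_sym (vdir (0, 1) z u v) (vdir (1, 0) z u v)), <- fE_vdir, <- fF_vdir, <- fG_vdir.
split; field; simpl in HW; auto.
Qed.

(** The derivatives of the components of [Y] multiply z_u and z_v, which a normal vector [e]
    annihilates; what remains is bilinear in the values of [X] and [Y]. *)
Lemma mink_second_fund (D : R * R -> Prop) (z : R -> R -> R4) (X Y : tfield) (e : R4) (u v : R) :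
  open D -> smooth4 D z -> smooth_tfield D Y -> D (u, v) ->
  mink e (vdir (1, 0) z u v) = 0 -> mink e (vdir (0, 1) z u v) = 0 ->
  mink (second_fund z X Y u v) e =
    fst (X u v) * fst (Y u v) * mink (vdir (1, 0) (vdir (1, 0) z) u v) e +
    (fst (X u v) * snd (Y u v) + snd (X u v) * fst (Y u v)) * mink (vdir (1, 0) (vdir (0, 1) z) u v) e +
    snd (X u v) * snd (Y u v) * mink (vdir (0, 1) (vdir (0, 1) z) u v) e.
Proof.
intros HD Hz [Y1 Y2] Huv H1 H2.
unfold second_fund; rewrite mink_normal_part; auto.
rewrite flat_conn_vdir, (vdir_ext D _ _ (fun x y => plus (scal (fst (Y x y)) (vdir (1, 0) z x y)) (scal (snd (Y x y)) (vdir (0, 1) z x y)))); auto.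
2: { intros x y _; rewrite push_vdir; apply vdir_linear. }
rewrite (vdir_plus D (X u v) (fun x y => scal (fst (Y x y)) (vdir (1, 0) z x y)) (fun x y => scal (snd (Y x y)) (vdir (0, 1) z x y)));
  auto; try (apply smooth4_scal; auto with smo).
rewrite (vdir_scal D (X u v) (fun x y => fst (Y x y))), (vdir_scal D (X u v) (fun x y => snd (Y x y))); auto with smo.
rewrite (vdir_linear (X u v) (vdir (1, 0) z)), (vdir_linear (X u v) (vdir (0, 1) z)), (vdir_comm D (0, 1) (1, 0)); auto.
mink_expand; rewrite (mink_sym (vdir (1, 0) z u v) e), (mink_sym (vdir (0, 1) z u v) e), H1, H2.
ring.
Qed.

(** A geometric frame in canonical parameters, rewritten without square roots or projections, as a
    list of scalar products. As x = sqrt(rho) z_u and y = sqrt(rho) z_v, the products of the second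
    derivatives with the normals are [nu] and [mu] divided by [rho]. *)
Record canon_frame (D : R * R -> Prop) (z n1 n2 : R -> R -> R4) (nu mu rho : R -> R -> R) : Prop := {
  cf_z : smooth4 D z;
  cf_n1 : smooth4 D n1;
  cf_n2 : smooth4 D n2;
  cf_nu : smooth D nu;
  cf_mu : smooth D mu;
  cf_rho : smooth D rho;
  cf_rho_pos : forall u v, D (u, v) -> 0 < rho u v;
  cf_rho2 : forall u v, D (u, v) -> rho u v ^ 2 = nu u v ^ 2 + mu u v ^ 2;
  cf_numu : forall u v, D (u, v) -> nu u v * mu u v <> 0;
  cf_E : forall u v, D (u, v) -> mink (vdir (1, 0) z u v) (vdir (1, 0) z u v) = - / rho u v;
  cf_F : forall u v, D (u, v) -> mink (vdir (1, 0) z u v) (vdir (0, 1) z u v) = 0;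
  cf_G : forall u v, D (u, v) -> mink (vdir (0, 1) z u v) (vdir (0, 1) z u v) = / rho u v;
  cf_11 : forall u v, D (u, v) -> mink (n1 u v) (n1 u v) = 1;
  cf_22 : forall u v, D (u, v) -> mink (n2 u v) (n2 u v) = 1;
  cf_12 : forall u v, D (u, v) -> mink (n1 u v) (n2 u v) = 0;
  cf_1u : forall u v, D (u, v) -> mink (n1 u v) (vdir (1, 0) z u v) = 0;
  cf_1v : forall u v, D (u, v) -> mink (n1 u v) (vdir (0, 1) z u v) = 0;
  cf_2u : forall u v, D (u, v) -> mink (n2 u v) (vdir (1, 0) z u v) = 0;
  cf_2v : forall u v, D (u, v) -> mink (n2 u v) (vdir (0, 1) z u v) = 0;
  cf_uu1 : forall u v, D (u, v) -> mink (vdir (1, 0) (vdir (1, 0) z) u v) (n1 u v) = nu u v / rho u v;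
  cf_uu2 : forall u v, D (u, v) -> mink (vdir (1, 0) (vdir (1, 0) z) u v) (n2 u v) = 0;
  cf_uv1 : forall u v, D (u, v) -> mink (vdir (1, 0) (vdir (0, 1) z) u v) (n1 u v) = 0;
  cf_uv2 : forall u v, D (u, v) -> mink (vdir (1, 0) (vdir (0, 1) z) u v) (n2 u v) = mu u v / rho u v;
  cf_vv1 : forall u v, D (u, v) -> mink (vdir (0, 1) (vdir (0, 1) z) u v) (n1 u v) = nu u v / rho u v;
  cf_vv2 : forall u v, D (u, v) -> mink (vdir (0, 1) (vdir (0, 1) z) u v) (n2 u v) = 0 }.

Arguments cf_z {D z n1 n2 nu mu rho}.
Arguments cf_n1 {D z n1 n2 nu mu rho}.
Arguments cf_n2 {D z n1 n2 nu mu rho}.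
Arguments cf_nu {D z n1 n2 nu mu rho}.
Arguments cf_mu {D z n1 n2 nu mu rho}.
Arguments cf_rho {D z n1 n2 nu mu rho}.
Arguments cf_rho_pos {D z n1 n2 nu mu rho}.
Arguments cf_rho2 {D z n1 n2 nu mu rho}.
Arguments cf_numu {D z n1 n2 nu mu rho}.
Arguments cf_E {D z n1 n2 nu mu rho}.
Arguments cf_F {D z n1 n2 nu mu rho}.
Arguments cf_G {D z n1 n2 nu mu rho}.
Arguments cf_11 {D z n1 n2 nu mu rho}.
Arguments cf_22 {D z n1 n2 nu mu rho}.
Arguments cf_12 {D z n1 n2 nu mu rho}.
Arguments cf_1u {D z n1 n2 nu mu rho}.
Arguments cf_1v {D z n1 n2 nu mu rho}.
Arguments cf_2u {D z n1 n2 nu mu rho}.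
Arguments cf_2v {D z n1 n2 nu mu rho}.
Arguments cf_uu1 {D z n1 n2 nu mu rho}.
Arguments cf_uu2 {D z n1 n2 nu mu rho}.
Arguments cf_uv1 {D z n1 n2 nu mu rho}.
Arguments cf_uv2 {D z n1 n2 nu mu rho}.
Arguments cf_vv1 {D z n1 n2 nu mu rho}.
Arguments cf_vv2 {D z n1 n2 nu mu rho}.

Lemma sqrt_inv_mult (x : R) : 0 < x -> / sqrt (/ x) * / sqrt (/ x) = x.
Proof.
intros Hx; rewrite <- Rinv_mult, sqrt_sqrt; [ field; lra | ].
apply Rlt_le, Rinv_0_lt_compat; auto.
Qed.

Lemma geometric_frame_canon (D : R * R -> Prop) (z n1 n2 : R -> R -> R4) (nu mu rho : R -> R -> R) :
  open D -> smooth4 D z -> geometric_frame D z (unit_u z) (unit_v z) n1 n2 nu mu ->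
  (forall u v, D (u, v) ->
     0 < rho u v /\ rho u v ^ 2 = nu u v ^ 2 + mu u v ^ 2 /\
     fE z u v = - / rho u v /\ fF z u v = 0 /\ fG z u v = / rho u v) ->
  canon_frame D z n1 n2 nu mu rho.
Proof.
intros HD Hz (HX & HY & Hn1 & Hn2 & HF) Hrho.
assert (HF' : forall u v, D (u, v) -> orthonormal_normal z (n1 u v) (n2 u v) u v) by (intros; now apply HF).
assert (h1u : forall u v, D (u, v) -> mink (n1 u v) (vdir (1, 0) z u v) = 0).
{ intros u v Huv; destruct (HF' u v Huv) as (_ & _ & _ & H & _); now rewrite partial4_10 in H. }
assert (h1v : forall u v, D (u, v) -> mink (n1 u v) (vdir (0, 1) z u v) = 0).
{ intros u v Huv; destruct (HF' u v Huv) as (_ & _ & _ & _ & H & _); now rewrite partial4_01 in H. }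
assert (h2u : forall u v, D (u, v) -> mink (n2 u v) (vdir (1, 0) z u v) = 0).
{ intros u v Huv; destruct (HF' u v Huv) as (_ & _ & _ & _ & _ & H & _); now rewrite partial4_10 in H. }
assert (h2v : forall u v, D (u, v) -> mink (n2 u v) (vdir (0, 1) z u v) = 0).
{ intros u v Huv; destruct (HF' u v Huv) as (_ & _ & _ & _ & _ & _ & H); now rewrite partial4_01 in H. }
assert (h11 : forall u v, D (u, v) -> mink (n1 u v) (n1 u v) = 1) by (intros; now apply HF').
assert (h22 : forall u v, D (u, v) -> mink (n2 u v) (n2 u v) = 1) by (intros; now apply HF').
assert (h12 : forall u v, D (u, v) -> mink (n1 u v) (n2 u v) = 0) by (intros; now apply HF').
assert (sf : forall X Y e u v, D (u, v) -> smooth_tfield D Y -> mink e (vdir (1, 0) z u v) = 0 ->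
  mink e (vdir (0, 1) z u v) = 0 -> forall k n, second_fund z X Y u v = scal k n ->
  fst (X u v) * fst (Y u v) * mink (vdir (1, 0) (vdir (1, 0) z) u v) e +
    (fst (X u v) * snd (Y u v) + snd (X u v) * fst (Y u v)) * mink (vdir (1, 0) (vdir (0, 1) z) u v) e +
    snd (X u v) * snd (Y u v) * mink (vdir (0, 1) (vdir (0, 1) z) u v) e = k * mink n e).
{ intros X Y e u v Huv sY He1 He2 k n E.
  rewrite <- (mink_second_fund D z X Y e u v), E; auto; apply mink_scal_l. }
assert (key : forall u v, D (u, v) ->
  mink (vdir (1, 0) (vdir (1, 0) z) u v) (n1 u v) = nu u v / rho u v /\
  mink (vdir (1, 0) (vdir (1, 0) z) u v) (n2 u v) = 0 /\
  mink (vdir (1, 0) (vdir (0, 1) z) u v) (n1 u v) = 0 /\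
  mink (vdir (1, 0) (vdir (0, 1) z) u v) (n2 u v) = mu u v / rho u v /\
  mink (vdir (0, 1) (vdir (0, 1) z) u v) (n1 u v) = nu u v / rho u v /\
  mink (vdir (0, 1) (vdir (0, 1) z) u v) (n2 u v) = 0).
{ intros u v Huv; destruct (HF u v Huv) as (_ & _ & s11 & s12 & s22 & _).
  destruct (Hrho u v Huv) as (r1 & r2 & rE & rF & rG).
  assert (A1 := sf _ _ (n1 u v) u v Huv HX (h1u u v Huv) (h1v u v Huv) _ _ s11).
  assert (A2 := sf _ _ (n2 u v) u v Huv HX (h2u u v Huv) (h2v u v Huv) _ _ s11).
  assert (A3 := sf _ _ (n1 u v) u v Huv HY (h1u u v Huv) (h1v u v Huv) _ _ s12).
  assert (A4 := sf _ _ (n2 u v) u v Huv HY (h2u u v Huv) (h2v u v Huv) _ _ s12).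
  assert (A5 := sf _ _ (n1 u v) u v Huv HY (h1u u v Huv) (h1v u v Huv) _ _ s22).
  assert (A6 := sf _ _ (n2 u v) u v Huv HY (h2u u v Huv) (h2v u v Huv) _ _ s22).
  unfold unit_u, unit_v, Rdiv in A1, A2, A3, A4, A5, A6; cbn [fst snd] in A1, A2, A3, A4, A5, A6.
  rewrite (mink_sym (n2 u v) (n1 u v)) in A3.
  rewrite h11 in A1, A5 by auto; rewrite h22 in A4 by auto; rewrite h12 in A2, A3, A6 by auto.
  rewrite rE, Ropp_involutive in A1, A2, A3, A4; rewrite rG in A3, A4, A5, A6.
  (* Both unit fields carry the factor [/ sqrt (/ rho u v)], whose square is [rho u v]; this is the
     origin of the quotients by [rho]. *)
  assert (S := sqrt_inv_mult (rho u v) r1).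
  assert (Hr : rho u v <> 0) by lra.
  assert (Hc : forall x, rho u v * (x / rho u v) = x) by (intros; field; auto).
  repeat split; apply Rmult_eq_reg_l with (2 := Hr); rewrite ?Hc, ?Rmult_0_r, <- S; lra. }
assert (srho : smooth D rho).
{ apply smooth_ext with (fun u v => - / mink (vdir (1, 0) z u v) (vdir (1, 0) z u v)); auto.
  - intros u v Huv; destruct (Hrho u v Huv) as (r1 & r2 & rE & rF & rG).
    rewrite <- fE_vdir, rE; field; lra.
  - apply smooth_opp; auto; apply smooth_inv; auto with smo.
    intros u v Huv; destruct (Hrho u v Huv) as (r1 & r2 & rE & rF & rG).
    rewrite <- fE_vdir, rE; apply Ropp_neq_0_compat, Rinv_neq_0_compat; lra. }
(* A geometric frame comes with smooth vector fields only; the smoothness of [nu] and [mu] is read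
   off from <z_uu, n1> rho and <z_uv, n2> rho. *)
constructor; auto.
- apply smooth_ext with (fun u v => mink (vdir (1, 0) (vdir (1, 0) z) u v) (n1 u v) * rho u v); auto with smo.
  intros u v Huv; destruct (key u v Huv) as (-> & _); field.
  destruct (Hrho u v Huv); lra.
- apply smooth_ext with (fun u v => mink (vdir (1, 0) (vdir (0, 1) z) u v) (n2 u v) * rho u v); auto with smo.
  intros u v Huv; destruct (key u v Huv) as (_ & _ & _ & -> & _); field.
  destruct (Hrho u v Huv); lra.
- intros u v Huv; exact (proj1 (Hrho u v Huv)).
- intros u v Huv; exact (proj1 (proj2 (Hrho u v Huv))).
- intros u v Huv; destruct (HF u v Huv) as (_ & _ & _ & _ & _ & H); exact H.
- intros u v Huv; rewrite <- fE_vdir; exact (proj1 (proj2 (proj2 (Hrho u v Huv)))).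
- intros u v Huv; rewrite <- fF_vdir; exact (proj1 (proj2 (proj2 (proj2 (Hrho u v Huv))))).
- intros u v Huv; rewrite <- fG_vdir; exact (proj2 (proj2 (proj2 (proj2 (Hrho u v Huv))))).
- intros u v Huv; exact (proj1 (key u v Huv)).
- intros u v Huv; exact (proj1 (proj2 (key u v Huv))).
- intros u v Huv; exact (proj1 (proj2 (proj2 (key u v Huv)))).
- intros u v Huv; exact (proj1 (proj2 (proj2 (proj2 (key u v Huv))))).
- intros u v Huv; exact (proj1 (proj2 (proj2 (proj2 (proj2 (key u v Huv)))))).
- intros u v Huv; exact (proj2 (proj2 (proj2 (proj2 (proj2 (key u v Huv)))))).
Qed.

(** * Linear algebra in a canonical frame *)

Section CanonFrame.
Context {D : R * R -> Prop} {z n1 n2 : R -> R -> R4} {nu mu rho : R -> R -> R}.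
Context (HD : open D) (C : canon_frame D z n1 n2 nu mu rho).

Let zu := vdir (1, 0) z.
Let zv := vdir (0, 1) z.

Lemma cf_rho_neq0 (u v : R) : D (u, v) -> rho u v <> 0.
Proof. intros Huv; pose proof (cf_rho_pos C u v Huv); lra. Qed.

(** The frame is orthogonal with squares -1/rho, 1/rho, 1, 1. *)
Lemma cf_gram (u v : R) : D (u, v) -> gram (zu u v) (zv u v) (n1 u v) (n2 u v) = - / rho u v * / rho u v.
Proof.
intros Huv; unfold gram, gram_row, det4.
rewrite (mink_sym (zu u v) (n1 u v)), (mink_sym (zu u v) (n2 u v)), (mink_sym (zv u v) (n1 u v)),
  (mink_sym (zv u v) (n2 u v)), (mink_sym (zv u v) (zu u v)), (mink_sym (n2 u v) (n1 u v)).
unfold zu, zv; rewrite (cf_E C), (cf_F C), (cf_G C), (cf_11 C),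
  (cf_12 C), (cf_22 C), (cf_1u C), (cf_1v C),
  (cf_2u C), (cf_2v C); auto.
generalize (/ rho u v); intros; ring.
Qed.

Lemma cf_ext (u v : R) (w w' : R4) : D (u, v) ->
  mink w (zu u v) = mink w' (zu u v) -> mink w (zv u v) = mink w' (zv u v) ->
  mink w (n1 u v) = mink w' (n1 u v) -> mink w (n2 u v) = mink w' (n2 u v) -> w = w'.
Proof.
intros Huv; apply mink_ext; rewrite cf_gram; auto.
assert (H := Rinv_neq_0_compat _ (cf_rho_neq0 u v Huv)).
apply Rmult_integral_contrapositive_currified; auto; now apply Ropp_neq_0_compat.
Qed.

Lemma cf_expand (u v : R) (w : R4) : D (u, v) ->
  w = plus (plus (scal (- rho u v * mink w (zu u v)) (zu u v)) (scal (rho u v * mink w (zv u v)) (zv u v)))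
           (plus (scal (mink w (n1 u v)) (n1 u v)) (scal (mink w (n2 u v)) (n2 u v))).
Proof.
intros Huv; assert (Hr := cf_rho_neq0 u v Huv); apply (cf_ext u v); auto; mink_expand;
rewrite ?(mink_sym (zu u v) (n1 u v)), ?(mink_sym (zu u v) (n2 u v)), ?(mink_sym (zv u v) (n1 u v)),
  ?(mink_sym (zv u v) (n2 u v)), ?(mink_sym (zv u v) (zu u v)), ?(mink_sym (n2 u v) (n1 u v));
unfold zu, zv; rewrite ?(cf_E C), ?(cf_F C), ?(cf_G C), ?(cf_11 C),
  ?(cf_12 C), ?(cf_22 C), ?(cf_1u C), ?(cf_1v C),
  ?(cf_2u C), ?(cf_2v C); auto;
generalize (mink w (vdir (1, 0) z u v)) (mink w (vdir (0, 1) z u v)) (mink w (n1 u v)) (mink w (n2 u v));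
revert Hr; generalize (rho u v); intros; field; auto.
Qed.

Lemma cf_parseval (u v : R) (w w' : R4) : D (u, v) ->
  mink w w' = - rho u v * mink w (zu u v) * mink w' (zu u v) + rho u v * mink w (zv u v) * mink w' (zv u v)
    + mink w (n1 u v) * mink w' (n1 u v) + mink w (n2 u v) * mink w' (n2 u v).
Proof.
intros Huv; rewrite (cf_expand u v w Huv) at 1; mink_expand.
rewrite !(mink_sym _ w'); ring.
Qed.

Lemma cf_orthonormal (u v : R) : D (u, v) -> orthonormal_normal z (n1 u v) (n2 u v) u v.
Proof.
intros Huv; unfold orthonormal_normal; rewrite partial4_10, partial4_01.
destruct C; repeat split; auto.
Qed.

Lemma cf_unit (u v : R) : D (u, v) ->
  unit_u z u v = (sqrt (rho u v), 0) /\ unit_v z u v = (0, sqrt (rho u v)).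
Proof.
intros Huv; assert (Hr := cf_rho_pos C u v Huv).
unfold unit_u, unit_v; rewrite fE_vdir, fG_vdir, (cf_E C), (cf_G C), Ropp_involutive; auto.
assert (E : 1 / sqrt (/ rho u v) = sqrt (rho u v)).
{ rewrite sqrt_inv; unfold Rdiv; rewrite Rinv_inv; ring. }
now rewrite E.
Qed.

Lemma cf_W (u v : R) : D (u, v) -> fE z u v * fG z u v - fF z u v ^ 2 <> 0.
Proof.
intros Huv; rewrite fE_vdir, fF_vdir, fG_vdir, (cf_E C), (cf_F C), (cf_G C); auto.
assert (H := Rinv_0_lt_compat _ (cf_rho_pos C u v Huv)); nra.
Qed.

Lemma cf_second_fund (X Y : tfield) (u v : R) : smooth_tfield D Y -> D (u, v) ->
  second_fund z X Y u v =
  plus (scal ((fst (X u v) * fst (Y u v) + snd (X u v) * snd (Y u v)) * (nu u v / rho u v)) (n1 u v))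
       (scal ((fst (X u v) * snd (Y u v) + snd (X u v) * fst (Y u v)) * (mu u v / rho u v)) (n2 u v)).
Proof.
intros HY Huv; apply (cf_ext u v); auto; mink_expand.
- unfold second_fund at 1, zu; rewrite (proj1 (normal_part_orth z u v _ (cf_W u v Huv))).
  rewrite (cf_1u C), (cf_2u C); auto; ring.
- unfold second_fund at 1, zv; rewrite (proj2 (normal_part_orth z u v _ (cf_W u v Huv))).
  rewrite (cf_1v C), (cf_2v C); auto; ring.
- rewrite (mink_second_fund D), (mink_sym (n2 u v)), (cf_uu1 C), (cf_uv1 C), (cf_vv1 C), (cf_11 C), (cf_12 C);
    auto; try (now apply C); ring.
- rewrite (mink_second_fund D), (cf_uu2 C), (cf_uv2 C), (cf_vv2 C), (cf_12 C), (cf_22 C);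
    auto; try (now apply C); ring.
Qed.

End CanonFrame.

(** * The Ricci equation *)

Lemma dir_mink_const (D : R * R -> Prop) (h : R * R) (w w' : R -> R -> R4) (r : R) (u v : R) :
  open D -> smooth4 D w -> smooth4 D w' -> (forall x y, D (x, y) -> mink (w x y) (w' x y) = r) ->
  D (u, v) -> mink (vdir h w u v) (w' u v) = - mink (w u v) (vdir h w' u v).
Proof.
intros HD Hw Hw' H Huv; assert (E := dir_mink D h w w' u v HD Hw Hw' Huv).
rewrite (dir_ext D h _ (fun _ _ => r) u v HD) in E; auto; rewrite dir_const in E; lra.
Qed.

Section Ricci.
Context {D : R * R -> Prop} {z n1 n2 : R -> R -> R4} {nu mu rho : R -> R -> R}.
Context (HD : open D) (C : canon_frame D z n1 n2 nu mu rho).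

Let zu := vdir (1, 0) z.
Let zv := vdir (0, 1) z.
Let Hz : smooth4 D z := cf_z C.
Let Hn1 : smooth4 D n1 := cf_n1 C.
Let Hn2 : smooth4 D n2 := cf_n2 C.

Lemma mink_self_diff (h : R * R) (w : R -> R -> R4) (r u v : R) :
  smooth4 D w -> (forall x y, D (x, y) -> mink (w x y) (w x y) = r) -> D (u, v) ->
  mink (vdir h w u v) (w u v) = 0.
Proof.
intros Hw H Huv; assert (E := dir_mink_const D h w w r u v HD Hw Hw H Huv).
rewrite (mink_sym (w u v)) in E; lra.
Qed.

(** In the expansion over the frame the normal terms drop out, since d n1 is orthogonal to [n1] and
    d n2 to [n2]; the tangential components are, up to sign, the products of the second derivatives
    of [z] with the normals. *)
Lemma cf_diff_product (u v : R) : D (u, v) ->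
  mink (vdir (0, 1) n2 u v) (vdir (1, 0) n1 u v) = - (mu u v * nu u v / rho u v) /\
  mink (vdir (1, 0) n2 u v) (vdir (0, 1) n1 u v) = mu u v * nu u v / rho u v.
Proof.
intros Huv; assert (Hr := cf_rho_neq0 C u v Huv).
assert (su := smooth4_vdir D (1, 0) z HD Hz); assert (sv := smooth4_vdir D (0, 1) z HD Hz).
assert (d1u := fun l => dir_mink_const D l n1 zu 0 u v HD Hn1 su (cf_1u C) Huv).
assert (d1v := fun l => dir_mink_const D l n1 zv 0 u v HD Hn1 sv (cf_1v C) Huv).
assert (d2u := fun l => dir_mink_const D l n2 zu 0 u v HD Hn2 su (cf_2u C) Huv).
assert (d2v := fun l => dir_mink_const D l n2 zv 0 u v HD Hn2 sv (cf_2v C) Huv).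
assert (d11 := fun l => mink_self_diff l n1 1 u v Hn1 (cf_11 C) Huv).
assert (d22 := fun l => mink_self_diff l n2 1 u v Hn2 (cf_22 C) Huv).
rewrite (cf_parseval C u v (vdir (0, 1) n2 u v) (vdir (1, 0) n1 u v)),
  (cf_parseval C u v (vdir (1, 0) n2 u v) (vdir (0, 1) n1 u v)); auto.
fold zu zv; rewrite !d1u, !d1v, !d2u, !d2v, !d11, !d22.
rewrite !(mink_sym (n1 u v)), !(mink_sym (n2 u v)).
unfold zu, zv; rewrite (vdir_comm D (0, 1) (1, 0) z); auto.
rewrite (cf_uu1 C), (cf_uu2 C), (cf_uv1 C), (cf_uv2 C), (cf_vv1 C), (cf_vv2 C); auto.
split; field; auto.
Qed.

Lemma cf_normal_conn (Z : tfield) (u v : R) : D (u, v) ->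
  normal_conn z Z n2 u v = scal (mink (vdir (Z u v) n2 u v) (n1 u v)) (n1 u v).
Proof.
intros Huv; unfold normal_conn; rewrite flat_conn_vdir.
destruct (normal_part_orth z u v (vdir (Z u v) n2 u v) (cf_W C u v Huv)) as [O1 O2].
apply (cf_ext C u v); auto; mink_expand.
- rewrite O1, (cf_1u C); auto; ring.
- rewrite O2, (cf_1v C); auto; ring.
- rewrite mink_normal_part, (cf_11 C); auto; try (now apply C); ring.
- rewrite mink_normal_part, (cf_12 C), (mink_self_diff (Z u v) n2 1); auto; try (now apply C); ring.
Qed.

(** With the connection form (be1, be2) = <d n2, n1>, the curvature is rho times d_u be2 - d_v be1.
    The mixed second derivatives of [n2] cancel in this difference and the products of first
    derivatives remain. *)
Lemma cf_ricci (u v : R) : D (u, v) ->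
  mink (R_perp z (unit_u z) (unit_v z) n2 u v) (n1 u v) = - 2 * nu u v * mu u v.
Proof.
intros Huv.
set (la := fun x y => sqrt (rho x y)).
assert (sla : smooth D la) by (apply smooth_sqrt; auto; [ apply (cf_rho_pos C) | apply (cf_rho C) ]).
assert (Hla : la u v * la u v = rho u v).
{ apply sqrt_sqrt, Rlt_le, (cf_rho_pos C); auto. }
set (be1 := fun x y => mink (vdir (1, 0) n2 x y) (n1 x y)).
set (be2 := fun x y => mink (vdir (0, 1) n2 x y) (n1 x y)).
assert (s1 : smooth D be1) by (apply smooth_mink; auto with smo).
assert (s2 : smooth D be2) by (apply smooth_mink; auto with smo).
assert (dirX : forall f x y, D (x, y) -> dir (unit_u z x y) f x y = la x y * dir (1, 0) f x y).
{ intros f x y Hxy; rewrite (proj1 (cf_unit C x y Hxy)); unfold dir; simpl; fold (la x y); ring. }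
assert (dirY : forall f x y, D (x, y) -> dir (unit_v z x y) f x y = la x y * dir (0, 1) f x y).
{ intros f x y Hxy; rewrite (proj2 (cf_unit C x y Hxy)); unfold dir; simpl; fold (la x y); ring. }
assert (EX : forall x y, D (x, y) -> normal_conn z (unit_u z) n2 x y = scal (la x y * be1 x y) (n1 x y)).
{ intros x y Hxy; rewrite cf_normal_conn, vdir_linear, (proj1 (cf_unit C x y Hxy)); auto.
  mink_expand; cbn [fst snd]; fold (be1 x y) (be2 x y) (la x y); f_equal; ring. }
assert (EY : forall x y, D (x, y) -> normal_conn z (unit_v z) n2 x y = scal (la x y * be2 x y) (n1 x y)).
{ intros x y Hxy; rewrite cf_normal_conn, vdir_linear, (proj2 (cf_unit C x y Hxy)); auto.
  mink_expand; cbn [fst snd]; fold (be1 x y) (be2 x y) (la x y); f_equal; ring. }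
assert (along_dir : forall Z f, along Z f u v = dir (Z u v) f u v).
{ intros Z f; unfold along; now rewrite partial_derive_10, partial_derive_01, <- dir_linear. }
assert (B : bracket (unit_u z) (unit_v z) u v = (- (la u v * dir (0, 1) la u v), la u v * dir (1, 0) la u v)).
{ unfold bracket; rewrite !along_dir, !dirX, !dirY; auto.
  rewrite (dir_ext D (1, 0) (fun s t => fst (unit_v z s t)) (fun _ _ => 0)); auto.
  rewrite (dir_ext D (0, 1) (fun s t => snd (unit_u z s t)) (fun _ _ => 0)); auto.
  rewrite (dir_ext D (0, 1) (fun s t => fst (unit_u z s t)) la); auto.
  - rewrite (dir_ext D (1, 0) (fun s t => snd (unit_v z s t)) la); auto.
    + rewrite !dir_const; f_equal; ring.
    + intros x y Hxy; now rewrite (proj2 (cf_unit C x y Hxy)).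
  - intros x y Hxy; now rewrite (proj1 (cf_unit C x y Hxy)). }
unfold R_perp; mink_expand.
unfold normal_conn at 1 3; rewrite !flat_conn_vdir, !mink_normal_part; try (now apply C).
rewrite cf_normal_conn; auto; mink_expand; rewrite (cf_11 C), B; auto.
rewrite (vdir_ext D _ (normal_conn z (unit_v z) n2) (fun x y => scal (la x y * be2 x y) (n1 x y))); auto.
rewrite (vdir_ext D _ (normal_conn z (unit_u z) n2) (fun x y => scal (la x y * be1 x y) (n1 x y))); auto.
rewrite (vdir_scal D _ (fun x y => la x y * be2 x y)), (vdir_scal D _ (fun x y => la x y * be1 x y)); auto with smo.
mink_expand; rewrite !(mink_self_diff _ n1 1), (cf_11 C), dirX, dirY; auto; try apply (cf_11 C).
rewrite !(dir_mult D); auto.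
rewrite (vdir_linear (_, _) n2); mink_expand; cbn [fst snd].
fold (be1 u v) (be2 u v).
assert (E2 : dir (1, 0) be2 u v = mink (vdir (1, 0) (vdir (0, 1) n2) u v) (n1 u v) + mink (vdir (0, 1) n2 u v) (vdir (1, 0) n1 u v)).
{ unfold be2; apply (dir_mink D); auto with smo. }
assert (E1 : dir (0, 1) be1 u v = mink (vdir (0, 1) (vdir (1, 0) n2) u v) (n1 u v) + mink (vdir (1, 0) n2 u v) (vdir (0, 1) n1 u v)).
{ unfold be1; apply (dir_mink D); auto with smo. }
rewrite (vdir_comm D (0, 1) (1, 0)) in E1; auto.
destruct (cf_diff_product u v Huv) as [P2 P1]; rewrite P2 in E2; rewrite P1 in E1.
rewrite E1, E2.
(* The derivatives of [la] have cancelled against those brought by the bracket, leaving [la] squared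
   times the exterior derivative of the connection form. *)
transitivity ((la u v * la u v) * (- 2 * (mu u v * nu u v / rho u v))); [ ring | ].
rewrite Hla; field; now apply (cf_rho_neq0 C).
Qed.

End Ricci.

(** * The null pair of a surface in canonical parameters *)

Section CanonNull.
Context {D : R * R -> Prop} {z n1 n2 : R -> R -> R4} {nu mu rho : R -> R -> R}.
Context (HD : open D) (C : canon_frame D z n1 n2 nu mu rho).

Let zu := vdir (1, 0) z.
Let zv := vdir (0, 1) z.
Let Hz : smooth4 D z := cf_z C.

(** These are the Christoffel symbols of the first kind, obtained by differentiating E = -1/rho, F =
    0 and G = 1/rho along both parameters. *)
Lemma cf_tangential (u v : R) : D (u, v) ->
  let ir x y := / rho x y in
  mink (vdir (1, 0) zu u v) (zu u v) = - dir (1, 0) ir u v / 2 /\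
  mink (vdir (1, 0) zv u v) (zu u v) = - dir (0, 1) ir u v / 2 /\
  mink (vdir (1, 0) zv u v) (zv u v) = dir (1, 0) ir u v / 2 /\
  mink (vdir (0, 1) zv u v) (zv u v) = dir (0, 1) ir u v / 2 /\
  mink (vdir (1, 0) zu u v) (zv u v) = dir (0, 1) ir u v / 2 /\
  mink (vdir (0, 1) zv u v) (zu u v) = - dir (1, 0) ir u v / 2.
Proof.
intros Huv ir.
assert (su := smooth4_vdir D (1, 0) z HD Hz); assert (sv := smooth4_vdir D (0, 1) z HD Hz).
assert (c : vdir (0, 1) zu u v = vdir (1, 0) zv u v) by (apply (vdir_comm D); auto).
assert (Eu := fun l => dir_mink D l zu zu u v HD su su Huv).
assert (Fu := fun l => dir_mink D l zu zv u v HD su sv Huv).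
assert (Gu := fun l => dir_mink D l zv zv u v HD sv sv Huv).
assert (Eu' : forall l, dir l (fun x y => mink (zu x y) (zu x y)) u v = - dir l ir u v).
{ intros l'; rewrite <- dir_opp; apply (dir_ext D); auto; apply (cf_E C). }
assert (Fu' : forall l, dir l (fun x y => mink (zu x y) (zv x y)) u v = 0).
{ intros l'; rewrite (dir_ext D l' _ (fun _ _ => 0)); auto; [ apply dir_const | apply (cf_F C) ]. }
assert (Gu' : forall l, dir l (fun x y => mink (zv x y) (zv x y)) u v = dir l ir u v).
{ intros l'; apply (dir_ext D); auto; apply (cf_G C). }
assert (e1 := Eu (1, 0)); assert (e2 := Eu (0, 1)); assert (f1 := Fu (1, 0)); assert (f2 := Fu (0, 1)).
assert (g1 := Gu (1, 0)); assert (g2 := Gu (0, 1)).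
rewrite Eu', (mink_sym (zu u v)) in e1, e2; rewrite Fu', (mink_sym (zu u v)) in f1, f2.
rewrite Gu', (mink_sym (zv u v)) in g1, g2; rewrite c in e2, f2.
repeat split; lra.
Qed.

(** The tangential parts agree because E = -G and F = 0, the normal parts because sigma(x,x) =
    sigma(y,y). *)
Lemma cf_wave (u v : R) : D (u, v) -> vdir (0, 1) zv u v = vdir (1, 0) zu u v.
Proof.
intros Huv; destruct (cf_tangential u v Huv) as (e1 & e2 & e3 & e4 & e5 & e6).
apply (cf_ext C u v); auto; fold zu zv.
- now rewrite e1, e6.
- now rewrite e4, e5.
- unfold zu, zv; now rewrite (cf_uu1 C), (cf_vv1 C).
- unfold zu, zv; now rewrite (cf_uu2 C), (cf_vv2 C).
Qed.

Let a := vdir (1, 1) z.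
Let b := vdir (1, -1) z.

Lemma vdir_vdir_linear (h k : R * R) (u v : R) : D (u, v) ->
  vdir h (vdir k z) u v =
  plus (plus (scal (fst h * fst k) (vdir (1, 0) zu u v)) (scal (fst h * snd k + snd h * fst k) (vdir (1, 0) zv u v)))
       (scal (snd h * snd k) (vdir (0, 1) zv u v)).
Proof.
intros Huv.
assert (su := smooth4_vdir D (1, 0) z HD Hz); assert (sv := smooth4_vdir D (0, 1) z HD Hz).
rewrite (vdir_ext D h _ (fun x y => plus (scal (fst k) (zu x y)) (scal (snd k) (zv x y)))); auto.
2: { intros; apply vdir_linear. }
rewrite (vdir_plus D h (fun x y => scal (fst k) (zu x y)) (fun x y => scal (snd k) (zv x y))); auto;
  try (apply smooth4_scal; auto with smo).
rewrite (vdir_scal D h (fun _ _ => fst k)), (vdir_scal D h (fun _ _ => snd k)), !dir_const; auto with smo.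
rewrite (vdir_linear h zu), (vdir_linear h zv).
replace (vdir (0, 1) zu u v) with (vdir (1, 0) zv u v) by (apply (vdir_comm D); auto).
generalize (vdir (1, 0) zu u v) (vdir (1, 0) zv u v) (vdir (0, 1) zv u v) (zu u v) (zv u v).
intros; R4_ring.
Qed.

Lemma cf_ab (u v : R) : a u v = plus (zu u v) (zv u v) /\ b u v = minus (zu u v) (zv u v).
Proof.
unfold a, b; rewrite (vdir_linear (1, 1)), (vdir_linear (1, -1)); fold zu zv; cbn [fst snd].
generalize (zu u v) (zv u v); intros; split; R4_ring.
Qed.

Lemma cf_products (u v : R) : D (u, v) ->
  mink (zu u v) (zu u v) = - / rho u v /\ mink (zv u v) (zv u v) = / rho u v /\
  mink (zu u v) (zv u v) = 0 /\ mink (zv u v) (zu u v) = 0.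
Proof.
intros Huv; rewrite (mink_sym (zv u v) (zu u v)); unfold zu, zv.
rewrite (cf_E C), (cf_F C), (cf_G C); auto.
Qed.

Lemma cf_null_pair : null_pair D (1, 1) (1, -1) a b.
Proof.
assert (E : forall u v, D (u, v) ->
  vdir (1, 1) a u v = scal 2 (plus (vdir (1, 0) zu u v) (vdir (1, 0) zv u v)) /\
  vdir (1, -1) b u v = scal 2 (minus (vdir (1, 0) zu u v) (vdir (1, 0) zv u v)) /\
  vdir (1, -1) a u v = zero /\ vdir (1, 1) b u v = zero).
{ intros u v Huv; unfold a, b; rewrite !vdir_vdir_linear, (cf_wave u v Huv); auto; cbn [fst snd].
  generalize (vdir (1, 0) zu u v) (vdir (1, 0) zv u v); intros; split; [ | split; [ | split ] ]; R4_ring. }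
constructor.
- unfold a; auto with smo.
- unfold b; auto with smo.
- intros u v Huv; rewrite (proj1 (cf_ab u v)); mink_expand.
  destruct (cf_products u v Huv) as (-> & -> & -> & ->); ring.
- intros u v Huv; rewrite (proj2 (cf_ab u v)); mink_expand.
  destruct (cf_products u v Huv) as (-> & -> & -> & ->); ring.
- intros u v Huv; rewrite (proj1 (cf_ab u v)), (proj2 (cf_ab u v)); mink_expand.
  destruct (cf_products u v Huv) as (-> & -> & -> & ->).
  assert (Hr := Rinv_0_lt_compat _ (cf_rho_pos C u v Huv)); lra.
- intros u v Huv; exact (proj1 (proj2 (proj2 (E u v Huv)))).
- intros u v Huv; exact (proj2 (proj2 (proj2 (E u v Huv)))).
all: intros u v Huv; destruct (E u v Huv) as (E1 & E2 & _); rewrite ?E1, ?E2.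
all: destruct (cf_tangential u v Huv) as (e1 & e2 & e3 & e4 & e5 & e6).
all: rewrite (cf_parseval C u v); auto; fold zu zv; mink_expand.
all: rewrite e1, e2, e3, e5; unfold zu, zv; rewrite (cf_uu1 C), (cf_uu2 C), (cf_uv1 C), (cf_uv2 C); auto.
all: assert (H := cf_rho2 C u v Huv); assert (Hr := cf_rho_neq0 C u v Huv).
(* The tangential part of d_s a is a multiple of the null vector [a], and likewise for [b], so only
   the normal part counts; the canonical choice rho^2 = nu^2 + mu^2 makes its square 4. *)
all: transitivity (4 * (nu u v ^ 2 + mu u v ^ 2) / rho u v ^ 2); [ field; auto | rewrite <- H; field; auto ].
Qed.

Lemma cf_np_f (u v : R) : D (u, v) -> np_f a b u v = - (2 / rho u v).
Proof.
intros Huv; unfold np_f; rewrite (proj1 (cf_ab u v)), (proj2 (cf_ab u v)); mink_expand.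
destruct (cf_products u v Huv) as (-> & -> & -> & ->); unfold Rdiv; ring.
Qed.

(** The normal parts of d_s a = 2 (z_uu + z_uv) and d_t b = 2 (z_uu - z_uv) are 2 (nu n1 + mu n2) /
    rho and 2 (nu n1 - mu n2) / rho. *)
Lemma cf_np_c (u v : R) : D (u, v) ->
  np_c (1, 1) (1, -1) a b u v = 4 * (nu u v ^ 2 - mu u v ^ 2) / rho u v ^ 2.
Proof.
intros Huv; assert (N := cf_null_pair); assert (N' := null_pair_sym _ _ _ _ _ N).
assert (Hr := cf_rho_neq0 C u v Huv).
unfold np_c; rewrite (cf_parseval C u v); auto; fold zu zv.
assert (zu_ab : zu u v = scal (/ 2) (plus (a u v) (b u v))).
{ destruct (cf_ab u v) as [-> ->]; generalize (zu u v) (zv u v); intros; apply R4_ext; R4_coords; field. }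
assert (zv_ab : zv u v = scal (/ 2) (minus (a u v) (b u v))).
{ destruct (cf_ab u v) as [-> ->]; generalize (zu u v) (zv u v); intros; apply R4_ext; R4_coords; field. }
assert (Pu : mink (np_P (1, 1) a b u v) (zu u v) = 0).
{ rewrite zu_ab; mink_expand; rewrite (np_P_a HD N), (np_P_b HD N); auto; ring. }
assert (Pv : mink (np_P (1, 1) a b u v) (zv u v) = 0).
{ rewrite zv_ab; mink_expand; rewrite (np_P_a HD N), (np_P_b HD N); auto; ring. }
rewrite Pu, Pv.
assert (an : forall n, mink n (zu u v) = 0 -> mink n (zv u v) = 0 -> mink (a u v) n = 0 /\ mink (b u v) n = 0).
{ intros n H1 H2; destruct (cf_ab u v) as [-> ->]; mink_expand.
  rewrite (mink_sym (zu u v)), (mink_sym (zv u v)), H1, H2; split; ring. }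
destruct (an (n1 u v) (cf_1u C u v Huv) (cf_1v C u v Huv)) as [a1 b1].
destruct (an (n2 u v) (cf_2u C u v Huv) (cf_2v C u v Huv)) as [a2 b2].
unfold np_P; mink_expand; rewrite a1, a2, b1, b2, !Rmult_0_r, !Rmult_0_l.
unfold a, b; rewrite !vdir_vdir_linear, (cf_wave u v Huv); auto; cbn [fst snd]; mink_expand.
unfold zu, zv; rewrite (cf_uu1 C), (cf_uu2 C), (cf_uv1 C), (cf_uv2 C); auto.
field; auto.
Qed.

(** As rho^2 = nu^2 + mu^2, the difference is 64 (nu mu)^2 / rho^4. *)
Lemma cf_np_c_neq (u v : R) : D (u, v) -> 16 - np_c (1, 1) (1, -1) a b u v ^ 2 <> 0.
Proof.
intros Huv; rewrite cf_np_c; auto.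
assert (H := cf_rho2 C u v Huv); assert (Hr := cf_rho_neq0 C u v Huv); assert (Hn := cf_numu C u v Huv).
replace (16 - (4 * (nu u v ^ 2 - mu u v ^ 2) / rho u v ^ 2) ^ 2) with (64 * (nu u v * mu u v) ^ 2 / (rho u v ^ 2) ^ 2).
- apply Rmult_integral_contrapositive_currified.
  + apply Rmult_integral_contrapositive_currified; [ lra | now apply pow_nonzero ].
  + now apply Rinv_neq_0_compat, pow_nonzero, pow_nonzero.
- assert (H' : rho u v ^ 2 <> 0) by now apply pow_nonzero.
  rewrite H in *; field; auto.
Qed.

End CanonNull.

(** * Surfaces with prescribed curvatures and canonical frames *)

Lemma surface_canon_frame (D : R * R -> Prop) (z : R -> R -> R4) (K kap : R -> R -> R) :
  open D -> smooth4 D z -> canonical_parameters D z -> gauss_curvature D z K -> normal_curvature D z kap ->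
  exists n1 n2 nu mu rho, canon_frame D z n1 n2 nu mu rho /\
    forall u v, D (u, v) -> K u v = nu u v ^ 2 - mu u v ^ 2 /\ kap u v = - 2 * nu u v * mu u v.
Proof.
intros HD Hz (m1 & m2 & nu0 & mu0 & G0 & Hm) HK (n1 & n2 & nu & mu & G & Hkap).
set (rho := fun u v => sqrt (mu u v ^ 2 + nu u v ^ 2)).
(* The definitions of canonical parameters and of normal curvature each supply a geometric frame of
   their own. Both describe the same vectors sigma(x,x) and sigma(x,y), so the squares of the
   geometric functions agree, and [rho] computed from either is the same. *)
assert (sq : forall u v, D (u, v) -> nu0 u v ^ 2 = nu u v ^ 2 /\ mu0 u v ^ 2 = mu u v ^ 2).
{ intros u v Huv.
  destruct G0 as (_ & _ & _ & _ & G0); destruct (G0 u v Huv) as (_ & (o1 & o2 & _) & s1 & s2 & _ & _).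
  destruct G as (_ & _ & _ & _ & G); destruct (G u v Huv) as (_ & (o1' & o2' & _) & s1' & s2' & _ & _).
  rewrite s1 in s1'; rewrite s2 in s2'.
  assert (E1 := f_equal (fun w => mink w w) s1'); assert (E2 := f_equal (fun w => mink w w) s2').
  cbv beta in E1, E2; revert E1 E2; mink_expand; rewrite o1, o2, o1', o2'; intros; split; lra. }
assert (pos : forall u v, D (u, v) -> 0 < mu u v ^ 2 + nu u v ^ 2).
{ intros u v Huv; destruct G as (_ & _ & _ & _ & G); destruct (G u v Huv) as (_ & _ & _ & _ & _ & nz).
  assert (nu u v <> 0) by (intros E; apply nz; rewrite E; ring); pose proof (pow2_gt_0 _ H).
  pose proof (pow2_ge_0 (mu u v)); lra. }
assert (C : canon_frame D z n1 n2 nu mu rho).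
{ apply geometric_frame_canon; auto; intros u v Huv.
  destruct (sq u v Huv) as [q1 q2]; destruct (Hm u v Huv) as (E & F & G').
  rewrite q1, q2 in E, G'; fold (rho u v) in E, G'.
  split; [ | split; [ | split; [ | split ] ] ]; auto.
  - apply sqrt_lt_R0; auto.
  - unfold rho; rewrite <- Rsqr_pow2, Rsqr_sqrt; [ ring | apply Rlt_le; auto ].
  - rewrite E; unfold Rdiv; ring.
  - rewrite G'; unfold Rdiv; ring. }
exists n1, n2, nu, mu, rho; split; auto.
intros u v Huv; split.
- rewrite (HK u v Huv).
  destruct G as (_ & _ & _ & _ & G); destruct (G u v Huv) as (_ & (o1 & o2 & _) & s1 & s2 & s3 & _).
  rewrite s1, s2, s3; mink_expand; rewrite o1, o2; ring.
- rewrite (Hkap u v Huv); now apply (cf_ricci HD C).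
Qed.

(* A Lorentz-orthonormal pair in the plane satisfies [y = (x2, x1)] up to sign. *)
Lemma lorentz_orthonormal (x1 x2 y1 y2 r : R) :
  x1 ^ 2 - x2 ^ 2 = r -> y2 ^ 2 - y1 ^ 2 = r -> x1 * y1 = x2 * y2 -> 0 < r ->
  y1 ^ 2 + y2 ^ 2 = x1 ^ 2 + x2 ^ 2 /\ y1 * y2 = x1 * x2.
Proof.
intros Hx Hy Ho Hr.
assert (E : y1 ^ 2 = x2 ^ 2).
{ apply Rmult_eq_reg_l with r; [ | lra ].
  assert (H : (r + x2 ^ 2) * y1 ^ 2 = x2 ^ 2 * (r + y1 ^ 2)).
  { replace (r + x2 ^ 2) with (x1 ^ 2) by lra; replace (r + y1 ^ 2) with (y2 ^ 2) by lra.
    transitivity ((x1 * y1) ^ 2); [ ring | rewrite Ho; ring ]. }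
  lra. }
assert (E' : y2 ^ 2 = x1 ^ 2) by lra.
split; [ lra | ].
assert (S : (y1 * y2 - x1 * x2) ^ 2 = 0).
{ replace ((y1 * y2 - x1 * x2) ^ 2) with (y1 ^ 2 * y2 ^ 2 + x1 ^ 2 * x2 ^ 2 - 2 * (x1 * y1) * (x2 * y2)) by ring.
  rewrite <- Ho, E' , E.
  replace (2 * (x1 * y1) * (x1 * y1)) with (2 * x1 ^ 2 * y1 ^ 2) by ring; rewrite E; ring. }
apply Rminus_diag_uniq, Rsqr_0_uniq; rewrite Rsqr_pow2; auto.
Qed.

Lemma canon_frame_surface (D : R * R -> Prop) (z n1 n2 : R -> R -> R4) (nu mu rho K kap : R -> R -> R) :
  open D -> canon_frame D z n1 n2 nu mu rho ->
  (forall u v, D (u, v) -> K u v = nu u v ^ 2 - mu u v ^ 2 /\ kap u v = - 2 * nu u v * mu u v) ->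
  zmc_surface D z /\ canonical_parameters D z /\ gauss_curvature D z K /\ normal_curvature D z kap.
Proof.
intros HD C HK.
assert (Hz := cf_z C).
assert (metric : forall (a b : R * R) u v, D (u, v) ->
  mink (push z a u v) (push z b u v) = (snd a * snd b - fst a * fst b) / rho u v).
{ intros a b u v Huv; rewrite !push_vdir, (vdir_linear a), (vdir_linear b); mink_expand.
  rewrite (mink_sym (vdir (0, 1) z u v) (vdir (1, 0) z u v)), (cf_E C), (cf_F C), (cf_G C); auto.
  unfold Rdiv; ring. }
assert (ss : forall u v, D (u, v) -> sqrt (rho u v) * sqrt (rho u v) = rho u v).
{ intros; apply sqrt_sqrt, Rlt_le, (cf_rho_pos C); auto. }
assert (otan : forall u v, D (u, v) -> orthonormal_tangent z (unit_u z u v) (unit_v z u v) u v).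
{ intros u v Huv; assert (Hr := cf_rho_neq0 C u v Huv).
  destruct (cf_unit C u v Huv) as [-> ->]; unfold orthonormal_tangent; rewrite !metric; auto; cbn [fst snd].
  rewrite ss; auto; repeat split; field; auto. }
assert (ssqrt : smooth D (fun x y => sqrt (rho x y))).
{ apply smooth_sqrt; auto; [ apply (cf_rho_pos C) | apply (cf_rho C) ]. }
assert (sX : smooth_tfield D (unit_u z)).
{ split.
  - apply smooth_ext with (fun x y => sqrt (rho x y)); auto; intros x y Hxy.
    now rewrite (proj1 (cf_unit C x y Hxy)).
  - apply (smooth_const D 0). }
assert (sY : smooth_tfield D (unit_v z)).
{ split.
  - apply (smooth_const D 0).
  - apply smooth_ext with (fun x y => sqrt (rho x y)); auto; intros x y Hxy.
    now rewrite (proj2 (cf_unit C x y Hxy)). }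
assert (GF : geometric_frame D z (unit_u z) (unit_v z) n1 n2 nu mu).
{ split; [ | split; [ | split; [ | split ] ] ]; auto; try now apply C.
  intros u v Huv; assert (Hr := cf_rho_neq0 C u v Huv).
  split; [ | split; [ | split; [ | split; [ | split ] ] ] ]; auto;
    try (rewrite (cf_second_fund HD C), ?(proj1 (cf_unit C u v Huv)), ?(proj2 (cf_unit C u v Huv)); auto;
      cbn [fst snd]; rewrite ss; auto;
      revert Hr; generalize (n1 u v) (n2 u v) (rho u v) (nu u v) (mu u v) (sqrt (rho u v));
      intros p q r s t w Hr; apply R4_ext; R4_coords; field; now auto).
  - now apply (cf_orthonormal C).
  - now apply (cf_numu C). }
split; [ split; [ | split; [ | split ] ] | split; [ | split ] ]; auto.
- intros u v Huv; exists (unit_u z u v), (unit_v z u v); auto.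
(* For an arbitrary orthonormal pair, sigma(X,X) depends only on X1^2 + X2^2 and X1 X2, and these
   two numbers are the same for [Y]. *)
- intros X Y u v HX HY Huv (o1 & o2 & o3).
  assert (Hr := cf_rho_pos C u v Huv).
  rewrite metric in o1, o2, o3; auto.
  assert (Hc : forall x, x / rho u v * rho u v = x) by (intros; field; lra).
  apply (f_equal (fun x => x * rho u v)) in o1, o2, o3; rewrite Hc in o1, o2, o3.
  destruct (lorentz_orthonormal (fst (X u v)) (snd (X u v)) (fst (Y u v)) (snd (Y u v)) (rho u v)) as [S P]; try lra.
  unfold mean_curvature; rewrite !(cf_second_fund HD C); auto.
  replace (fst (Y u v) * fst (Y u v) + snd (Y u v) * snd (Y u v))
    with (fst (X u v) * fst (X u v) + snd (X u v) * snd (X u v)) by lra.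
  replace (fst (Y u v) * snd (Y u v) + snd (Y u v) * fst (Y u v))
    with (fst (X u v) * snd (X u v) + snd (X u v) * fst (X u v)) by lra.
  generalize (n1 u v) (n2 u v) (rho u v) (nu u v) (mu u v) (fst (X u v)) (snd (X u v)).
  intros; apply R4_ext; R4_coords; unfold Rdiv; ring.
(* In any orthonormal normal frame Delta1 is nu mu / rho^2 times the determinant of the change of
   frame, whose square is 1 by the Lagrange identity. *)
- intros u v e1 e2 Huv (o1 & o2 & o3 & o4 & o5 & o6 & o7) c11 c12 c22 D1 D2 D3 E.
  injection E as E1 _ _.
  assert (Hr := cf_rho_neq0 C u v Huv).
  rewrite partial4_10 in o4, o6; rewrite partial4_01 in o5, o7.
  unfold D1, c11, c12 in E1; rewrite partial4_20, partial4_11 in E1.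
  rewrite !(cf_parseval C u v _ e1), !(cf_parseval C u v _ e2) in E1; auto.
  rewrite o4, o5, o6, o7, (cf_uu1 C), (cf_uu2 C), (cf_uv1 C), (cf_uv2 C) in E1; auto.
  rewrite (cf_parseval C u v e1 e1), o4, o5 in o1; auto.
  rewrite (cf_parseval C u v e2 e2), o6, o7 in o2; auto.
  rewrite (cf_parseval C u v e1 e2), o4, o5, o6, o7 in o3; auto.
  revert E1 o1 o2 o3; generalize (mink e1 (n1 u v)) (mink e1 (n2 u v)) (mink e2 (n1 u v)) (mink e2 (n2 u v)).
  intros p q r s E1 o1 o2 o3.
  assert (det : p * s - q * r = 0).
  { apply Rmult_eq_reg_l with (nu u v * mu u v / (rho u v * rho u v)).
    - rewrite Rmult_0_r, <- E1; field; auto.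
    - apply Rmult_integral_contrapositive_currified; [ now apply (cf_numu C) | ].
      apply Rinv_neq_0_compat; now apply Rmult_integral_contrapositive_currified. }
  assert (det2 : (p * s - q * r) ^ 2 = 1).
  { transitivity ((p * p + q * q) * (r * r + s * s) - (p * r + q * s) ^ 2); [ ring | ].
    replace (p * p + q * q) with 1 by lra; replace (r * r + s * s) with 1 by lra.
    replace (p * r + q * s) with 0 by lra; ring. }
  rewrite det in det2; lra.
- exists n1, n2, nu, mu; split; auto.
  intros u v Huv; assert (Hr := cf_rho_pos C u v Huv).
  replace (mu u v ^ 2 + nu u v ^ 2) with (rho u v ^ 2) by (rewrite (cf_rho2 C u v Huv); ring).
  rewrite sqrt_pow2 by lra.
  rewrite fE_vdir, fF_vdir, fG_vdir, (cf_E C), (cf_F C), (cf_G C); auto.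
  unfold Rdiv; rewrite !Rmult_1_l; auto.
- intros u v Huv; rewrite (proj1 (HK u v Huv)).
  destruct GF as (_ & _ & _ & _ & G); destruct (G u v Huv) as (_ & (o1 & o2 & _) & s1 & s2 & s3 & _).
  cbv zeta; rewrite s1, s2, s3; mink_expand; rewrite o1, o2; ring.
- exists n1, n2, nu, mu; split; auto.
  intros u v Huv; rewrite (proj2 (HK u v Huv)); symmetry; now apply (cf_ricci HD C).
Qed.

(** * The differential equations for the curvatures *)

Lemma quartic_norm (nu mu rho K kap : R) :
  0 < rho -> rho ^ 2 = nu ^ 2 + mu ^ 2 -> K = nu ^ 2 - mu ^ 2 -> kap = - 2 * nu * mu ->
  K ^ 2 + kap ^ 2 = rho ^ 4.
Proof.
intros Hr H -> ->; replace (rho ^ 4) with ((rho ^ 2) ^ 2) by ring; rewrite H; ring.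
Qed.

Lemma Rpower_quartic (x rho : R) : 0 < rho -> x = rho ^ 4 ->
  Rpower x (1 / 4) = rho /\ ln (Rpower x (1 / 8)) = / 2 * ln rho.
Proof.
intros Hr ->.
assert (L : ln (rho ^ 4) = 4 * ln rho).
{ rewrite ln_pow; auto; simpl; ring. }
split.
- unfold Rpower; rewrite L; replace (1 / 4 * (4 * ln rho)) with (ln rho) by field; now apply exp_ln.
- unfold Rpower; rewrite ln_exp, L; field.
Qed.

Lemma box_ext (D : R * R -> Prop) (f g : R -> R -> R) (u v : R) :
  open D -> (forall x y, D (x, y) -> f x y = g x y) -> D (u, v) -> box f u v = box g u v.
Proof.
intros HD H Huv; unfold box; rewrite !partial_derive_20, !partial_derive_02.
assert (E : forall h, dir h (dir h f) u v = dir h (dir h g) u v).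
{ intros h; apply (dir_ext D); auto; intros; now apply (dir_ext D). }
now rewrite !E.
Qed.

(** The unit vector (X, Y) is e (c, s) with e = 1 or e = -1; the derivative of its angle is
    insensitive to this sign, which covers every determination of the arctangent. *)
Lemma angle_derivative (X Y X' Y' t s c : R) :
X' * s + X * (c * t) - (Y' * c + Y * (- s * t)) = 0 -> X * s - Y * c = 0 -> X * X' + Y * Y' = 0 ->
X * X + Y * Y = 1 -> s * s + c * c = 1 -> t = X * Y' - Y * X'.
Proof.
intros E1 E2 E3 E4 E5.
set (e := X * c + Y * s).
assert (HX : X = e * c).
{ unfold e; transitivity (X * (s * s + c * c)); [ rewrite E5; ring | ].
  replace (X * (s * s + c * c)) with ((X * s) * s + X * c * c) by ring.
  replace (X * s) with (Y * c) by lra; ring. }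
assert (HY : Y = e * s).
{ unfold e; transitivity (Y * (s * s + c * c)); [ rewrite E5; ring | ].
  replace (Y * (s * s + c * c)) with (Y * s * s + (Y * c) * c) by ring.
  replace (Y * c) with (X * s) by lra; ring. }
assert (He : e * e = 1).
{ rewrite <- E4, HX, HY; transitivity (e * e * (s * s + c * c)); [ rewrite E5; ring | ring ]. }
assert (E6 : e * t = Y' * c - X' * s) by (unfold e; lra).
transitivity (e * e * t); [ rewrite He; ring | ].
rewrite Rmult_assoc, E6, HX, HY; ring.
Qed.

(** The passage from the equation for c = 4 X to the one for the angle of (X, Y), with f = -2 / r
    and kap = r^2 Y. Division by [Y] eliminates the derivatives of [Y] by means of X^2 + Y^2 = 1. *)
Lemma angle_mixed (X Y Xh Yh Xk Yk Xhk Yhk r : R) :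
  Y <> 0 -> r <> 0 -> Xh * Xk + X * Xhk + (Yh * Yk + Y * Yhk) = 0 ->
  X * Xh + Y * Yh = 0 -> X * Xk + Y * Yk = 0 -> X * X + Y * Y = 1 ->
  4 * Xhk = 16 * Y ^ 2 / - (2 / r) - 4 * X * (4 * Xh) * (4 * Xk) / (16 * Y ^ 2) ->
  r * (Xh * Yk + X * Yhk - (Yh * Xk + Y * Xhk)) = 2 * (r ^ 2 * Y).
Proof.
intros Y0 r0 dd d1 d2 E Hcc.
assert (HYh : Yh = - X * Xh / Y) by (apply Rmult_eq_reg_l with Y; auto; field_simplify; lra).
assert (HYk : Yk = - X * Xk / Y) by (apply Rmult_eq_reg_l with Y; auto; field_simplify; lra).
assert (HYhk : Yhk = - (Xh * Xk + X * Xhk + Yh * Yk) / Y) by (apply Rmult_eq_reg_l with Y; auto; field_simplify; lra).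
assert (HXhk : Xhk = - 2 * r * Y ^ 2 - X * Xh * Xk / Y ^ 2).
{ apply Rmult_eq_reg_l with 4; [ | lra ].
  rewrite Hcc; field; auto. }
rewrite HYhk, HYh, HYk, HXhk.
apply Rminus_diag_uniq.
transitivity (2 * r ^ 2 * Y * (X * X + Y * Y - 1)); [ field; auto | rewrite E; ring ].
Qed.

(** From rho = -2 / f one has (1/2) ln rho = const - (1/2) ln (-f), so the left-hand side is -(1/2)
    d_h (d_k f / f). *)
Lemma half_ln_mixed (D : R * R -> Prop) (h k : R * R) (rho f : R -> R -> R) (u v : R) :
  open D -> smooth D rho -> smooth D f -> (forall x y, D (x, y) -> 0 < rho x y) ->
  (forall x y, D (x, y) -> f x y = - (2 / rho x y)) -> D (u, v) ->
  dir h (dir k (fun x y => / 2 * ln (rho x y))) u v =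
  - / 2 * ((dir h (dir k f) u v - dir h f u v * dir k f u v / f u v) / f u v).
Proof.
intros HD sr sf Hr Hf Huv.
assert (r0 : forall x y, D (x, y) -> rho x y <> 0) by (intros x y Hxy; specialize (Hr x y Hxy); lra).
assert (f0 : forall x y, D (x, y) -> f x y <> 0).
{ intros x y Hxy; rewrite Hf; auto; specialize (Hr x y Hxy).
  apply Ropp_neq_0_compat, Rmult_integral_contrapositive_currified; [ lra | apply Rinv_neq_0_compat; lra ]. }
assert (sl : smooth D (fun x y => ln (rho x y))) by now apply smooth_ln.
assert (Ef : forall x y, D (x, y) -> dir k f x y = 2 * dir k rho x y / rho x y ^ 2).
{ intros x y Hxy; assert (Hr' := r0 x y Hxy).
  rewrite (dir_ext D k _ (fun x y => (-2) * / rho x y)); auto.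
  - rewrite (dir_mult D k (fun _ _ => -2)), dir_const, (dir_inv D); auto with smo.
    + field; auto.
    + now apply smooth_inv.
  - intros; rewrite Hf; auto; unfold Rdiv; ring. }
rewrite (dir_ext D h _ (fun x y => (- / 2) * (dir k f x y / f x y))); auto.
- rewrite (dir_mult D h (fun _ _ => - / 2)), dir_const, (dir_div D); auto with smo.
  + field; auto.
  + apply smooth_div; auto with smo.
- intros x y Hxy; assert (Hr' := r0 x y Hxy).
  rewrite (dir_mult D k (fun _ _ => / 2)), dir_const; auto with smo.
  rewrite (dir_comp D k ln (/ rho x y)); auto.
  + rewrite Ef, Hf; auto; field; auto.
  + apply is_derive_ln; auto.
Qed.

Section PDE.
Context {D : R * R -> Prop} {z n1 n2 : R -> R -> R4} {nu mu rho K kap : R -> R -> R}.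
Context (HD : open D) (C : canon_frame D z n1 n2 nu mu rho).
Context (HK : forall u v, D (u, v) -> K u v = nu u v ^ 2 - mu u v ^ 2 /\ kap u v = - 2 * nu u v * mu u v).

Lemma cf_quartic (u v : R) : D (u, v) -> K u v ^ 2 + kap u v ^ 2 = rho u v ^ 4.
Proof.
intros Huv; destruct (HK u v Huv); apply quartic_norm with (nu u v) (mu u v); auto;
  [ now apply (cf_rho_pos C) | now apply (cf_rho2 C) ].
Qed.

(** The box of (1/2) ln rho is -(1/2) c / f; with c = 4 K / rho^2 and f = -2 / rho this is K /
    rho. *)
Lemma cf_eq_gauss (u v : R) : D (u, v) -> eq_gauss K kap u v.
Proof.
intros Huv.
set (a := vdir (1, 1) z); set (b := vdir (1, -1) z).
assert (N := cf_null_pair HD C : null_pair D (1, 1) (1, -1) a b).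
assert (Hr := cf_rho_neq0 C u v Huv).
unfold eq_gauss.
rewrite (proj1 (Rpower_quartic _ _ (cf_rho_pos C u v Huv) (cf_quartic u v Huv))).
rewrite (box_ext D _ (fun x y => / 2 * ln (rho x y))); auto.
2: { intros x y Hxy; exact (proj2 (Rpower_quartic _ _ (cf_rho_pos C x y Hxy) (cf_quartic x y Hxy))). }
assert (sl : smooth D (fun x y => ln (rho x y))).
{ apply smooth_ln; auto; [ apply (cf_rho_pos C) | apply (cf_rho C) ]. }
rewrite (box_dir D), (half_ln_mixed D (1, 1) (1, -1) rho (np_f a b)); auto with smo;
  try apply (cf_rho C); try apply (cf_rho_pos C); try apply (np_smooth_f HD N); try apply (cf_np_f C).
rewrite <- (np_c_eq HD N u v Huv).
unfold a, b; rewrite (cf_np_c HD C), (cf_np_f C), (proj1 (HK u v Huv)); auto.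
field; auto.
Qed.

(** On the circle, (X, Y) = (K, kap) / rho^2 is a unit vector with angle [theta] modulo pi, and X =
    c / 4, so that the second-order equation for [np_c] becomes one for [theta]. *)
Lemma cf_eq_normal (U : R * R -> Prop) (theta : R -> R -> R) (u v : R) :
  open U -> (forall p, U p -> D p) -> arctan_determination U K kap theta -> U (u, v) ->
  eq_normal K kap theta u v.
Proof.
intros HU HUD [st Ht] Huv.
set (a := vdir (1, 1) z); set (b := vdir (1, -1) z).
assert (N := cf_null_pair HD C : null_pair D (1, 1) (1, -1) a b).
set (c := np_c (1, 1) (1, -1) a b).
(* [X] and [Y] are K / rho^2 and kap / rho^2, written in terms of [c], [nu], [mu] and [rho], whose
   smoothness is known. *)
set (X := fun x y => / 4 * c x y).
set (Y := fun x y => -2 * (nu x y * mu x y) * (/ rho x y * / rho x y)).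
assert (sc : smooth D c) by apply (np_smooth_c HD N).
assert (sX' : smooth D X) by (apply smooth_mult; auto with smo).
assert (sX : smooth U X) by now apply (smooth_subset D).
assert (sY : smooth U Y).
{ apply (smooth_subset D); auto.
  assert (smooth D (fun x y => / rho x y)) by (apply smooth_inv; auto; [ apply (cf_rho_neq0 C) | apply (cf_rho C) ]).
  assert (smooth D nu) by apply (cf_nu C); assert (smooth D mu) by apply (cf_mu C).
  unfold Y; auto 10 with smo. }
assert (EX : forall x y, U (x, y) -> X x y = K x y / rho x y ^ 2).
{ intros x y Hxy; assert (Hr := cf_rho_neq0 C x y (HUD _ Hxy)).
  unfold X, c, a, b; rewrite (cf_np_c HD C), (proj1 (HK x y (HUD _ Hxy))); auto; field; auto. }
assert (EY : forall x y, U (x, y) -> Y x y = kap x y / rho x y ^ 2).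
{ intros x y Hxy; assert (Hr := cf_rho_neq0 C x y (HUD _ Hxy)).
  unfold Y; rewrite (proj2 (HK x y (HUD _ Hxy))); auto; field; auto. }
assert (XY : forall x y, U (x, y) -> X x y * X x y + Y x y * Y x y = 1).
{ intros x y Hxy; assert (Hr := cf_rho_neq0 C x y (HUD _ Hxy)).
  rewrite EX, EY; auto; transitivity ((K x y ^ 2 + kap x y ^ 2) / rho x y ^ 4); [ field; auto | ].
  rewrite cf_quartic; auto; field; auto. }
assert (Y0 : Y u v <> 0).
{ unfold Y; assert (Hi := Rinv_neq_0_compat _ (cf_rho_neq0 C u v (HUD _ Huv))).
  assert (Hn := cf_numu C u v (HUD _ Huv)).
  repeat (apply Rmult_integral_contrapositive_currified; auto); lra. }
assert (dXY : forall l x y, U (x, y) -> X x y * dir l X x y + Y x y * dir l Y x y = 0).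
{ intros l x y Hxy.
  assert (E := dir_const l 1 x y).
  rewrite <- (dir_ext U l (fun x y => X x y * X x y + Y x y * Y x y)), (dir_plus U), !(dir_mult U) in E; auto with smo.
  lra. }
destruct (smooth_sin_cos U theta HU st) as [ssin scos].
assert (dtheta : forall l x y, U (x, y) -> dir l theta x y = X x y * dir l Y x y - Y x y * dir l X x y).
{ intros l x y Hxy.
  assert (Hr := cf_rho_neq0 C x y (HUD _ Hxy)).
  assert (E0 : forall x y, U (x, y) -> X x y * sin (theta x y) - Y x y * cos (theta x y) = 0).
  { intros x' y' Hxy'; rewrite EX, EY; auto; unfold Rdiv.
    transitivity ((K x' y' * sin (theta x' y') - kap x' y' * cos (theta x' y')) * / rho x' y' ^ 2); [ ring | ].
    rewrite Ht; auto; ring. }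
  assert (E1 : dir l (fun x y => X x y * sin (theta x y) - Y x y * cos (theta x y)) x y = 0).
  { rewrite (dir_ext U l _ (fun _ _ => 0)); auto; apply dir_const. }
  rewrite (dir_minus U l (fun x y => X x y * sin (theta x y))), !(dir_mult U l X), !(dir_mult U l Y) in E1; auto with smo.
  rewrite (dir_comp U l sin (cos (theta x y))), (dir_comp U l cos (- sin (theta x y))) in E1; auto;
    try apply is_derive_sin; try apply is_derive_cos.
  assert (E2 := E0 x y Hxy); assert (E3 := dXY l x y Hxy); assert (E4 := XY x y Hxy).
  assert (E5 := sin2_cos2 (theta x y)); unfold Rsqr in E5.
  now apply (angle_derivative _ _ _ _ _ (sin (theta x y)) (cos (theta x y))). }
unfold eq_normal.
assert (Hr := cf_rho_neq0 C u v (HUD _ Huv)).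
rewrite (proj1 (Rpower_quartic _ _ (cf_rho_pos C u v (HUD _ Huv)) (cf_quartic u v (HUD _ Huv)))).
rewrite (box_dir U); auto.
rewrite (dir_ext U (1, 1) _ (fun x y => X x y * dir (1, -1) Y x y - Y x y * dir (1, -1) X x y)); auto.
rewrite (dir_minus U (1, 1) (fun x y => X x y * dir (1, -1) Y x y)), (dir_mult U (1, 1) X), (dir_mult U (1, 1) Y); auto with smo.
assert (ddXY : dir (1, 1) (fun x y => X x y * dir (1, -1) X x y + Y x y * dir (1, -1) Y x y) u v = 0).
{ rewrite (dir_ext U (1, 1) _ (fun _ _ => 0)); auto; apply dir_const. }
rewrite (dir_plus U (1, 1) (fun x y => X x y * dir (1, -1) X x y)), (dir_mult U (1, 1) X), (dir_mult U (1, 1) Y) in ddXY; auto with smo.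
assert (dX := fun l => dXY l u v Huv); assert (d1 := dX (1, 1)); assert (d2 := dX (1, -1)).
assert (E1 := XY u v Huv).
assert (Hc := cf_np_c_neq HD C u v (HUD _ Huv)); fold a b c in Hc.
(* To be read with c = 4 X, 16 - c^2 = 16 Y^2 and f = -2 / rho. *)
assert (Hcc := np_dhkc D (1, 1) (1, -1) a b u v HD N (HUD _ Huv) Hc); cbv zeta in Hcc; fold c in Hcc.
assert (dXc : forall l x y, D (x, y) -> dir l c x y = 4 * dir l X x y).
{ intros l x y Hxy; unfold X; rewrite (dir_mult D l (fun _ _ => / 4)), dir_const; auto with smo; field. }
rewrite (dir_ext D (1, -1) (dir (1, 1) c) (fun x y => 4 * dir (1, 1) X x y)) in Hcc; auto.
rewrite (dir_mult D (1, -1) (fun _ _ => 4)), dir_const, (dir_comm D (1, -1) (1, 1)), !dXc in Hcc; auto with smo.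
replace (c u v) with (4 * X u v) in Hcc, Hc by (unfold X; field).
unfold a, b in Hcc; rewrite (cf_np_f C) in Hcc; auto.
assert (Ek := EY u v Huv).
replace (16 - (4 * X u v) ^ 2) with (16 * Y u v ^ 2) in Hcc, Hc.
2: { transitivity (16 * (X u v * X u v + Y u v * Y u v) - (4 * X u v) ^ 2); [ ring | rewrite E1; ring ]. }
assert (Ek' : kap u v = rho u v ^ 2 * Y u v) by (rewrite Ek; field; auto).
rewrite Ek'; clear Ek Ek'.
apply angle_mixed; auto.
etransitivity; [ | etransitivity; [ exact Hcc | ] ]; ring.
Qed.

End PDE.

Lemma arctan_quot_determination (U : R * R -> Prop) (K kap : R -> R -> R) :
  open U -> smooth U K -> smooth U kap -> (forall u v, U (u, v) -> K u v <> 0) ->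
  arctan_determination U K kap (arctan_quot K kap).
Proof.
intros HU sK sk H0; split.
- apply smooth_atan; auto; now apply smooth_div.
- intros u v Huv; unfold arctan_quot; rewrite sin_atan, cos_atan; unfold Rdiv.
  rewrite !Rmult_1_l, <- !Rmult_assoc; f_equal; field; auto.
Qed.

Lemma open_neq_0 (D : R * R -> Prop) (f : R -> R -> R) :
  open D -> smooth D f -> open (fun p => D p /\ f (fst p) (snd p) <> 0).
Proof.
intros HD Hf [u v] [Huv H0]; simpl in H0.
apply filter_and; auto.
apply (locally_2d_locally (fun x y => f x y <> 0) u v).
apply continuity_2d_pt_neq_0; auto; now apply (smooth_cont D).
Qed.

Lemma surface_equations (D : R * R -> Prop) (z : R -> R -> R4) (K kap : R -> R -> R) :
  plane_domain D -> zmc_surface D z -> canonical_parameters D z -> gauss_curvature D z K -> normal_curvature D z kap ->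
  (forall u v, D (u, v) ->
     eq_gauss K kap u v /\ (K u v <> 0 -> eq_normal K kap (arctan_quot K kap) u v)) /\
  (forall (U : R * R -> Prop) (theta : R -> R -> R),
     open U -> (forall p, U p -> D p) -> arctan_determination U K kap theta ->
     forall u v, U (u, v) -> eq_normal K kap theta u v).
Proof.
intros [HD _] [Hz _] Hc HK Hk.
destruct (surface_canon_frame D z K kap HD Hz Hc HK Hk) as (n1 & n2 & nu & mu & rho & C & HKk).
assert (second : forall (U : R * R -> Prop) (theta : R -> R -> R),
  open U -> (forall p, U p -> D p) -> arctan_determination U K kap theta ->
  forall u v, U (u, v) -> eq_normal K kap theta u v).
{ intros U theta HU HUD Ht u v Huv; now apply (cf_eq_normal HD C HKk U). }
split; auto; intros u v Huv; split; [ now apply (cf_eq_gauss HD C HKk) | ].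
intros H0.
assert (snu := cf_nu C); assert (smu := cf_mu C).
assert (sK : smooth D K).
{ apply smooth_ext with (fun x y => nu x y * nu x y - mu x y * mu x y); auto with smo.
  intros x y Hxy; rewrite (proj1 (HKk x y Hxy)); ring. }
assert (sk : smooth D kap).
{ apply smooth_ext with (fun x y => -2 * (nu x y * mu x y)); auto with smo.
  intros x y Hxy; rewrite (proj2 (HKk x y Hxy)); ring. }
(* On the open set where [K] does not vanish, the arctangent of the quotient is itself a smooth
   determination, so the general statement applies to it. *)
set (U := fun p : R * R => D p /\ K (fst p) (snd p) <> 0).
assert (HU : open U) by now apply open_neq_0.
apply (second U); auto.
- now intros p [].
- apply arctan_quot_determination; auto.
  + apply (smooth_subset D); auto; now intros p [].
  + apply (smooth_subset D); auto; now intros p [].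
  + now intros x y [].
- split; auto.
Qed.

(** The curvatures determine rho by rho^4 = K^2 + kap^2, hence f = -2 / rho, so both null pairs have
    the same product and are related by a linear isometry. *)
Lemma surface_unique (x0 y0 eps : R) (z1 z2 : R -> R -> R4) (K kap : R -> R -> R) :
  let D := diamond x0 y0 eps in
  0 < eps ->
  smooth4 D z1 -> canonical_parameters D z1 -> gauss_curvature D z1 K -> normal_curvature D z1 kap ->
  smooth4 D z2 -> canonical_parameters D z2 -> gauss_curvature D z2 K -> normal_curvature D z2 kap ->
  exists M : R4 -> R4, motion M /\ forall u v, D (u, v) -> z2 u v = M (z1 u v).
Proof.
intros D Heps s1 c1 g1 k1 s2 c2 g2 k2.
assert (HD : open D) by apply open_diamond.
destruct (surface_canon_frame D z1 K kap HD s1 c1 g1 k1) as (m1 & m2 & nu1 & mu1 & rho1 & C1 & K1).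
destruct (surface_canon_frame D z2 K kap HD s2 c2 g2 k2) as (n1 & n2 & nu2 & mu2 & rho2 & C2 & K2).
assert (Er : forall u v, D (u, v) -> rho1 u v = rho2 u v).
{ intros u v Huv.
  destruct (Rpower_quartic _ _ (cf_rho_pos C1 u v Huv) (cf_quartic C1 K1 u v Huv)) as [<- _].
  exact (proj1 (Rpower_quartic _ _ (cf_rho_pos C2 u v Huv) (cf_quartic C2 K2 u v Huv))). }
destruct (null_pair_unique x0 y0 eps _ _ _ _ Heps (cf_null_pair HD C1) (cf_null_pair HD C2)) as (L & L1 & L2 & L3 & L4).
- intros x y Hxy; rewrite (cf_np_f C1), (cf_np_f C2), Er; auto.
- intros x y Hxy; now apply (cf_np_c_neq HD C1).
(* The isometry matches the null derivatives of both surfaces, so this difference is constant; it is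
   the translation part of the motion. *)
- set (w := fun u v => minus (z2 u v) (L (z1 u v))).
  assert (sL : smooth4 D (fun u v => L (z1 u v))).
  { apply (vdir_linear_map D (1, 1) L z1 x0 y0); auto; now apply diamond_center. }
  assert (sw : smooth4 D w) by now apply smooth4_minus.
  assert (dw : forall l u v, D (u, v) -> vdir l w u v = minus (vdir l z2 u v) (L (vdir l z1 u v))).
  { intros l u v Huv; unfold w; rewrite (vdir_minus D l z2 (fun x y => L (z1 x y))); auto.
    now rewrite (proj2 (vdir_linear_map D l L z1 u v L1 L2 HD s1 Huv)). }
  assert (d1 : forall u v, D (u, v) -> vdir (1, 1) w u v = zero).
  { intros u v Huv; rewrite dw, (proj1 (L4 u v Huv)); auto; R4_ring. }
  assert (d2 : forall u v, D (u, v) -> vdir (1, -1) w u v = zero).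
  { intros u v Huv; rewrite dw, (proj2 (L4 u v Huv)); auto; R4_ring. }
  assert (Ew : forall u v, D (u, v) -> w u v = w x0 y0) by (intros; now apply (diamond_constant4 x0 y0 eps)).
  exists (fun p => plus (L p) (w x0 y0)); split.
  + exists L, (w x0 y0); auto.
  + intros u v Huv; rewrite <- (Ew u v Huv); unfold w.
    generalize (L (z1 u v)) (z2 u v); intros; R4_ring.
Qed.

(** * Complex-valued functions *)

Definition smoothC (D : R * R -> Prop) (w : R -> R -> C) : Prop :=
  smooth D (fun u v => fst (w u v)) /\ smooth D (fun u v => snd (w u v)).

Definition cdir (h : R * R) (w : R -> R -> C) (u v : R) : C :=
  (dir h (fun x y => fst (w x y)) u v, dir h (fun x y => snd (w x y)) u v).

Lemma C_ext (a b : C) : fst a = fst b -> snd a = snd b -> a = b.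
Proof. destruct a, b; simpl; congruence. Qed.

Lemma C_minus_eq_0 (a b : C) : Cminus a b = 0%C -> a = b.
Proof. intros E; transitivity (Cminus a b + b)%C; [ ring | rewrite E; ring ]. Qed.

Lemma C_mult_eq_reg_l (r a b : C) : r <> 0%C -> Cmult r a = Cmult r b -> a = b.
Proof.
intros Hr E; transitivity (/ r * (r * a))%C; [ field; auto | rewrite E; field; auto ].
Qed.

Lemma cdir_ext (D : R * R -> Prop) (h : R * R) (w w' : R -> R -> C) (u v : R) :
  open D -> (forall x y, D (x, y) -> w x y = w' x y) -> D (u, v) -> cdir h w u v = cdir h w' u v.
Proof.
intros HD H Huv; apply C_ext; apply (dir_ext D); auto; intros; now rewrite H.
Qed.

Lemma smoothC_cdir (D : R * R -> Prop) (h : R * R) (w : R -> R -> C) :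
  open D -> smoothC D w -> smoothC D (cdir h w).
Proof. intros HD [H1 H2]; split; now apply smooth_dir. Qed.

Lemma smoothC_mult (D : R * R -> Prop) (w w' : R -> R -> C) :
  open D -> smoothC D w -> smoothC D w' -> smoothC D (fun u v => Cmult (w u v) (w' u v)).
Proof. intros HD [H1 H2] [H1' H2']; split; simpl; auto with smo. Qed.

Lemma smoothC_minus (D : R * R -> Prop) (w w' : R -> R -> C) :
  open D -> smoothC D w -> smoothC D w' -> smoothC D (fun u v => Cminus (w u v) (w' u v)).
Proof. intros HD [H1 H2] [H1' H2']; split; simpl; auto with smo. Qed.

Lemma smoothC_div (D : R * R -> Prop) (w w' : R -> R -> C) :
  open D -> (forall u v, D (u, v) -> w' u v <> 0%C) -> smoothC D w -> smoothC D w' ->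
  smoothC D (fun u v => Cdiv (w u v) (w' u v)).
Proof.
intros HD H0 H [H1' H2']; apply smoothC_mult; auto.
assert (Hn : forall u v, D (u, v) -> fst (w' u v) ^ 2 + snd (w' u v) ^ 2 <> 0).
{ intros u v Huv E; apply (H0 u v Huv).
  pose proof (pow2_ge_0 (fst (w' u v))); pose proof (pow2_ge_0 (snd (w' u v))).
  apply C_ext; simpl; apply Rsqr_0_uniq; rewrite Rsqr_pow2; lra. }
assert (sn : smooth D (fun u v => fst (w' u v) ^ 2 + snd (w' u v) ^ 2)).
{ apply smooth_ext with (fun u v => fst (w' u v) * fst (w' u v) + snd (w' u v) * snd (w' u v)); auto with smo.
  intros; ring. }
split; simpl; apply smooth_div; auto with smo.
Qed.

Lemma cdir_mult (D : R * R -> Prop) (h : R * R) (w w' : R -> R -> C) (u v : R) :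
  open D -> smoothC D w -> smoothC D w' -> D (u, v) ->
  cdir h (fun x y => Cmult (w x y) (w' x y)) u v =
  Cplus (Cmult (cdir h w u v) (w' u v)) (Cmult (w u v) (cdir h w' u v)).
Proof.
intros HD [H1 H2] [H1' H2'] Huv; apply C_ext; unfold cdir; simpl.
- rewrite (dir_minus D h (fun x y => fst (w x y) * fst (w' x y))), !(dir_mult D); auto with smo; ring.
- rewrite (dir_plus D h (fun x y => fst (w x y) * snd (w' x y))), !(dir_mult D); auto with smo; ring.
Qed.

Lemma cdir_minus (D : R * R -> Prop) (h : R * R) (w w' : R -> R -> C) (u v : R) :
  smoothC D w -> smoothC D w' -> D (u, v) ->
  cdir h (fun x y => Cminus (w x y) (w' x y)) u v = Cminus (cdir h w u v) (cdir h w' u v).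
Proof.
intros [H1 H2] [H1' H2'] Huv; apply C_ext.
- exact (dir_minus D h _ _ u v H1 H1' Huv).
- exact (dir_minus D h _ _ u v H2 H2' Huv).
Qed.

Lemma cdir_const (h : R * R) (c : C) (u v : R) : cdir h (fun _ _ => c) u v = 0%C.
Proof. apply C_ext; [ exact (dir_const h (fst c) u v) | exact (dir_const h (snd c) u v) ]. Qed.

Lemma cdir_comm (D : R * R -> Prop) (h k : R * R) (w : R -> R -> C) (u v : R) :
  open D -> smoothC D w -> D (u, v) -> cdir h (cdir k w) u v = cdir k (cdir h w) u v.
Proof.
intros HD [H1 H2] Huv; apply C_ext.
- exact (dir_comm D h k _ u v HD H1 Huv).
- exact (dir_comm D h k _ u v HD H2 Huv).
Qed.

#[export] Hint Resolve smoothC_cdir smoothC_mult smoothC_minus : smo.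

(** * Factorization of solutions of the Liouville equation *)

Section Liouville.
Context {x0 y0 eps : R} {psi : R -> R -> C}.
Let D := diamond x0 y0 eps.
Let h : R * R := (1, 1).
Let k : R * R := (1, -1).
Context (Hpsi : smoothC D psi) (psi0 : forall u v, D (u, v) -> psi u v <> 0%C).
Context (liouville : forall u v, D (u, v) ->
  (psi u v * cdir h (cdir k psi) u v - cdir h psi u v * cdir k psi u v)%C = Copp 1).

Let HD : open D := open_diamond x0 y0 eps.

(** The values of [w] on the slice of constant u - v through the center, extended to a function of u
    + v alone. *)
Definition retC (w : R -> R -> C) (u v : R) : C := w (ret1 x0 y0 1 u v) (ret2 x0 y0 1 u v).

Lemma smoothC_ret (w : R -> R -> C) : smoothC D w -> smoothC D (retC w).
Proof.
intros [H1 H2]; split.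
- apply (smooth_ret x0 y0 eps 1 (fun x y => fst (w x y))); auto.
- apply (smooth_ret x0 y0 eps 1 (fun x y => snd (w x y))); auto.
Qed.

Lemma cdir_ret (w : R -> R -> C) (u v : R) : smoothC D w -> D (u, v) ->
  cdir h (retC w) u v = retC (cdir h w) u v /\ cdir k (retC w) u v = 0%C.
Proof.
intros [H1 H2] Huv.
destruct (dir_ret x0 y0 eps 1 (fun x y => fst (w x y)) u v (or_introl eq_refl) H1 Huv) as [E1 F1].
destruct (dir_ret x0 y0 eps 1 (fun x y => snd (w x y)) u v (or_introl eq_refl) H2 Huv) as [E2 F2].
split; apply C_ext; auto.
Qed.

Let ret_in (u v : R) (Huv : D (u, v)) : D (ret1 x0 y0 1 u v, ret2 x0 y0 1 u v) :=
  diamond_ret x0 y0 eps 1 u v (or_introl eq_refl) Huv.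

Let q (u v : R) : C := Cdiv (cdir h (cdir h psi) u v) (psi u v).

(** Differentiation of the Liouville equation along [h]; the two products of psi_h with psi_hk
    cancel. *)
Lemma liouville_h (u v : R) : D (u, v) ->
  Cmult (psi u v) (cdir h (cdir h (cdir k psi)) u v) = Cmult (cdir h (cdir h psi) u v) (cdir k psi u v).
Proof.
intros Huv.
assert (E := cdir_const h (Copp 1) u v).
rewrite <- (cdir_ext D h _ _ u v HD liouville Huv) in E.
rewrite (cdir_minus D h (fun x y => Cmult (psi x y) (cdir h (cdir k psi) x y))), !(cdir_mult D) in E; auto with smo.
apply C_minus_eq_0; rewrite <- E; ring.
Qed.

Lemma smooth_q : smoothC D q.
Proof. apply smoothC_div; auto with smo. Qed.

(** By [liouville_h], psi^2 d_k q = psi psi_hhk - psi_hh psi_k = 0. Hence psi solves in the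
    direction [h] one linear equation y'' = q y, with a potential common to all slices. *)
Lemma q_ret (u v : R) : D (u, v) -> q u v = retC q u v.
Proof.
intros Huv.
assert (dq : forall x y, D (x, y) -> cdir k q x y = 0%C).
{ intros x y Hxy.
  assert (E : cdir k (fun x y => Cmult (q x y) (psi x y)) x y = cdir k (cdir h (cdir h psi)) x y).
  { apply (cdir_ext D); auto; intros; unfold q; field; auto. }
  assert (P0 := psi0 x y Hxy).
  rewrite (cdir_mult D), (cdir_comm D k h (cdir h psi)) in E; auto with smo; try apply smooth_q.
  rewrite (cdir_ext D h (cdir k (cdir h psi)) (cdir h (cdir k psi))) in E; auto.
  2: { intros; apply (cdir_comm D); auto. }
  assert (E' := liouville_h x y Hxy).
  apply C_mult_eq_reg_l with (psi x y * psi x y)%C; [ now apply Cmult_neq_0 | ].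
  transitivity ((cdir k q x y * psi x y + q x y * cdir k psi x y) * psi x y - q x y * psi x y * cdir k psi x y)%C; [ ring | ].
  rewrite E.
  replace (q x y * psi x y)%C with (cdir h (cdir h psi) x y) by (unfold q; field; auto).
  rewrite <- E'; ring. }
destruct smooth_q as [s1 s2].
apply C_ext.
- apply (eq_ret x0 y0 eps 1 (fun x y => fst (q x y))); auto.
  intros x y Hxy; exact (f_equal fst (dq x y Hxy)).
- apply (eq_ret x0 y0 eps 1 (fun x y => snd (q x y))); auto.
  intros x y Hxy; exact (f_equal snd (dq x y Hxy)).
Qed.

Let xi1 := retC psi.
Let xi2 := retC (cdir k psi).
Let eta1 (u v : R) : C := (cdir h psi u v * xi1 u v - psi u v * cdir h xi1 u v)%C.
Let eta2 (u v : R) : C := (cdir h psi u v * xi2 u v - psi u v * cdir h xi2 u v)%C.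

Lemma wronskian (xi : R -> R -> C) (u v : R) :
  smoothC D xi -> (forall x y, D (x, y) -> cdir h (cdir h xi) x y = Cmult (q x y) (xi x y)) ->
  D (u, v) ->
  cdir h (fun x y => (cdir h psi x y * xi x y - psi x y * cdir h xi x y)%C) u v = 0%C.
Proof.
intros Hxi E Huv.
rewrite (cdir_minus D h (fun x y => Cmult (cdir h psi x y) (xi x y))), !(cdir_mult D), E; auto with smo.
unfold q; field; auto.
Qed.

(** On the central slice psi and psi_k both solve y'' = q y; they are [xi1] and [xi2], and the
    Liouville equation says that their Wronskian is -1, so they form a basis of solutions. The
    coefficients of psi in this basis are its Wronskians [eta1] and [eta2] with them, which are
    independent of u + v. *)
Lemma liouville_factor : exists xi1 xi2 eta1 eta2 : R -> R -> C,
  smoothC D xi1 /\ smoothC D xi2 /\ smoothC D eta1 /\ smoothC D eta2 /\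
  forall u v, D (u, v) ->
    cdir k xi1 u v = 0%C /\ cdir k xi2 u v = 0%C /\ cdir h eta1 u v = 0%C /\ cdir h eta2 u v = 0%C /\
    (xi1 u v * eta2 u v - xi2 u v * eta1 u v)%C = psi u v /\
    (xi1 u v * cdir h xi2 u v - xi2 u v * cdir h xi1 u v)%C = Copp 1 /\
    (eta1 u v * cdir k eta2 u v - eta2 u v * cdir k eta1 u v)%C = 1%C.
Proof.
assert (s1 : smoothC D xi1) by now apply smoothC_ret.
assert (s2 : smoothC D xi2) by (apply smoothC_ret; auto with smo).
assert (dk1 : forall u v, D (u, v) -> cdir k xi1 u v = 0%C) by (intros; now apply cdir_ret).
assert (dk2 : forall u v, D (u, v) -> cdir k xi2 u v = 0%C) by (intros; apply cdir_ret; auto with smo).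
assert (dh1 : forall u v, D (u, v) -> cdir h xi1 u v = retC (cdir h psi) u v) by (intros; now apply cdir_ret).
assert (dh2 : forall u v, D (u, v) -> cdir h xi2 u v = retC (cdir h (cdir k psi)) u v).
{ intros; apply cdir_ret; auto with smo. }
assert (W : forall u v, D (u, v) ->
  (xi1 u v * cdir h xi2 u v - xi2 u v * cdir h xi1 u v)%C = Copp 1).
{ intros u v Huv; rewrite dh1, dh2; auto.
  rewrite <- (liouville _ _ (ret_in u v Huv)); unfold xi1, xi2, retC; ring. }
assert (hh1 : forall u v, D (u, v) -> cdir h (cdir h xi1) u v = Cmult (q u v) (xi1 u v)).
{ intros u v Huv; rewrite (cdir_ext D h _ (retC (cdir h psi))); auto.
  rewrite (proj1 (cdir_ret (cdir h psi) u v (smoothC_cdir D h psi HD Hpsi) Huv)), q_ret; auto.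
  unfold xi1, retC, q; field; apply psi0; now apply ret_in. }
(* For psi_k the equation y'' = q y is [liouville_h] divided by psi. *)
assert (hh2 : forall u v, D (u, v) -> cdir h (cdir h xi2) u v = Cmult (q u v) (xi2 u v)).
{ intros u v Huv; rewrite (cdir_ext D h _ (retC (cdir h (cdir k psi)))); auto.
  rewrite (proj1 (cdir_ret (cdir h (cdir k psi)) u v
    (smoothC_cdir D h _ HD (smoothC_cdir D k psi HD Hpsi)) Huv)), q_ret; auto.
  assert (Hr := ret_in u v Huv); assert (E := liouville_h _ _ Hr); assert (P0 := psi0 _ _ Hr).
  unfold xi2, retC, q.
  apply C_mult_eq_reg_l with (psi (ret1 x0 y0 1 u v) (ret2 x0 y0 1 u v)); auto.
  rewrite E; field; auto. }
assert (t1 : smoothC D eta1) by (unfold eta1; auto with smo).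
assert (t2 : smoothC D eta2) by (unfold eta2; auto with smo).
exists xi1, xi2, eta1, eta2.
split; [ | split; [ | split; [ | split ] ] ]; auto.
intros u v Huv; split; [ | split; [ | split; [ | split; [ | split; [ | split ] ] ] ] ]; auto.
- now apply wronskian.
- now apply wronskian.
- unfold eta1, eta2.
  transitivity (Copp (psi u v * (xi1 u v * cdir h xi2 u v - xi2 u v * cdir h xi1 u v)))%C; [ ring | ].
  rewrite W; auto; ring.
(* As [xi1] and [xi2] are constant along [k], the Wronskian of the [eta] is the Liouville expression
   times the Wronskian of the [xi], that is (-1)(-1) = 1. *)
- assert (c1 : cdir k (cdir h xi1) u v = 0%C).
  { rewrite (cdir_comm D), (cdir_ext D h _ (fun _ _ => 0%C)); auto; apply cdir_const. }
  assert (c2 : cdir k (cdir h xi2) u v = 0%C).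
  { rewrite (cdir_comm D), (cdir_ext D h _ (fun _ _ => 0%C)); auto; apply cdir_const. }
  unfold eta1 at 2, eta2 at 1.
  rewrite (cdir_minus D k (fun x y => Cmult (cdir h psi x y) (xi1 x y))),
    (cdir_minus D k (fun x y => Cmult (cdir h psi x y) (xi2 x y))), !(cdir_mult D), c1, c2, dk1, dk2,
    (cdir_comm D k h); auto with smo.
  unfold eta1, eta2.
  transitivity ((psi u v * cdir h (cdir k psi) u v - cdir h psi u v * cdir k psi u v) *
    (xi1 u v * cdir h xi2 u v - xi2 u v * cdir h xi1 u v))%C; [ ring | ].
  rewrite W, liouville; auto; ring.
Qed.

End Liouville.

(* The null vector of the rank one hermitian matrix of a spinor, and its differential. *)
Definition herm (x y : C) : R4 :=
  (2 * (fst x * fst y + snd x * snd y), 2 * (snd x * fst y - fst x * snd y),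
   fst x * fst x + snd x * snd x - (fst y * fst y + snd y * snd y),
   fst x * fst x + snd x * snd x + (fst y * fst y + snd y * snd y)).

Definition dherm (x y x' y' : C) : R4 :=
  (2 * (fst x' * fst y + fst x * fst y' + (snd x' * snd y + snd x * snd y')),
   2 * (snd x' * fst y + snd x * fst y' - (fst x' * snd y + fst x * snd y')),
   2 * (fst x * fst x' + snd x * snd x' - (fst y * fst y' + snd y * snd y')),
   2 * (fst x * fst x' + snd x * snd x' + (fst y * fst y' + snd y * snd y'))).

(** * Null vectors of spinors *)

Definition Cnorm2 (x : C) : R := fst x ^ 2 + snd x ^ 2.

(** The form <w, w> is -4 times the determinant of the hermitian matrix of w. For a sum of two rank
    one matrices that determinant is the squared modulus of the determinant of the two spinors;
    polarization gives the factor -2. *)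
Lemma mink_herm (x y x' y' : C) :
  mink (herm x y) (herm x' y') = - 2 * Cnorm2 (Cminus (Cmult x y') (Cmult y x')).
Proof. unfold mink, herm, Cnorm2; simpl; ring. Qed.

(** The matrix xi xi'^H + xi' xi^H, with H the conjugate transpose, has determinant -|det (xi,
    xi')|^2. A Wronskian of modulus 1 thus produces the value 4 required of a null pair. *)
Lemma mink_dherm (x y x' y' : C) :
  mink (dherm x y x' y') (dherm x y x' y') = 4 * Cnorm2 (Cminus (Cmult x y') (Cmult y x')).
Proof. unfold mink, dherm, Cnorm2; simpl; ring. Qed.

Lemma vdir_herm (D : R * R -> Prop) (h : R * R) (x y : R -> R -> C) (u v : R) :
  open D -> smoothC D x -> smoothC D y -> D (u, v) ->
  vdir h (fun s t => herm (x s t) (y s t)) u v = dherm (x u v) (y u v) (cdir h x u v) (cdir h y u v).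
Proof.
intros HD [x1 x2] [y1 y2] Huv.
set (a := fun s t => fst (x s t)) in *; set (b := fun s t => snd (x s t)) in *.
set (c := fun s t => fst (y s t)) in *; set (d := fun s t => snd (y s t)) in *.
apply R4_ext.
- change (dir h (fun s t => 2 * (a s t * c s t + b s t * d s t)) u v =
    2 * (dir h a u v * c u v + a u v * dir h c u v + (dir h b u v * d u v + b u v * dir h d u v))).
  rewrite (dir_mult D h (fun _ _ => 2)), dir_const, (dir_plus D h (fun s t => a s t * c s t)), !(dir_mult D); auto with smo; ring.
- change (dir h (fun s t => 2 * (b s t * c s t - a s t * d s t)) u v =
    2 * (dir h b u v * c u v + b u v * dir h c u v - (dir h a u v * d u v + a u v * dir h d u v))).
  rewrite (dir_mult D h (fun _ _ => 2)), dir_const, (dir_minus D h (fun s t => b s t * c s t)), !(dir_mult D); auto with smo; ring.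
- change (dir h (fun s t => a s t * a s t + b s t * b s t - (c s t * c s t + d s t * d s t)) u v =
    2 * (a u v * dir h a u v + b u v * dir h b u v - (c u v * dir h c u v + d u v * dir h d u v))).
  rewrite (dir_minus D h (fun s t => a s t * a s t + b s t * b s t)), !(dir_plus D h), !(dir_mult D); auto with smo; ring.
- change (dir h (fun s t => a s t * a s t + b s t * b s t + (c s t * c s t + d s t * d s t)) u v =
    2 * (a u v * dir h a u v + b u v * dir h b u v + (c u v * dir h c u v + d u v * dir h d u v))).
  rewrite !(dir_plus D h), !(dir_mult D); auto with smo; ring.
Qed.

Lemma smooth4_herm (D : R * R -> Prop) (x y : R -> R -> C) :
  open D -> smoothC D x -> smoothC D y -> smooth4 D (fun s t => herm (x s t) (y s t)).
Proof.
intros HD [x1 x2] [y1 y2].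
split; [ | split; [ | split ] ]; unfold herm, coord1, coord2, coord3, coord4; simpl; auto 10 with smo.
Qed.

Lemma dherm_0 (x y : C) : dherm x y 0%C 0%C = zero.
Proof. apply R4_ext; R4_coords; unfold dherm, coord1, coord2, coord3, coord4; simpl; ring. Qed.

Lemma spinor_null_pair (D : R * R -> Prop) (h k : R * R) (xi1 xi2 eta1 eta2 : R -> R -> C) :
  open D -> smoothC D xi1 -> smoothC D xi2 -> smoothC D eta1 -> smoothC D eta2 ->
  (forall u v, D (u, v) ->
    cdir k xi1 u v = 0%C /\ cdir k xi2 u v = 0%C /\ cdir h eta1 u v = 0%C /\ cdir h eta2 u v = 0%C /\
    (xi1 u v * eta2 u v - xi2 u v * eta1 u v)%C <> 0%C /\
    (xi1 u v * cdir h xi2 u v - xi2 u v * cdir h xi1 u v)%C = Copp 1 /\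
    (eta1 u v * cdir k eta2 u v - eta2 u v * cdir k eta1 u v)%C = 1%C) ->
  null_pair D h k (fun u v => herm (xi1 u v) (xi2 u v)) (fun u v => herm (eta1 u v) (eta2 u v)).
Proof.
intros HD s1 s2 t1 t2 H.
constructor; try (now apply smooth4_herm); intros u v Huv;
  destruct (H u v Huv) as (h1 & h2 & h3 & h4 & h5 & h6 & h7).
- rewrite mink_herm; unfold Cnorm2; simpl; ring.
- rewrite mink_herm; unfold Cnorm2; simpl; ring.
- rewrite mink_herm; intros E; apply h5; revert E.
  generalize (xi1 u v * eta2 u v - xi2 u v * eta1 u v)%C; intros w E.
  unfold Cnorm2 in E; pose proof (pow2_ge_0 (fst w)); pose proof (pow2_ge_0 (snd w)).
  apply C_ext; simpl; apply Rsqr_0_uniq; rewrite Rsqr_pow2; lra.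
- rewrite (vdir_herm D), h1, h2; auto; apply dherm_0.
- rewrite (vdir_herm D), h3, h4; auto; apply dherm_0.
- rewrite (vdir_herm D), mink_dherm, h6; auto; unfold Cnorm2; simpl; ring.
- rewrite (vdir_herm D), mink_dherm, h7; auto; unfold Cnorm2; simpl; ring.
Qed.

(** * Recovering the surface and its frame from a null pair *)

Lemma diamond_potential (x0 y0 eps : R) (a b : R -> R -> R) :
  let D := diamond x0 y0 eps in
  smooth D a -> smooth D b ->
  (forall u v, D (u, v) -> dir (1, -1) a u v = 0) -> (forall u v, D (u, v) -> dir (1, 1) b u v = 0) ->
  exists z, smooth D z /\ forall u v, D (u, v) -> dir (1, 1) z u v = a u v /\ dir (1, -1) z u v = b u v.
Proof.
intros D sa sb da db.
assert (HD : open D) by apply open_diamond.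
destruct (diamond_antiderivative x0 y0 eps 1 a (or_introl eq_refl) sa da) as (A & sA & dA).
destruct (diamond_antiderivative x0 y0 eps (-1) b (or_intror eq_refl) sb) as (B & sB & dB).
{ intros u v Huv; replace (- (-1)) with 1 by ring; auto. }
fold D in sA, dA, sB, dB.
(* [A] is a function of u + v and [B] of u - v; the halves compensate the derivative 2 of these
   coordinates along [(1, 1)] and [(1, -1)]. *)
exists (fun u v => / 2 * A u v + / 2 * B u v); split; auto with smo.
intros u v Huv; rewrite !(dir_plus D _ (fun x y => / 2 * A x y)), !(dir_mult D _ (fun _ _ => / 2)), !dir_const, !dA, !dB; auto with smo.
cbn [fst snd]; split; field.
Qed.

Lemma diamond_potential4 (x0 y0 eps : R) (a b : R -> R -> R4) :
  let D := diamond x0 y0 eps in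
  smooth4 D a -> smooth4 D b ->
  (forall u v, D (u, v) -> vdir (1, -1) a u v = zero) -> (forall u v, D (u, v) -> vdir (1, 1) b u v = zero) ->
  exists z, smooth4 D z /\ forall u v, D (u, v) -> vdir (1, 1) z u v = a u v /\ vdir (1, -1) z u v = b u v.
Proof.
intros D (a1 & a2 & a3 & a4) (b1 & b2 & b3 & b4) da db.
destruct (diamond_potential x0 y0 eps _ _ a1 b1) as (z1 & s1 & d1).
{ intros u v Huv; exact (f_equal coord1 (da u v Huv)). }
{ intros u v Huv; exact (f_equal coord1 (db u v Huv)). }
destruct (diamond_potential x0 y0 eps _ _ a2 b2) as (z2 & s2 & d2).
{ intros u v Huv; exact (f_equal coord2 (da u v Huv)). }
{ intros u v Huv; exact (f_equal coord2 (db u v Huv)). }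
destruct (diamond_potential x0 y0 eps _ _ a3 b3) as (z3 & s3 & d3).
{ intros u v Huv; exact (f_equal coord3 (da u v Huv)). }
{ intros u v Huv; exact (f_equal coord3 (db u v Huv)). }
destruct (diamond_potential x0 y0 eps _ _ a4 b4) as (z4 & s4 & d4).
{ intros u v Huv; exact (f_equal coord4 (da u v Huv)). }
{ intros u v Huv; exact (f_equal coord4 (db u v Huv)). }
exists (fun u v => (z1 u v, z2 u v, z3 u v, z4 u v)); split.
- split; [ | split; [ | split ] ]; auto.
- intros u v Huv; destruct (d1 u v Huv), (d2 u v Huv), (d3 u v Huv), (d4 u v Huv).
  split; apply R4_ext; auto.
Qed.

(** Two forms of c = 4 (n^2 - m^2) / r^2: the first gives 8 + 2 c = 16 n^2 / r^2, the square of P +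
    Q, the second 8 - 2 c = 16 m^2 / r^2, the square of P - Q. *)
Lemma angle_coefficients (n m r : R) : r <> 0 -> r ^ 2 = n ^ 2 + m ^ 2 ->
  4 * (n ^ 2 - m ^ 2) / r ^ 2 = 8 * n ^ 2 / r ^ 2 - 4 /\ 4 * (n ^ 2 - m ^ 2) / r ^ 2 = 4 - 8 * m ^ 2 / r ^ 2.
Proof.
intros r0 E; split; apply Rminus_diag_uniq.
- transitivity (4 * (r ^ 2 - (n ^ 2 + m ^ 2)) / r ^ 2); [ field; auto | rewrite <- E; field; auto ].
- transitivity (4 * (n ^ 2 + m ^ 2 - r ^ 2) / r ^ 2); [ field; auto | rewrite <- E; field; auto ].
Qed.

Lemma null_pair_canon_frame (D : R * R -> Prop) (z a b : R -> R -> R4) (nu mu rho : R -> R -> R) :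
  open D -> null_pair D (1, 1) (1, -1) a b -> smooth4 D z ->
  smooth D nu -> smooth D mu -> smooth D rho ->
  (forall u v, D (u, v) -> vdir (1, 1) z u v = a u v /\ vdir (1, -1) z u v = b u v) ->
  (forall u v, D (u, v) -> 0 < rho u v /\ rho u v ^ 2 = nu u v ^ 2 + mu u v ^ 2 /\ nu u v * mu u v <> 0) ->
  (forall u v, D (u, v) -> np_f a b u v = - (2 / rho u v)) ->
  (forall u v, D (u, v) -> np_c (1, 1) (1, -1) a b u v = 4 * (nu u v ^ 2 - mu u v ^ 2) / rho u v ^ 2) ->
  exists n1 n2, canon_frame D z n1 n2 nu mu rho.
Proof.
intros HD N Hz snu smu srho Hab Hr Hf Hc.
assert (N' := null_pair_sym _ _ _ _ _ N).
set (P := np_P (1, 1) a b); set (Q := np_P (1, -1) b a).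
assert (sP : smooth4 D P) by apply (np_smooth_P HD N).
assert (sQ : smooth4 D Q) by apply (np_smooth_P HD N').
assert (nu0 : forall u v, D (u, v) -> nu u v <> 0).
{ intros u v Huv E; destruct (Hr u v Huv) as (_ & _ & H); apply H; rewrite E; ring. }
assert (mu0 : forall u v, D (u, v) -> mu u v <> 0).
{ intros u v Huv E; destruct (Hr u v Huv) as (_ & _ & H); apply H; rewrite E; ring. }
(* Solved from P = 2 (nu n1 + mu n2) / rho and Q = 2 (nu n1 - mu n2) / rho, the relations that hold
   on a surface in canonical parameters. *)
set (n1 := fun u v => scal (/ 4 * (rho u v / nu u v)) (plus (P u v) (Q u v))).
set (n2 := fun u v => scal (/ 4 * (rho u v / mu u v)) (minus (P u v) (Q u v))).
assert (sn1 : smooth D (fun u v => / 4 * (rho u v / nu u v))).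
{ apply smooth_mult; auto with smo; now apply smooth_div. }
assert (sn2 : smooth D (fun u v => / 4 * (rho u v / mu u v))).
{ apply smooth_mult; auto with smo; now apply smooth_div. }
assert (zuv : forall u v, D (u, v) ->
  vdir (1, 0) z u v = scal (/ 2) (plus (a u v) (b u v)) /\ vdir (0, 1) z u v = scal (/ 2) (minus (a u v) (b u v))).
{ intros u v Huv; destruct (Hab u v Huv) as [<- <-].
  rewrite (vdir_linear (1, 1)), (vdir_linear (1, -1)); cbn [fst snd].
  generalize (vdir (1, 0) z u v) (vdir (0, 1) z u v); intros; split; apply R4_ext; R4_coords; field. }
assert (sa := np_smooth_a N); assert (sb := np_smooth_b N).
assert (dzu : forall l u v, D (u, v) -> vdir l (vdir (1, 0) z) u v = scal (/ 2) (plus (vdir l a u v) (vdir l b u v))).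
{ intros l u v Huv; rewrite (vdir_ext D l _ (fun x y => scal (/ 2) (plus (a x y) (b x y)))); auto.
  - rewrite (vdir_scal D l (fun _ _ => / 2)), dir_const, (vdir_plus D); auto with smo.
    generalize (vdir l a u v) (vdir l b u v) (a u v) (b u v); intros; R4_ring.
  - intros; now apply zuv. }
assert (dzv : forall l u v, D (u, v) -> vdir l (vdir (0, 1) z) u v = scal (/ 2) (minus (vdir l a u v) (vdir l b u v))).
{ intros l u v Huv; rewrite (vdir_ext D l _ (fun x y => scal (/ 2) (minus (a x y) (b x y)))); auto.
  - rewrite (vdir_scal D l (fun _ _ => / 2)), dir_const, (vdir_minus D); auto with smo.
    generalize (vdir l a u v) (vdir l b u v) (a u v) (b u v); intros; R4_ring.
  - intros; now apply zuv. }
assert (dab : forall u v, D (u, v) ->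
  vdir (1, 0) a u v = scal (/ 2) (vdir (1, 1) a u v) /\ vdir (0, 1) a u v = scal (/ 2) (vdir (1, 1) a u v) /\
  vdir (1, 0) b u v = scal (/ 2) (vdir (1, -1) b u v) /\ vdir (0, 1) b u v = scal (- / 2) (vdir (1, -1) b u v)).
{ intros u v Huv.
  assert (A := np_dka N u v Huv); assert (B := np_dhb N u v Huv).
  rewrite vdir_linear in A, B; cbn [fst snd] in A, B.
  rewrite (vdir_linear (1, 1) a), (vdir_linear (1, -1) b); cbn [fst snd].
  revert A B; generalize (vdir (1, 0) a u v) (vdir (0, 1) a u v) (vdir (1, 0) b u v) (vdir (0, 1) b u v).
  intros p q r s A B.
  assert (Epq : p = q).
  { transitivity (plus (plus (scal 1 p) (scal (-1) q)) q); [ R4_ring | rewrite A; R4_ring ]. }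
  assert (Ers : r = scal (-1) s).
  { transitivity (plus (plus (scal 1 r) (scal 1 s)) (scal (-1) s)); [ R4_ring | rewrite B; R4_ring ]. }
  subst p r; split; [ | split; [ | split ] ]; apply R4_ext; R4_coords; field. }
assert (orth : forall u v, D (u, v) ->
  mink (P u v) (vdir (1, 0) z u v) = 0 /\ mink (P u v) (vdir (0, 1) z u v) = 0 /\
  mink (Q u v) (vdir (1, 0) z u v) = 0 /\ mink (Q u v) (vdir (0, 1) z u v) = 0).
{ intros u v Huv; destruct (zuv u v Huv) as [-> ->]; mink_expand.
  unfold P, Q; rewrite (np_P_a HD N), (np_P_b HD N), (np_P_a HD N'), (np_P_b HD N'); auto.
  repeat split; ring. }
assert (Gram : forall u v, D (u, v) ->
  mink (P u v) (P u v) = 4 /\ mink (Q u v) (Q u v) = 4 /\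
  mink (P u v) (Q u v) = 4 * (nu u v ^ 2 - mu u v ^ 2) / rho u v ^ 2 /\
  mink (Q u v) (P u v) = 4 * (nu u v ^ 2 - mu u v ^ 2) / rho u v ^ 2).
{ intros u v Huv; rewrite (mink_sym (Q u v) (P u v)), <- Hc; auto; unfold P, Q.
  rewrite (np_P_P HD N), (np_P_P HD N'); auto. }
assert (dPQ : forall u v, D (u, v) ->
  mink (vdir (1, 1) a u v) (P u v) = 4 /\ mink (vdir (1, -1) b u v) (Q u v) = 4 /\
  mink (vdir (1, 1) a u v) (Q u v) = 4 * (nu u v ^ 2 - mu u v ^ 2) / rho u v ^ 2 /\
  mink (vdir (1, -1) b u v) (P u v) = 4 * (nu u v ^ 2 - mu u v ^ 2) / rho u v ^ 2).
{ intros u v Huv; rewrite <- Hc; auto; unfold P, Q.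
  rewrite (np_dha_Q HD N), (np_dha_Q HD N'), np_c_sym; auto.
  rewrite !(mink_sym (vdir _ _ _ _)), (np_P_dha HD N), (np_P_dha HD N'); auto. }
exists n1, n2; constructor; auto; try (apply smooth4_scal; auto with smo);
  intros u v Huv; destruct (Hr u v Huv) as (r1 & r2 & r3); assert (m0 := mu0 u v Huv); assert (k0 := nu0 u v Huv);
  assert (r0 : rho u v <> 0) by lra;
  destruct (zuv u v Huv) as [zu zv]; destruct (dab u v Huv) as (da1 & da2 & db1 & db2);
  destruct (orth u v Huv) as (o1 & o2 & o3 & o4); destruct (Gram u v Huv) as (g1 & g2 & g3 & g4);
  destruct (dPQ u v Huv) as (p1 & p2 & p3 & p4); auto;
  try (rewrite zu, ?zv; mink_expand; rewrite (mink_sym (b u v) (a u v)), (np_aa N), (np_bb N); auto;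
       change (mink (a u v) (b u v)) with (np_f a b u v); rewrite Hf; auto; field; now auto);
  try (rewrite zv; mink_expand; rewrite (mink_sym (b u v) (a u v)), (np_aa N), (np_bb N); auto;
       change (mink (a u v) (b u v)) with (np_f a b u v); rewrite Hf; auto; field; now auto);
  try (unfold n1, n2; mink_expand; rewrite ?o1, ?o2, ?o3, ?o4; ring);
  unfold n1, n2; rewrite ?dzu, ?dzv, ?da1, ?da2, ?db1, ?db2; auto; mink_expand;
  rewrite ?g1, ?g2, ?g3, ?g4, ?p1, ?p2, ?p3, ?p4;
  revert r2 r1 r0 m0 k0; clear; generalize (nu u v) (mu u v) (rho u v);
  intros n m r r2 r1 r0 m0 k0; destruct (angle_coefficients n m r r0 r2) as [c1 c2];
  (* The first form of c suits the products with [n1], the second those with [n2]. *)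
  first [ rewrite c1; field; now auto | rewrite c2; field; now auto ].
Qed.

(** * Existence of the surface *)

Lemma Rpower_quarter (x : R) : 0 < x -> Rpower x (1 / 4) ^ 4 = x.
Proof.
intros Hx; rewrite <- Rpower_pow, Rpower_mult; [ | apply exp_pos ].
replace (1 / 4 * INR 4) with 1 by (simpl; field); now apply Rpower_1.
Qed.

(** nu - i mu is the square root of K + i kap with positive real part. It exists and depends
    smoothly on the data because kap <> 0 keeps K + i kap off the negative real axis, that is rho^2
    + K > 0. *)
Lemma half_angle (K kap rho : R) :
  kap <> 0 -> 0 < rho -> rho ^ 4 = K ^ 2 + kap ^ 2 ->
  let nu := sqrt ((rho ^ 2 + K) / 2) in
  let mu := - kap / (2 * nu) in
  0 < (rho ^ 2 + K) / 2 /\ nu <> 0 /\ rho ^ 2 = nu ^ 2 + mu ^ 2 /\ nu * mu <> 0 /\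
  K = nu ^ 2 - mu ^ 2 /\ kap = - 2 * nu * mu.
Proof.
intros Hk Hr H nu mu.
assert (Hk2 : 0 < kap ^ 2) by now apply pow2_gt_0.
assert (Hp : 0 < rho ^ 2 + K).
{ assert (0 < rho ^ 2) by (apply pow_lt; auto).
  destruct (Rle_or_lt (rho ^ 2 + K) 0) as [Hle | ]; auto.
  assert (rho ^ 2 * rho ^ 2 <= K * K) by nra.
  replace (rho ^ 2 * rho ^ 2) with (rho ^ 4) in * by ring; lra. }
assert (Hn : 0 < nu) by (apply sqrt_lt_R0; lra).
assert (Hn2 : nu ^ 2 = (rho ^ 2 + K) / 2).
{ unfold nu; rewrite <- Rsqr_pow2, Rsqr_sqrt; lra. }
assert (Hm : - 2 * nu * mu = - - kap) by (unfold mu; field; lra).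
assert (Hm2 : mu ^ 2 = (rho ^ 2 - K) / 2).
{ apply Rmult_eq_reg_l with (4 * nu ^ 2); [ | nra ].
  transitivity ((- 2 * nu * mu) ^ 2); [ ring | rewrite Hm ].
  rewrite Hn2; transitivity (rho ^ 4 - K ^ 2); [ rewrite H; ring | field ]. }
repeat split; lra.
Qed.

Lemma surface_exists (x0 y0 eps : R) (K kap : R -> R -> R) :
  let D := diamond x0 y0 eps in
  smooth D K -> smooth D kap ->
  (forall u v, D (u, v) -> K u v <> 0 /\ kap u v <> 0) ->
  (forall u v, D (u, v) -> eq_gauss K kap u v /\ eq_normal K kap (arctan_quot K kap) u v) ->
  exists z : R -> R -> R4,
    zmc_surface D z /\ canonical_parameters D z /\ gauss_curvature D z K /\ normal_curvature D z kap.
Proof.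
intros D sK sk H0 Heq.
assert (HD : open D) by apply open_diamond.
set (h := (1, 1) : R * R); set (k := (1, -1) : R * R).
set (rho := fun u v => Rpower (K u v ^ 2 + kap u v ^ 2) (1 / 4)).
set (nu := fun u v => sqrt ((rho u v ^ 2 + K u v) / 2)).
set (mu := fun u v => - kap u v / (2 * nu u v)).
assert (pos : forall u v, D (u, v) -> 0 < K u v ^ 2 + kap u v ^ 2).
{ intros u v Huv; destruct (H0 u v Huv) as [H1 H2].
  pose proof (pow2_gt_0 _ H1); pose proof (pow2_ge_0 (kap u v)); lra. }
assert (rpos : forall u v, 0 < rho u v) by (intros; apply exp_pos).
assert (r0 : forall u v, rho u v <> 0) by (intros u v; specialize (rpos u v); lra).
assert (r4 : forall u v, D (u, v) -> rho u v ^ 4 = K u v ^ 2 + kap u v ^ 2).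
{ intros; apply Rpower_quarter; auto. }
assert (half := fun u v Huv => half_angle (K u v) (kap u v) (rho u v) (proj2 (H0 u v Huv)) (rpos u v) (r4 u v Huv)).
change (forall u v, D (u, v) -> 0 < (rho u v ^ 2 + K u v) / 2 /\ nu u v <> 0 /\ rho u v ^ 2 = nu u v ^ 2 + mu u v ^ 2 /\
  nu u v * mu u v <> 0 /\ K u v = nu u v ^ 2 - mu u v ^ 2 /\ kap u v = - 2 * nu u v * mu u v) in half.
assert (srho : smooth D rho).
{ apply smooth_exp; auto; apply smooth_mult; auto with smo; apply smooth_ln; auto.
  apply smooth_ext with (fun u v => K u v * K u v + kap u v * kap u v); auto with smo; intros; ring. }
assert (snu : smooth D nu).
{ apply smooth_sqrt; auto; [ intros; now apply half | ].
  apply smooth_ext with (fun u v => (rho u v * rho u v + K u v) * / 2); auto with smo; intros; unfold Rdiv; ring. }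
assert (smu : smooth D mu).
{ apply smooth_div; auto with smo; intros u v Huv E; destruct (half u v Huv) as (_ & n0 & _); lra. }
set (L := fun u v => ln (rho u v)).
set (T := arctan_quot K kap).
assert (sL : smooth D L) by (apply smooth_ln; auto).
assert (sT : smooth D T).
{ apply smooth_atan; auto; apply smooth_div; auto; intros; now apply H0. }
(* [dL] and [dT] are the real and imaginary parts of d log (K + i kap) = d (2 L + i T), cleared of
   the denominator rho^4 = K^2 + kap^2. *)
assert (dL : forall l u v, D (u, v) -> 2 * rho u v ^ 4 * dir l L u v = K u v * dir l K u v + kap u v * dir l kap u v).
{ intros l u v Huv.
  assert (E : dir l (fun x y => 4 * L x y) u v = dir l (fun x y => ln (K x y * K x y + kap x y * kap x y)) u v).
  { apply (dir_ext D); auto; intros x y Hxy; unfold L.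
    replace (K x y * K x y + kap x y * kap x y) with (rho x y ^ 4) by (rewrite r4; auto; ring).
    rewrite ln_pow; auto; simpl; ring. }
  assert (Hp : 0 < K u v * K u v + kap u v * kap u v) by (specialize (pos u v Huv); lra).
  rewrite (dir_mult D l (fun _ _ => 4)), dir_const in E; auto with smo.
  rewrite (dir_comp D l ln (/ (K u v * K u v + kap u v * kap u v)) (fun x y => K x y * K x y + kap x y * kap x y)) in E;
    auto with smo; [ | now apply is_derive_ln ].
  rewrite (dir_plus D l (fun x y => K x y * K x y)), !(dir_mult D) in E; auto with smo.
  rewrite r4; auto.
  replace (dir l L u v) with (/ 4 * (0 * L u v + 4 * dir l L u v)) by field.
  rewrite E; field; lra. }
assert (dT : forall l u v, D (u, v) -> rho u v ^ 4 * dir l T u v = K u v * dir l kap u v - kap u v * dir l K u v).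
{ intros l u v Huv; destruct (H0 u v Huv) as [HK Hk].
  unfold T, arctan_quot.
  rewrite (dir_comp D l atan (/ (1 + (kap u v / K u v) ^ 2)) (fun x y => kap x y / K x y)); auto.
  - rewrite (dir_div D), r4; auto; [ | intros; now apply H0 ].
    field; split; auto; specialize (pos u v Huv); lra.
  - apply smooth_div; auto; intros; now apply H0.
  - apply is_derive_Reals, derivable_pt_lim_atan. }
(* The power rho^(3/2), the modulus by which the square root of K + i kap is divided in [psi]. *)
set (r3 := fun u v => rho u v * sqrt (rho u v)).
assert (r30 : forall u v, r3 u v <> 0).
{ intros u v; unfold r3; apply Rmult_integral_contrapositive_currified; auto.
  assert (H := sqrt_lt_R0 _ (rpos u v)); lra. }
assert (r32 : forall u v, r3 u v * r3 u v = rho u v ^ 3).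
{ intros u v; unfold r3.
  transitivity (rho u v ^ 2 * (sqrt (rho u v) * sqrt (rho u v))); [ ring | ].
  rewrite sqrt_sqrt; [ ring | apply Rlt_le; auto ]. }
assert (sr3 : smooth D r3) by (unfold r3; apply smooth_mult; auto; apply smooth_sqrt; auto).
(* The minus sign comes from kap = -2 nu mu: it is nu - i mu whose square is K + i kap. *)
set (psi := fun u v => (nu u v / r3 u v, - (mu u v / r3 u v)) : C).
assert (spsi : smoothC D psi).
{ split; simpl; try apply smooth_opp; auto; apply smooth_div; auto. }
assert (psi2 : forall u v, D (u, v) -> Cmult (psi u v) (psi u v) = (K u v / rho u v ^ 3, kap u v / rho u v ^ 3)).
{ intros u v Huv; destruct (half u v Huv) as (_ & _ & _ & _ & E1 & E2).
  rewrite <- r32; apply C_ext; unfold psi; simpl.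
  - rewrite E1 at 1; field; auto.
  - rewrite E2 at 1; field; auto. }
assert (psi0 : forall u v, D (u, v) -> psi u v <> 0%C).
{ intros u v Huv E; destruct (half u v Huv) as (_ & n0 & _).
  apply (f_equal fst) in E; unfold psi in E; simpl in E; apply n0.
  apply Rmult_eq_reg_r with (/ r3 u v); [ | now apply Rinv_neq_0_compat ].
  change (nu u v * / r3 u v = 0) in E; rewrite E; ring. }
assert (psin : forall u v, D (u, v) -> Cnorm2 (psi u v) = / rho u v).
{ intros u v Huv; destruct (half u v Huv) as (_ & _ & E & _).
  unfold Cnorm2, psi; simpl.
  transitivity ((nu u v ^ 2 + mu u v ^ 2) / (r3 u v * r3 u v)); [ field; auto | ].
  rewrite r32, <- E; field; auto. }
(* The logarithmic derivative of [psi]. The identity [dpsi] is checked on psi^2, whose parts are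
   explicit in K, kap and rho, and then divided by 2 psi. *)
set (zeta := fun l u v => (- / 2 * dir l L u v, / 2 * dir l T u v) : C).
assert (szeta : forall l, smoothC D (zeta l)) by (intros l; split; simpl; auto with smo).
assert (dpsi : forall l u v, D (u, v) -> cdir l psi u v = Cmult (zeta l u v) (psi u v)).
{ intros l u v Huv.
  assert (p0 := psi0 u v Huv).
  apply C_mult_eq_reg_l with (psi u v * 2)%C.
  { apply Cmult_neq_0; auto; intros E; apply (f_equal fst) in E; simpl in E; lra. }
  transitivity (cdir l (fun x y => Cmult (psi x y) (psi x y)) u v).
  { rewrite (cdir_mult D); auto; ring. }
  transitivity (2 * zeta l u v * (psi u v * psi u v))%C; [ | ring ].
  rewrite (cdir_ext D l _ (fun x y => (K x y / rho x y ^ 3, kap x y / rho x y ^ 3))), psi2; auto.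
  assert (EL := dL l u v Huv); assert (ET := dT l u v Huv); assert (E4 := r4 u v Huv).
  assert (Er : dir l rho u v = rho u v * dir l L u v).
  { unfold L; rewrite (dir_comp D l ln (/ rho u v)); auto; [ field; auto | now apply is_derive_ln ]. }
  assert (nz : rho u v ^ 4 <> 0) by (apply pow_nonzero; auto).
  assert (EK : dir l K u v = 2 * K u v * dir l L u v - kap u v * dir l T u v).
  { apply Rmult_eq_reg_l with (2 := nz).
    transitivity (K u v * (2 * rho u v ^ 4 * dir l L u v) - kap u v * (rho u v ^ 4 * dir l T u v)); [ | ring ].
    rewrite EL, ET, E4; ring. }
  assert (Ek : dir l kap u v = 2 * kap u v * dir l L u v + K u v * dir l T u v).
  { apply Rmult_eq_reg_l with (2 := nz).
    transitivity (kap u v * (2 * rho u v ^ 4 * dir l L u v) + K u v * (rho u v ^ 4 * dir l T u v)); [ | ring ].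
    rewrite EL, ET, E4; ring. }
  assert (d3 : dir l (fun x y => rho x y ^ 3) u v = 3 * rho u v ^ 3 * dir l L u v).
  { rewrite (dir_comp D l (fun x => x ^ 3) (3 * rho u v ^ 2)); auto.
    - rewrite Er; ring.
    - auto_derive; auto; ring. }
  assert (s3 : smooth D (fun x y => rho x y ^ 3)).
  { apply smooth_ext with (fun x y => rho x y * (rho x y * rho x y)); auto with smo; intros; ring. }
  apply C_ext; unfold cdir; cbn [fst snd].
  - rewrite (dir_div D), d3, EK; auto; [ | intros; apply pow_nonzero; auto ].
    unfold zeta; simpl; field; auto.
  - rewrite (dir_div D), d3, Ek; auto; [ | intros; apply pow_nonzero; auto ].
    unfold zeta; simpl; field; auto. }
assert (boxL : forall u v, D (u, v) -> dir h (dir k (fun x y => / 2 * L x y)) u v = K u v / rho u v).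
{ intros u v Huv; rewrite <- (box_dir D); auto with smo.
  rewrite <- (box_ext D (fun s t => ln (Rpower (K s t ^ 2 + kap s t ^ 2) (1 / 8)))); auto.
  - assert (E := proj1 (Heq u v Huv)); unfold eq_gauss in E; fold (rho u v) in E.
    rewrite <- E at 1; field; auto.
  - intros x y Hxy; exact (proj2 (Rpower_quartic _ (rho x y) (rpos x y) (eq_sym (r4 x y Hxy)))). }
assert (boxT : forall u v, D (u, v) -> dir h (dir k T) u v = 2 * kap u v / rho u v).
{ intros u v Huv; rewrite <- (box_dir D); auto.
  assert (E := proj2 (Heq u v Huv)); unfold eq_normal in E; fold (rho u v) T in E.
  rewrite <- E; field; auto. }
(* Both equations of the system combine into one complex equation: the right-hand side is -conj(K +
   i kap) / rho. *)
assert (dzeta : forall u v, D (u, v) -> cdir h (zeta k) u v = (- (K u v / rho u v), kap u v / rho u v)).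
{ intros u v Huv; apply C_ext; unfold cdir, zeta; cbn [fst snd].
  - rewrite <- boxL, <- dir_opp; auto; apply (dir_ext D); auto; intros x y Hxy.
    rewrite (dir_mult D k (fun _ _ => / 2)), dir_const; auto with smo; ring.
  - rewrite (dir_mult D h (fun _ _ => / 2)), dir_const, boxT; auto with smo; field; auto. }
(* With d_k psi = zeta_k psi, the left-hand side is psi^2 d_h zeta_k, the product of (K + i kap) /
   rho^3 with -conj(K + i kap) / rho. *)
assert (liou : forall u v, D (u, v) ->
  (psi u v * cdir h (cdir k psi) u v - cdir h psi u v * cdir k psi u v)%C = Copp 1).
{ intros u v Huv.
  rewrite (cdir_ext D h (cdir k psi) (fun x y => Cmult (zeta k x y) (psi x y))), (cdir_mult D), !dpsi; auto.
  transitivity ((psi u v * psi u v) * cdir h (zeta k) u v)%C; [ ring | ].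
  rewrite psi2, dzeta; auto.
  assert (E := r4 u v Huv); apply C_ext; simpl.
  - transitivity (- (K u v ^ 2 + kap u v ^ 2) / rho u v ^ 4); [ field; auto | rewrite <- E; field; auto ].
  - field; auto. }
destruct (liouville_factor spsi psi0 liou) as (xi1 & xi2 & eta1 & eta2 & s1 & s2 & t1 & t2 & F).
fold D h k in s1, s2, t1, t2, F.
set (a := fun u v => herm (xi1 u v) (xi2 u v)); set (b := fun u v => herm (eta1 u v) (eta2 u v)).
assert (N : null_pair D h k a b).
{ apply spinor_null_pair; auto; intros u v Huv; destruct (F u v Huv) as (f1 & f2 & f3 & f4 & f5 & f6 & f7).
  repeat split; auto; rewrite f5; auto. }
assert (Ef : forall u v, D (u, v) -> np_f a b u v = - (2 / rho u v)).
{ intros u v Huv; unfold np_f, a, b; rewrite mink_herm.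
  destruct (F u v Huv) as (_ & _ & _ & _ & -> & _); rewrite psin; auto; unfold Rdiv; ring. }
(* The Gauss equation expresses [np_c] through f = -2 / rho, and the first equation of the system
   evaluates the result as 4 K / rho^2. *)
assert (Ec : forall u v, D (u, v) -> np_c h k a b u v = 4 * (nu u v ^ 2 - mu u v ^ 2) / rho u v ^ 2).
{ intros u v Huv; destruct (half u v Huv) as (_ & _ & _ & _ & <- & _).
  assert (E := half_ln_mixed D h k rho (np_f a b) u v HD srho (np_smooth_f HD N) (fun x y _ => rpos x y) Ef Huv).
  change (fun x y => / 2 * ln (rho x y)) with (fun x y => / 2 * L x y) in E.
  rewrite boxL, <- (np_c_eq HD N), Ef in E; auto.
  transitivity ((- / 2 * (np_c h k a b u v / - (2 / rho u v))) * 4 / rho u v); [ field; auto | ].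
  rewrite <- E; field; auto. }
destruct (diamond_potential4 x0 y0 eps a b) as (z & sz & dz).
- apply (np_smooth_a N).
- apply (np_smooth_b N).
- apply (np_dka N).
- apply (np_dhb N).
- destruct (null_pair_canon_frame D z a b nu mu rho) as (n1 & n2 & C); auto.
  { intros u v Huv; destruct (half u v Huv) as (_ & _ & E1 & E2 & _); auto. }
  exists z; apply (canon_frame_surface D z n1 n2 nu mu rho); auto.
  intros u v Huv; destruct (half u v Huv) as (_ & _ & _ & _ & E1 & E2); auto.
Qed.

Theorem theorem5p1 :
  (forall (D : R * R -> Prop) (z : R -> R -> R4) (K kap : R -> R -> R),
     plane_domain D ->
     zmc_surface D z ->
     canonical_parameters D z ->
     gauss_curvature D z K ->
     normal_curvature D z kap ->
     (forall u v, D (u, v) ->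
        eq_gauss K kap u v /\
        (K u v <> 0 -> eq_normal K kap (arctan_quot K kap) u v)) /\
     (forall (U : R * R -> Prop) (theta : R -> R -> R),
        open U -> (forall p, U p -> D p) ->
        arctan_determination U K kap theta ->
        forall u v, U (u, v) -> eq_normal K kap theta u v))
  /\
  (forall (D : R * R -> Prop) (K kap : R -> R -> R),
     plane_domain D ->
     smooth D K -> smooth D kap ->
     (forall u v, D (u, v) -> K u v <> 0 /\ kap u v <> 0) ->
     (forall u v, D (u, v) ->
        eq_gauss K kap u v /\ eq_normal K kap (arctan_quot K kap) u v) ->
     forall p : R * R, D p ->
     exists D0 : R * R -> Prop,
       plane_domain D0 /\ D0 p /\ (forall q, D0 q -> D q) /\
       (exists z : R -> R -> R4,
          zmc_surface D0 z /\ canonical_parameters D0 z /\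
          gauss_curvature D0 z K /\ normal_curvature D0 z kap) /\
       (forall z1 z2 : R -> R -> R4,
          zmc_surface D0 z1 -> canonical_parameters D0 z1 ->
          gauss_curvature D0 z1 K -> normal_curvature D0 z1 kap ->
          zmc_surface D0 z2 -> canonical_parameters D0 z2 ->
          gauss_curvature D0 z2 K -> normal_curvature D0 z2 kap ->
          exists M : R4 -> R4, motion M /\
            forall u v, D0 (u, v) -> z2 u v = M (z1 u v))).
Proof.
split.
- intros D z K kap; apply surface_equations.
- intros D K kap [HD _] sK sk H0 Heq [x0 y0] Hp.
  (* One diamond around the point serves both claims: the integrations of the existence proof and
     the constancy arguments of uniqueness hold on all of it. *)
  destruct (diamond_inside D x0 y0 HD Hp) as (eps & Heps & Hin).
  exists (diamond x0 y0 eps); split; [ | split; [ | split; [ | split ] ] ]; auto.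
  + split; [ apply open_diamond | apply connected_diamond ].
  + now apply diamond_center.
  + apply surface_exists; auto; now apply (smooth_subset D).
  + intros z1 z2 [s1 _] c1 g1 k1 [s2 _] c2 g2 k2.
    now apply (surface_unique x0 y0 eps z1 z2 K kap).
Qed.
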